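(* Let $\tau\in\mathbb C$ with $\operatorname{Im}\tau>0$, let $\mathfrak u\in\mathbb C$, $\mathfrak u\notin\mathbb Z\tau+\mathbb Z$, let $h\in\mathbb C$ be an extra parameter, and define $$\Lambda(x;\mathfrak u|\tau)=\theta_1(x-\mathfrak u|\tau)\exp\left(\frac{\theta_1'(\mathfrak u|\tau)}{\theta_1(\mathfrak u|\tau)}x+hx\right).$$ Then the six functions $\Lambda=\Lambda(x;\mathfrak u|\tau)$, $\theta_1'=\theta_1'(x|\tau)$ and $\theta_k=\theta_k(x|\tau)$ ($k=1,2,3,4$) of $x$ satisfy the closed autonomous system of ODEs over the field $\mathbb C(\eta,\vartheta^2,\theta(\mathfrak u))$: $$\frac{\partial\theta_k}{\partial x}=\frac{\theta_1'}{\theta_1}\theta_k-\pi\vartheta_k^2\,\frac{\theta_n\theta_m}{\theta_1},\qquad n=\frac{8k-28}{3k-10},\quad m=\frac{10k-28}{3k-8},$$ $$\frac{\partial\theta_1'}{\partial x}=\frac{\theta_1'^2}{\theta_1}-\pi^2\vartheta_3^2\vartheta_4^2\,\frac{\theta_2^2}{\theta_1}-4\left\{\eta+\frac{\pi^2}{12}\big(\vartheta_3^4+\vartheta_4^4\big)\right\}\theta_1,$$ $$\frac1\Lambda\frac{\partial\Lambda}{\partial x}=\frac{\theta_1'}{\theta_1}+\frac{\pi\vartheta_2^2}{\theta_1(\mathfrak u)}\cdot\frac{\theta_1^3(\mathfrak u)\,\theta_2\theta_3\theta_4+\theta_2(\mathfrak u)\theta_3(\mathfrak u)\theta_4(\mathfrak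 u)\,\theta_1^3}{\theta_1\big(\theta_2^2(\mathfrak u)\,\theta_1^2-\theta_1^2(\mathfrak u)\,\theta_2^2\big)}+h.$$
   Context: Jacobi theta-functions: $\theta\left[{\varepsilon\atop\delta}\right](x|\tau)=\sum_{k\in\mathbb Z}e^{\pi i(k+\varepsilon/2)^2\tau+2\pi i(k+\varepsilon/2)(x+\delta/2)}$, with $\theta_1=-\theta\left[{1\atop1}\right]$, $\theta_2=\theta\left[{1\atop0}\right]$, $\theta_3=\theta\left[{0\atop0}\right]$, $\theta_4=\theta\left[{0\atop1}\right]$; $\theta_1'(x|\tau)=\partial_x\theta_1(x|\tau)$. $\vartheta_k=\theta_k(0|\tau)$ are the theta-constants (so $\vartheta_1=0$). $\theta_k$ without argument means $\theta_k(x|\tau)$, and $\theta_k(\mathfrak u)=\theta_k(\mathfrak u|\tau)$. $\eta=\zeta(1|1,\tau)$, where $\zeta(z|\omega,\omega')$ is the Weierstrass zeta-function with half-periods $\omega,\omega'$. For $k=2,3,4$ the indices $(n,m)$ are $(3,4),(4,2),(2,3)$; for $k=1$ the second term is absent because $\vartheta_1=0$, and the equation reads $\partial_x\theta_1=\theta_1'$. $\mathbb C(\eta,\vartheta^2,\theta(\mathfrak u))$ denotes the field generated by $\eta$, the squares $\vartheta_k^2$ and the values $\theta_k(\mathfrak u)$; $h$ is also a constant. *)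

(* Defs.v *)
From Stdlib Require Import Reals ZArith.
From Coquelicot Require Import Coquelicot.

Open Scope C_scope.

Definition Cexp (z : C) : C :=
  RtoC (exp (Re z)) * (RtoC (cos (Im z)) + Ci * RtoC (sin (Im z))).

(* Sum of a complex series, as a total function: the real and imaginary parts
   are summed by Coquelicot's [Series] (see [CSeries_correct]). *)
Definition CSeries (a : nat -> C) : C :=
  (Series (fun n => Re (a n)), Series (fun n => Im (a n))).

Lemma CSeries_correct (a : nat -> C) (l : C) :
  @is_series C_AbsRing C_NormedModule a l -> CSeries a = l.
Proof.
  intro H.
  assert (E : forall n, sum_n a n
      = (sum_n (fun k => Re (a k)) n, sum_n (fun k => Im (a k)) n)).
  { induction n as [|n IH].
    - rewrite !sum_O; now destruct (a 0%nat).
    - rewrite !sum_Sn, IH; reflexivity. }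
  assert (H' : filterlim (fun n => (sum_n (fun k => Re (a k)) n,
      sum_n (fun k => Im (a k)) n)) eventually (locally l)).
  { apply (filterlim_ext (sum_n a)); [exact E | exact H]. }
  destruct l as [lr li]; unfold CSeries; f_equal; apply is_series_unique.
  - intros P [e HP].
    destruct (H' (fun z => P (Re z))) as [N HN];
      [now exists e; intros z [Hz _]; apply HP | now exists N].
  - intros P [e HP].
    destruct (H' (fun z => P (Im z))) as [N HN];
      [now exists e; intros z [_ Hz]; apply HP | now exists N].
Qed.

(* Sum over Z, split as k >= 0 and k <= -1.  It is only applied to absolutely
   convergent families, for which the order of summation is irrelevant. *)
Definition Zsum (a : Z -> C) : C :=
  CSeries (fun n => a (Z.of_nat n)) + CSeries (fun n => a (- Z.of_nat (S n))%Z).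

Definition ZtoC (k : Z) : C := RtoC (IZR k).

(* theta[eps, delta](x | tau) *)
Definition theta_char (eps delta x tau : C) : C :=
  Zsum (fun k =>
    Cexp (PI * Ci * (ZtoC k + eps / 2) ^ 2 * tau
          + 2 * PI * Ci * (ZtoC k + eps / 2) * (x + delta / 2))).

(* The index set is {1, 2, 3, 4}; other values of k are junk. *)
Definition theta (k : Z) (x tau : C) : C :=
  match k with
  | 1%Z => - theta_char 1 1 x tau
  | 2%Z => theta_char 1 0 x tau
  | 3%Z => theta_char 0 0 x tau
  | 4%Z => theta_char 0 1 x tau
  | _ => 0
  end.

Definition vartheta (k : Z) (tau : C) : C := theta k 0 tau.

Definition dtheta1 (x tau : C) : C := C_derive (fun y => theta 1 y tau) x.

(* zeta(z | w, w') with HALF-periods w, w'.  The lattice sum converges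
   absolutely, so it may be evaluated as an iterated sum. *)
Definition weierstrass_zeta (z w w' : C) : C :=
  / z +
  Zsum (fun m => Zsum (fun n =>
    if (Z.eqb m 0 && Z.eqb n 0)%bool then 0 else
    let W := 2 * ZtoC m * w + 2 * ZtoC n * w' in
    / (z - W) + / W + z / W ^ 2)).

Definition eta (tau : C) : C := weierstrass_zeta 1 1 tau.

Definition Lambda (x u h tau : C) : C :=
  theta 1 (x - u) tau * Cexp (dtheta1 u tau / theta 1 u tau * x + h * x).

(* Z-division is exact for k = 2, 3, 4 (see [index_nm]). *)
Definition index_n (k : Z) : Z := ((8 * k - 28) / (3 * k - 10))%Z.
Definition index_m (k : Z) : Z := ((10 * k - 28) / (3 * k - 8))%Z.

Lemma index_nm :
  (index_n 2, index_m 2) = (3, 4)%Z /\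
  (index_n 3, index_m 3) = (4, 2)%Z /\
  (index_n 4, index_m 4) = (2, 3)%Z.
Proof. repeat split. Qed.

(* Main.v *)
(** Multiplying two theta series and splitting the double sum by the parity of m + n gives bilinear
    formulas for theta_i(x + y) theta_j(x - y) with modulus 2 tau. Their first and second
    y-derivatives at y = 0 express theta_1' theta_k - theta_1 theta_k' and
    theta_1'' theta_1 - theta_1'^2 through theta functions, up to the two constants theta_1'(0) and
    theta_1'''(0) / theta_1'(0); differentiating the addition formula for theta_1 in x and in u
    gives the equation for Lambda. The constants come from a finite form of the triple product with
    Gaussian binomial coefficients: passing to the limit in it by dominated convergence yields
    theta_1'(0) = pi theta_2(0) theta_3(0) theta_4(0), the zeros of theta_1, and
    theta_1'''(0) / theta_1'(0) as a Lambert series. Summing the lattice series of eta over 1 first,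
    with the general term made even, turns eta into the same Lambert series by the partial fractions
    of pi^2 / sin^2 (pi z), so that theta_1'''(0) / theta_1'(0) = -12 eta. *)

Require Import Defs.
From Stdlib Require Import Reals ZArith List Permutation Lra Lia Classical ClassicalEpsilon.
From Coquelicot Require Import Coquelicot.
Open Scope C_scope.

(** * Unconditional sums *)

(** The functions of the statement are sums of total functions, so each series has to be dominated
    before its value means anything. Sums over duplicate-free lists, on an arbitrary index type,
    then permit reindexing by bijections, interchange of summations and splitting by parity. One
    weight, [zweight], that is (1 + |k|)^(-3/2), serves for all dominations: it beats Gaussians, and
    a product of two copies beats (1 + |m| + |n|)^(-3), the decay of the zeta series. The bilinear
    formulas leave the scale theta_1'(0) free in the Wronskians. For the unknowns theta_2''(0),
    theta_3''(0), theta_4''(0) they provide two relations from squares and a third one that involves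
    theta_1'''(0). This is why exactly two constants have to come from elsewhere. In the finite
    product the exponential w^k is replaced by an arbitrary test function of k, so that one
    recursion yields the values as well as the first and third moments, that is, the derivatives of
    theta_1 at 0. The third moment is where the Lambert series appears, one summand for each factor
    of the product. *)

Definition classic_eq_dec {I : Type} (x y : I) : {x = y} + {x <> y} :=
  excluded_middle_informative (x = y).

Fixpoint lsum {I : Type} (f : I -> C) (L : list I) : C :=
  match L with nil => 0 | i :: L' => f i + lsum f L' end.

Fixpoint lsumR {I : Type} (f : I -> R) (L : list I) : R :=
  match L with nil => 0%R | i :: L' => (f i + lsumR f L')%R end.

(** Convergence along the directed set of finite subsets, modelled by duplicate-free lists. It
    refers to no enumeration of [I], so bijections and products act on the index directly. *)
Definition has_sum {I : Type} (f : I -> C) (l : C) : Prop :=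
  forall eps : R, (0 < eps)%R -> exists L0, forall L, NoDup L -> incl L0 L ->
    (Cmod (lsum f L - l) < eps)%R.

(** Summability of a nonnegative family, expressed without the value of its sum. *)
Definition sums_bounded {I : Type} (g : I -> R) (M : R) : Prop :=
  forall L, NoDup L -> (lsumR g L <= M)%R.

Lemma NoDup_union {I : Type} (L1 L2 : list I) :
  exists L, NoDup L /\ incl L1 L /\ incl L2 L.
Proof.
  exists (nodup classic_eq_dec (L1 ++ L2)). split; [apply NoDup_nodup|].
  split; intros x Hx; apply nodup_In, in_or_app; auto.
Qed.

Lemma NoDup_complement {I : Type} (L0 L : list I) :
  NoDup L0 -> incl L0 L -> NoDup L ->
  exists R, Permutation L (L0 ++ R) /\ NoDup R /\ (forall x, In x R -> ~ In x L0).
Proof.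
  revert L. induction L0 as [|a L0 IH]; intros L H0 Hi HL.
  - exists L. repeat split; auto.
  - inversion H0 as [|a' L' Ha H0']; subst.
    assert (HaL : In a L) by (apply Hi; now left).
    destruct (in_split a L HaL) as [l1 [l2 ->]].
    assert (HP : Permutation (l1 ++ a :: l2) (a :: l1 ++ l2))
      by (symmetry; apply Permutation_middle).
    assert (HN : NoDup (a :: l1 ++ l2)) by (eapply Permutation_NoDup; eauto).
    inversion HN as [|a'' L'' Ha2 HN']; subst.
    destruct (IH (l1 ++ l2)) as [R [HR [HRn HRd]]]; auto.
    { intros x Hx. assert (Hx' : In x (a :: l1 ++ l2)).
      { eapply Permutation_in; eauto. apply Hi. now right. }
      destruct Hx' as [->|]; auto. contradiction. }
    exists R. repeat split; auto.
    + simpl. rewrite HP. now constructor.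
    + intros x Hx [->|Hx']; [|now apply (HRd x)].
      apply Ha2. apply (Permutation_in x (Permutation_sym HR)). apply in_or_app; auto.
Qed.

Lemma lsum_perm {I : Type} (f : I -> C) L1 L2 :
  Permutation L1 L2 -> lsum f L1 = lsum f L2.
Proof. induction 1; simpl; try congruence. ring. Qed.

Lemma lsumR_perm {I : Type} (f : I -> R) L1 L2 :
  Permutation L1 L2 -> lsumR f L1 = lsumR f L2.
Proof. induction 1; simpl; try congruence. ring. Qed.

Lemma lsum_app {I : Type} (f : I -> C) L1 L2 : lsum f (L1 ++ L2) = lsum f L1 + lsum f L2.
Proof. induction L1 as [|a L1 IH]; simpl; [ring|rewrite IH; ring]. Qed.

Lemma lsumR_app {I : Type} (f : I -> R) L1 L2 :
  lsumR f (L1 ++ L2) = (lsumR f L1 + lsumR f L2)%R.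
Proof. induction L1 as [|a L1 IH]; simpl; [ring|rewrite IH; ring]. Qed.

Lemma lsum_map {I J : Type} (h : I -> J) (f : J -> C) L :
  lsum f (map h L) = lsum (fun i => f (h i)) L.
Proof. induction L as [|a L IH]; simpl; [easy|now rewrite IH]. Qed.

Lemma lsumR_map {I J : Type} (h : I -> J) (f : J -> R) L :
  lsumR f (map h L) = lsumR (fun i => f (h i)) L.
Proof. induction L as [|a L IH]; simpl; [easy|now rewrite IH]. Qed.

Lemma lsum_plus {I : Type} (f g : I -> C) L :
  lsum (fun i => f i + g i) L = lsum f L + lsum g L.
Proof. induction L as [|a L IH]; simpl; [ring|rewrite IH; ring]. Qed.

Lemma lsum_scal {I : Type} (c : C) (f : I -> C) L :
  lsum (fun i => c * f i) L = c * lsum f L.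
Proof. induction L as [|a L IH]; simpl; [ring|rewrite IH; ring]. Qed.

Lemma lsumR_scal {I : Type} (c : R) (f : I -> R) L :
  lsumR (fun i => c * f i)%R L = (c * lsumR f L)%R.
Proof. induction L as [|a L IH]; simpl; [ring|rewrite IH; ring]. Qed.

Lemma lsum_ext {I : Type} (f g : I -> C) L :
  (forall i, f i = g i) -> lsum f L = lsum g L.
Proof. intros H; induction L as [|a L IH]; simpl; [easy|now rewrite IH, H]. Qed.

Lemma lsumR_le {I : Type} (f g : I -> R) L :
  (forall i, (f i <= g i)%R) -> (lsumR f L <= lsumR g L)%R.
Proof.
  intros H; induction L as [|a L IH]; simpl; [lra|]. specialize (H a). lra.
Qed.

Lemma lsumR_nonneg {I : Type} (g : I -> R) L :
  (forall i, (0 <= g i)%R) -> (0 <= lsumR g L)%R.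
Proof. intros H; induction L as [|a L IH]; simpl; [lra|]. specialize (H a). lra. Qed.

Lemma Cmod_lsum {I : Type} (f : I -> C) L : (Cmod (lsum f L) <= lsumR (fun i => Cmod (f i)) L)%R.
Proof.
  induction L as [|a L IH]; simpl; [rewrite Cmod_0; lra|].
  eapply Rle_trans; [apply Cmod_triangle|lra].
Qed.

Lemma lsumR_incl {I : Type} (g : I -> R) L L' :
  (forall i, (0 <= g i)%R) -> NoDup L -> NoDup L' -> incl L L' ->
  (lsumR g L <= lsumR g L')%R.
Proof.
  intros Hg HL HL' Hi. destruct (NoDup_complement L L' HL Hi HL') as [R [HR _]].
  rewrite (lsumR_perm g _ _ HR), lsumR_app. pose proof (lsumR_nonneg g R Hg). lra.
Qed.

Lemma sums_bounded_le {I : Type} (f g : I -> R) M :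
  (forall i, (f i <= g i)%R) -> sums_bounded g M -> sums_bounded f M.
Proof. intros H Hg L HL. eapply Rle_trans; [apply lsumR_le, H|auto]. Qed.

Lemma sums_bounded_scal {I : Type} (c : R) (g : I -> R) M :
  (0 <= c)%R -> sums_bounded g M -> sums_bounded (fun i => c * g i)%R (c * M).
Proof.
  intros Hc Hg L HL. rewrite lsumR_scal. apply Rmult_le_compat_l; auto.
Qed.

Lemma sums_bounded_inj {I J : Type} (h : J -> I) (g : I -> R) M :
  (forall j j', h j = h j' -> j = j') -> sums_bounded g M ->
  sums_bounded (fun j => g (h j)) M.
Proof.
  intros Hh Hg L HL. rewrite <- lsumR_map. apply Hg.
  apply FinFun.Injective_map_NoDup; auto.
Qed.

Lemma has_sum_unique {I : Type} (f : I -> C) l l' : has_sum f l -> has_sum f l' -> l = l'.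
Proof.
  intros H H'. apply NNPP; intros Hne.
  assert (Hp : (0 < Cmod (l - l'))%R).
  { apply Cmod_gt_0. intros E; apply Hne. now apply Ceq_minus. }
  destruct (H (Cmod (l - l') / 2)%R ltac:(lra)) as [L1 H1].
  destruct (H' (Cmod (l - l') / 2)%R ltac:(lra)) as [L2 H2].
  destruct (NoDup_union L1 L2) as [L [HL [Hi1 Hi2]]].
  specialize (H1 L HL Hi1). specialize (H2 L HL Hi2).
  replace (l - l') with (- (lsum f L - l) + (lsum f L - l')) in * by ring.
  pose proof (Cmod_triangle (- (lsum f L - l)) (lsum f L - l')) as HT.
  rewrite Cmod_opp in HT. lra.
Qed.

Lemma has_sum_ext {I : Type} (f g : I -> C) l :
  (forall i, f i = g i) -> has_sum f l -> has_sum g l.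
Proof.
  intros E H eps He. destruct (H eps He) as [L0 H0]. exists L0. intros L HL Hi.
  rewrite <- (lsum_ext f g L E). auto.
Qed.

Lemma has_sum_plus {I : Type} (f g : I -> C) l m :
  has_sum f l -> has_sum g m -> has_sum (fun i => f i + g i) (l + m).
Proof.
  intros Hf Hg eps He.
  destruct (Hf (eps / 2)%R ltac:(lra)) as [L1 H1].
  destruct (Hg (eps / 2)%R ltac:(lra)) as [L2 H2].
  exists (L1 ++ L2). intros L HL Hi. rewrite lsum_plus.
  specialize (H1 L HL (fun x Hx => Hi x (in_or_app _ _ _ (or_introl Hx)))).
  specialize (H2 L HL (fun x Hx => Hi x (in_or_app _ _ _ (or_intror Hx)))).
  replace (lsum f L + lsum g L - (l + m)) with ((lsum f L - l) + (lsum g L - m)) by ring.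
  eapply Rle_lt_trans; [apply Cmod_triangle|lra].
Qed.

Lemma has_sum_zero {I : Type} : has_sum (fun _ : I => 0) 0.
Proof.
  intros eps He. exists nil. intros L _ _.
  replace (lsum (fun _ : I => 0) L) with (RtoC 0).
  - now rewrite <- RtoC_minus, Rminus_0_r, Cmod_0.
  - induction L; simpl; [easy|rewrite <- IHL; ring].
Qed.

Lemma has_sum_scal {I : Type} (c : C) (f : I -> C) l :
  has_sum f l -> has_sum (fun i => c * f i) (c * l).
Proof.
  intros Hf. destruct (classic (c = 0)) as [->|Hc].
  { replace (0 * l) with (RtoC 0) by ring.
    apply (has_sum_ext (fun _ => 0)); [intros; ring|apply has_sum_zero]. }
  apply Cmod_gt_0 in Hc. intros eps He.
  destruct (Hf (eps / Cmod c)%R) as [L0 H0]; [now apply Rdiv_lt_0_compat|].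
  exists L0. intros L HL Hi. rewrite lsum_scal.
  replace (c * lsum f L - c * l) with (c * (lsum f L - l)) by ring.
  rewrite Cmod_mult. specialize (H0 L HL Hi).
  apply (Rmult_lt_compat_l (Cmod c)) in H0; auto.
  replace (Cmod c * (eps / Cmod c))%R with eps in H0 by (field; lra). auto.
Qed.

Lemma has_sum_minus {I : Type} (f g : I -> C) l m :
  has_sum f l -> has_sum g m -> has_sum (fun i => f i - g i) (l - m).
Proof.
  intros Hf Hg. apply (has_sum_ext (fun i => f i + (-1) * g i)); [intros; ring|].
  replace (l - m) with (l + (-1) * m) by ring.
  apply has_sum_plus, has_sum_scal; auto.
Qed.

Lemma has_sum_bij {I J : Type} (h : J -> I) (k : I -> J) (f : I -> C) l :
  (forall j, k (h j) = j) -> (forall i, h (k i) = i) ->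
  has_sum f l -> has_sum (fun j => f (h j)) l.
Proof.
  intros Hk Hh Hf eps He. destruct (Hf eps He) as [L0 H0].
  exists (map k L0). intros L HL Hi. rewrite <- lsum_map. apply H0.
  - apply FinFun.Injective_map_NoDup; auto. intros x y E.
    now rewrite <- (Hk x), <- (Hk y), E.
  - intros x Hx. rewrite <- (Hh x). apply in_map, Hi, in_map, Hx.
Qed.

Lemma has_sum_le {I : Type} (f : I -> C) l L0 M :
  has_sum f l -> (forall L, NoDup L -> incl L0 L -> (Cmod (lsum f L) <= M)%R) -> (Cmod l <= M)%R.
Proof.
  intros Hf HM. apply Rnot_lt_le. intros Hlt.
  destruct (Hf (Cmod l - M)%R ltac:(lra)) as [L1 H1].
  destruct (NoDup_union L0 L1) as [L [HL [Hi0 Hi1]]].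
  specialize (H1 L HL Hi1). specialize (HM L HL Hi0).
  pose proof (Cmod_triangle (lsum f L) (- (lsum f L - l))) as HT. rewrite Cmod_opp in HT.
  replace (lsum f L + - (lsum f L - l)) with l in HT by ring. lra.
Qed.

Lemma has_sum_bound {I : Type} (f : I -> C) (g : I -> R) l M :
  has_sum f l -> (forall i, (Cmod (f i) <= g i)%R) -> sums_bounded g M -> (Cmod l <= M)%R.
Proof.
  intros Hf Hg HM. apply (has_sum_le f l nil M Hf). intros L HL _.
  eapply Rle_trans; [apply Cmod_lsum|]. eapply Rle_trans; [apply lsumR_le, Hg|auto].
Qed.

(** The sum is the supremum of the finite sums. Its two defining properties are exported because
    [sums_tail] needs a finite set whose sum is within [eps] of it. *)
Lemma has_sum_nonneg {I : Type} (g : I -> R) M :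
  (forall i, (0 <= g i)%R) -> sums_bounded g M ->
  exists s : R, has_sum (fun i => RtoC (g i)) s /\
    (forall eps, (0 < eps)%R -> exists L0, NoDup L0 /\ (s - eps < lsumR g L0)%R) /\
    (forall L, NoDup L -> (lsumR g L <= s)%R).
Proof.
  intros Hg HM.
  destruct (completeness (fun r => exists L, NoDup L /\ r = lsumR g L)) as [s [Hub Hlub]].
  { exists M. intros r [L [HL ->]]. auto. }
  { exists 0%R, nil. split; [constructor|easy]. }
  assert (Hs : forall L, NoDup L -> (lsumR g L <= s)%R) by (intros L HL; apply Hub; eauto).
  assert (Happ : forall eps, (0 < eps)%R -> exists L0, NoDup L0 /\ (s - eps < lsumR g L0)%R).
  { intros eps He. apply NNPP. intros Hno.
    assert (s <= s - eps)%R; [|lra]. apply Hlub. intros r [L [HL ->]].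
    apply Rnot_lt_le. intros Hlt. apply Hno. eauto. }
  exists s. split; [|split]; auto.
  intros eps He. destruct (Happ eps He) as [L0 [HL0 H0]]. exists L0. intros L HL Hi.
  assert (E : lsum (fun i => RtoC (g i)) L = lsumR g L).
  { clear. induction L as [|a L IH]; simpl; [easy|]. now rewrite IH, RtoC_plus. }
  rewrite E, <- RtoC_minus, Cmod_R.
  pose proof (lsumR_incl g L0 L Hg HL0 HL Hi). specialize (Hs L HL).
  apply Rabs_def1; lra.
Qed.

Lemma sums_tail {I : Type} (g : I -> R) M :
  (forall i, (0 <= g i)%R) -> sums_bounded g M ->
  forall eps, (0 < eps)%R -> exists L0, NoDup L0 /\
    forall L, NoDup L -> (forall x, In x L -> ~ In x L0) -> (lsumR g L < eps)%R.
Proof.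
  intros Hg HM eps He. destruct (has_sum_nonneg g M Hg HM) as [s [_ [Ha Hs]]].
  destruct (Ha eps He) as [L0 [HL0 H0]]. exists L0. split; auto. intros L HL Hd.
  assert (HN : NoDup (L0 ++ L)) by (apply NoDup_app; auto; intros x H1 H2; now apply (Hd x)).
  specialize (Hs _ HN). rewrite lsumR_app in Hs. lra.
Qed.

(** A real family [u] with |u| <= g is the difference of the nonnegative families g + u and g, which
    reduces convergence to suprema; real and imaginary parts are then recombined. *)
Lemma abs_summable {I : Type} (f : I -> C) (g : I -> R) M :
  (forall i, (Cmod (f i) <= g i)%R) -> sums_bounded g M -> exists l, has_sum f l.
Proof.
  intros Hfg HM.
  assert (H0 : forall i, (0 <= g i)%R)
    by (intros i; eapply Rle_trans; [apply Cmod_ge_0|apply Hfg]).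
  assert (Hre : forall i, (Rabs (Re (f i)) <= g i)%R)
    by (intros i; eapply Rle_trans; [apply re_le_Cmod|apply Hfg]).
  assert (Him : forall i, (Rabs (Im (f i)) <= g i)%R).
  { intros i; eapply Rle_trans; [|apply Hfg].
    eapply Rle_trans; [|apply Rmax_Cmod]. apply Rmax_r. }
  assert (Hreal : forall u : I -> R, (forall i, (Rabs (u i) <= g i)%R) ->
    exists l : C, has_sum (fun i => RtoC (u i)) l).
  { intros u Hu.
    destruct (has_sum_nonneg (fun i => g i + u i)%R (2 * M)) as [s [Hs _]].
    - intros i. specialize (Hu i). apply Rabs_le_between in Hu. lra.
    - apply (sums_bounded_le _ (fun i => 2 * g i)%R).
      + intros i. specialize (Hu i). apply Rabs_le_between in Hu. lra.
      + apply sums_bounded_scal; auto; lra.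
    - destruct (has_sum_nonneg g M H0 HM) as [t [Ht _]].
      exists (s - t). apply (has_sum_ext (fun i => RtoC (g i + u i) - RtoC (g i))).
      + intros i. rewrite RtoC_plus. ring.
      + now apply has_sum_minus. }
  destruct (Hreal _ Hre) as [a Ha]. destruct (Hreal _ Him) as [b Hb].
  exists (a + Ci * b).
  apply (has_sum_ext (fun i => RtoC (Re (f i)) + Ci * RtoC (Im (f i)))).
  - intros i. apply injective_projections; simpl; unfold Re, Im; ring.
  - apply has_sum_plus, has_sum_scal; auto.
Qed.

(** * Limits of sequences and dominated convergence *)

Definition Clim (u : nat -> C) (l : C) : Prop :=
  forall eps : R, (0 < eps)%R -> exists N, forall n, (N <= n)%nat -> (Cmod (u n - l) < eps)%R.

Lemma Clim_unique u l l' : Clim u l -> Clim u l' -> l = l'.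
Proof.
  intros H H'. apply NNPP; intros Hne.
  assert (Hp : (0 < Cmod (l - l'))%R).
  { apply Cmod_gt_0. intros E; apply Hne. now apply Ceq_minus. }
  destruct (H (Cmod (l - l') / 2)%R ltac:(lra)) as [N1 H1].
  destruct (H' (Cmod (l - l') / 2)%R ltac:(lra)) as [N2 H2].
  specialize (H1 (max N1 N2) ltac:(lia)). specialize (H2 (max N1 N2) ltac:(lia)).
  pose proof (Cmod_triangle (- (u (max N1 N2) - l)) (u (max N1 N2) - l')) as HT.
  rewrite Cmod_opp in HT.
  replace (- (u (max N1 N2) - l) + (u (max N1 N2) - l')) with (l - l') in HT by ring. lra.
Qed.

Lemma Clim_ext u v l : (forall n, u n = v n) -> Clim u l -> Clim v l.
Proof.
  intros E H eps He. destruct (H eps He) as [N HN]. exists N. intros n Hn.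
  rewrite <- E. auto.
Qed.

Lemma Clim_const c : Clim (fun _ => c) c.
Proof.
  intros eps He. exists 0%nat. intros n _. replace (c - c) with (RtoC 0) by ring.
  now rewrite Cmod_0.
Qed.

Lemma Clim_plus u v l m : Clim u l -> Clim v m -> Clim (fun n => u n + v n) (l + m).
Proof.
  intros Hu Hv eps He.
  destruct (Hu (eps / 2)%R ltac:(lra)) as [N1 H1].
  destruct (Hv (eps / 2)%R ltac:(lra)) as [N2 H2].
  exists (max N1 N2). intros n Hn.
  specialize (H1 n ltac:(lia)). specialize (H2 n ltac:(lia)).
  replace (u n + v n - (l + m)) with ((u n - l) + (v n - m)) by ring.
  eapply Rle_lt_trans; [apply Cmod_triangle|lra].
Qed.

Lemma Clim_mult u v l m : Clim u l -> Clim v m -> Clim (fun n => u n * v n) (l * m).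
Proof.
  intros Hu Hv eps He.
  set (e := Rmin 1 (eps / (2 * (1 + Cmod l + Cmod m)))).
  pose proof (Cmod_ge_0 l) as Hl. pose proof (Cmod_ge_0 m) as Hm.
  assert (Hep : (0 < e)%R) by (apply Rmin_glb_lt; [lra|apply Rdiv_lt_0_compat; lra]).
  assert (He1 : (e <= 1)%R) by apply Rmin_l.
  assert (He2 : (e * (1 + Cmod l + Cmod m) <= eps / 2)%R).
  { replace (eps / 2)%R with (eps / (2 * (1 + Cmod l + Cmod m)) * (1 + Cmod l + Cmod m))%R
      by (field; lra).
    apply Rmult_le_compat_r; [lra|apply Rmin_r]. }
  destruct (Hu e Hep) as [N1 H1]. destruct (Hv e Hep) as [N2 H2].
  exists (max N1 N2). intros n Hn.
  specialize (H1 n ltac:(lia)). specialize (H2 n ltac:(lia)).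
  replace (u n * v n - l * m) with ((u n - l) * (v n - m) + (l * (v n - m) + (u n - l) * m)) by ring.
  eapply Rle_lt_trans; [apply Cmod_triangle|].
  eapply Rle_lt_trans; [apply Rplus_le_compat_l, Cmod_triangle|].
  rewrite !Cmod_mult.
  pose proof (Cmod_ge_0 (u n - l)). pose proof (Cmod_ge_0 (v n - m)). nra.
Qed.

Lemma Clim_scal c u l : Clim u l -> Clim (fun n => c * u n) (c * l).
Proof. intros H. apply Clim_mult; auto. apply Clim_const. Qed.

Lemma Clim_inv (u : nat -> C) (l : C) : l <> 0 -> Clim u l -> Clim (fun n => / u n) (/ l).
Proof.
  intros Hl H eps He. pose proof (proj1 (Cmod_gt_0 l) Hl) as Hp.
  set (m := Cmod l) in *.
  destruct (H (Rmin (m / 2) (eps * m * m / 2))) as [N HN].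
  { apply Rmin_glb_lt; [lra|]. assert (0 < eps * m * m)%R by (repeat apply Rmult_lt_0_compat; auto). lra. }
  exists N. intros n Hn. specialize (HN n Hn).
  pose proof (Rmin_l (m / 2) (eps * m * m / 2)). pose proof (Rmin_r (m / 2) (eps * m * m / 2)).
  assert (Hun : (m / 2 < Cmod (u n))%R).
  { pose proof (Cmod_triangle (u n) (- (u n - l))) as HT. rewrite Cmod_opp in HT.
    replace (u n + - (u n - l)) with l in HT by ring. fold m in HT. lra. }
  assert (Hu0 : u n <> 0) by (apply Cmod_gt_0; lra).
  replace (/ u n - / l) with (- (u n - l) * / (u n * l)) by (field; auto).
  rewrite Cmod_mult, Cmod_opp, Cmod_inv, Cmod_mult by (apply Cmult_neq_0; auto). fold m.
  apply (Rmult_lt_reg_r (Cmod (u n) * m)); [apply Rmult_lt_0_compat; lra|].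
  rewrite Rmult_assoc, Rinv_l, Rmult_1_r by (apply Rgt_not_eq, Rmult_lt_0_compat; lra).
  assert (eps * m * m / 2 < eps * (Cmod (u n) * m))%R; [|lra].
  replace (eps * m * m / 2)%R with ((eps * m) * (m / 2))%R by field.
  replace (eps * (Cmod (u n) * m))%R with ((eps * m) * Cmod (u n))%R by ring.
  apply Rmult_lt_compat_l; auto. apply Rmult_lt_0_compat; auto.
Qed.

Lemma Clim_lower (u : nat -> C) (l : C) (d : R) : Clim u l -> (forall n, (d <= Cmod (u n))%R) -> (d <= Cmod l)%R.
Proof.
  intros H Hd. apply Rnot_lt_le. intros Hlt.
  destruct (H (d - Cmod l)%R ltac:(lra)) as [N HN]. specialize (HN N (le_n _)).
  specialize (Hd N). pose proof (Cmod_triangle (u N - l) l) as HT.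
  replace (u N - l + l) with (u N) in HT by ring. lra.
Qed.

Lemma lsumR_small {I : Type} (f : nat -> I -> C) (L : list I) :
  (forall i, Clim (fun n => f n i) 0) ->
  forall eps, (0 < eps)%R -> exists N, forall n, (N <= n)%nat ->
    (lsumR (fun i => Cmod (f n i)) L < eps)%R.
Proof.
  intros H. induction L as [|a L IH]; intros eps He; simpl.
  - exists 0%nat. auto.
  - destruct (IH (eps / 2)%R ltac:(lra)) as [N1 H1].
    destruct (H a (eps / 2)%R ltac:(lra)) as [N2 H2]. exists (max N1 N2). intros n Hn.
    specialize (H1 n ltac:(lia)). specialize (H2 n ltac:(lia)).
    replace (f n a - 0) with (f n a) in H2 by ring. lra.
Qed.

(** A finite set [L0] carries all but a small part of the bound [g]. On [L0] the terms converge
    uniformly; off [L0] both [f n] and [f0] are bounded by [g]. The threshold [N0] admits a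
    domination that only holds eventually, as in [csc2_has_sum]. *)
Lemma tannery {I : Type} (f : nat -> I -> C) (f0 : I -> C) (g : I -> R) (M : R)
  (l : nat -> C) (l0 : C) (N0 : nat) :
  (forall i, Clim (fun n => f n i) (f0 i)) ->
  (forall n i, (N0 <= n)%nat -> (Cmod (f n i) <= g i)%R) ->
  sums_bounded g M ->
  (forall n, has_sum (f n) (l n)) -> has_sum f0 l0 -> Clim l l0.
Proof.
  intros Hlim Hdom HM Hl Hl0 eps He.
  assert (Hg0 : forall i, (0 <= g i)%R).
  { intros i; eapply Rle_trans; [apply Cmod_ge_0|apply (Hdom N0 i (le_n _))]. }
  assert (Hf0 : forall i, (Cmod (f0 i) <= g i)%R).
  { intros i. apply Rnot_lt_le. intros Hlt.
    destruct (Hlim i (Cmod (f0 i) - g i)%R ltac:(lra)) as [N HN].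
    specialize (HN (max N N0) ltac:(lia)). specialize (Hdom (max N N0) i ltac:(lia)).
    pose proof (Cmod_triangle (f (max N N0) i) (- (f (max N N0) i - f0 i))) as HT.
    rewrite Cmod_opp in HT.
    replace (f (max N N0) i + - (f (max N N0) i - f0 i)) with (f0 i) in HT by ring. lra. }
  (* At most eps/6 comes from [L0] and 2 eps/6 from its complement. Aiming at eps/2 leaves room for
     the strict inequality, as [has_sum_le] yields a weak one. *)
  destruct (sums_tail g M Hg0 HM (eps / 6)%R ltac:(lra)) as [L0 [HL0 Ht]].
  destruct (lsumR_small (fun n i => f n i - f0 i) L0) with (eps := (eps / 6)%R) as [N1 H1]; [|lra|].
  { intros i e Hep. destruct (Hlim i e Hep) as [N HN]. exists N. intros n Hn.
    replace (f n i - f0 i - 0) with (f n i - f0 i) by ring. auto. }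
  exists (max N0 N1). intros n Hn.
  apply Rle_lt_trans with (eps / 2)%R; [|lra].
  apply (has_sum_le _ _ L0 _ (has_sum_minus _ _ _ _ (Hl n) Hl0)).
  intros L HL Hi. eapply Rle_trans; [apply Cmod_lsum|].
  destruct (NoDup_complement L0 L HL0 Hi HL) as [T [HT [HTn HTd]]].
  rewrite (lsumR_perm _ _ _ HT), lsumR_app.
  specialize (H1 n ltac:(lia)). specialize (Ht T HTn HTd).
  assert (lsumR (fun i => Cmod (f n i - f0 i)) T <= lsumR (fun i => 2 * g i)%R T)%R.
  { apply lsumR_le. intros i. pose proof (Cmod_triangle (f n i) (- f0 i)) as HC.
    rewrite Cmod_opp in HC. fold (Cminus (f n i) (f0 i)) in HC.
    specialize (Hdom n i ltac:(lia)). specialize (Hf0 i). lra. }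
  rewrite lsumR_scal in H. lra.
Qed.

(** * Double sums and products of sums *)

Lemma has_sum_lsum {I J : Type} (F : I -> J -> C) (G : I -> C) (L : list I) :
  (forall i, has_sum (F i) (G i)) -> has_sum (fun j => lsum (fun i => F i j) L) (lsum G L).
Proof.
  intros H. induction L as [|a L IH]; simpl; [apply has_sum_zero|].
  apply has_sum_plus; auto.
Qed.

Lemma NoDup_list_prod' {I J : Type} (L : list I) (L' : list J) :
  NoDup L -> NoDup L' -> NoDup (list_prod L L').
Proof.
  intros HL HL'. induction HL as [|a L Ha HL IH]; simpl; [constructor|].
  apply NoDup_app; auto.
  - apply FinFun.Injective_map_NoDup; auto. intros x y E. congruence.
  - intros [i j] H1 H2. apply in_map_iff in H1. destruct H1 as [j' [E _]].
    apply in_prod_iff in H2. destruct H2. congruence.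
Qed.

Lemma lsum_list_prod {I J : Type} (F : I * J -> C) (L : list I) (L' : list J) :
  lsum F (list_prod L L') = lsum (fun j => lsum (fun i => F (i, j)) L) L'.
Proof.
  induction L as [|a L IH]; simpl.
  - induction L'; simpl; [easy|rewrite <- IHL'; ring].
  - rewrite lsum_app, IH, lsum_map, lsum_plus. easy.
Qed.

Lemma lsumR_list_prod {I J : Type} (f : I -> R) (g : J -> R) (L : list I) (L' : list J) :
  lsumR (fun p => f (fst p) * g (snd p))%R (list_prod L L') = (lsumR f L * lsumR g L')%R.
Proof.
  induction L as [|a L IH]; simpl; [ring|].
  rewrite lsumR_app, IH, lsumR_map. simpl. rewrite lsumR_scal. ring.
Qed.

(** For a finite set of rows, enlarge the columns until the truncated rows are within eps/2 of the
    row sums and the rectangle contains the finite set [P0] beyond which the double sum is within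
    eps/2 of [l]. *)
Lemma has_sum_fubini {I J : Type} (F : I * J -> C) (G : I -> C) l :
  has_sum F l -> (forall i, has_sum (fun j => F (i, j)) (G i)) -> has_sum G l.
Proof.
  intros HF HG eps He. destruct (HF (eps / 2)%R ltac:(lra)) as [P0 H0].
  exists (map fst P0). intros L HL Hi.
  destruct (has_sum_lsum (fun i j => F (i, j)) G L HG (eps / 2)%R ltac:(lra)) as [J0 HJ].
  destruct (NoDup_union J0 (map snd P0)) as [J' [HJ' [Hi1 Hi2]]].
  specialize (HJ J' HJ' Hi1). specialize (H0 (list_prod L J') (NoDup_list_prod' _ _ HL HJ')).
  rewrite lsum_list_prod in H0.
  assert (HI : incl P0 (list_prod L J')).
  { intros [i j] Hp. apply in_prod_iff. split.
    - apply Hi. now apply (in_map fst) in Hp.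
    - apply Hi2. now apply (in_map snd) in Hp. }
  specialize (H0 HI).
  set (A := lsum (fun j => lsum (fun i => F (i, j)) L) J') in *.
  replace (lsum G L - l) with (- (A - lsum G L) + (A - l)) by ring.
  eapply Rle_lt_trans; [apply Cmod_triangle|]. rewrite Cmod_opp. lra.
Qed.

Lemma sums_bounded_prod {I J : Type} (f : I -> R) (g : J -> R) M M' :
  (forall i, (0 <= f i)%R) -> (forall j, (0 <= g j)%R) ->
  sums_bounded f M -> sums_bounded g M' ->
  sums_bounded (fun p : I * J => f (fst p) * g (snd p))%R (M * M').
Proof.
  intros Hf Hg HM HM' L HL.
  set (L1 := nodup classic_eq_dec (map fst L)). set (L2 := nodup classic_eq_dec (map snd L)).
  apply Rle_trans with (lsumR (fun p => f (fst p) * g (snd p))%R (list_prod L1 L2)).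
  - apply lsumR_incl; auto.
    + intros [i j]; simpl. apply Rmult_le_pos; auto.
    + apply NoDup_list_prod'; apply NoDup_nodup.
    + intros [i j] Hp. apply in_prod_iff. split; apply nodup_In.
      * now apply (in_map fst) in Hp.
      * now apply (in_map snd) in Hp.
  - rewrite lsumR_list_prod. apply Rmult_le_compat.
    + apply lsumR_nonneg, Hf.
    + apply lsumR_nonneg, Hg.
    + apply HM, NoDup_nodup.
    + apply HM', NoDup_nodup.
Qed.

Lemma has_sum_prod {I J : Type} (f : I -> C) (g : J -> C) (f' : I -> R) (g' : J -> R) M M' a b :
  (forall i, (Cmod (f i) <= f' i)%R) -> (forall j, (Cmod (g j) <= g' j)%R) ->
  sums_bounded f' M -> sums_bounded g' M' -> has_sum f a -> has_sum g b ->
  has_sum (fun p : I * J => f (fst p) * g (snd p)) (a * b).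
Proof.
  intros Hf Hg HM HM' Ha Hb.
  destruct (abs_summable (fun p : I * J => f (fst p) * g (snd p))
    (fun p => f' (fst p) * g' (snd p))%R (M * M')) as [l Hl].
  - intros [i j]; simpl. rewrite Cmod_mult. apply Rmult_le_compat; auto using Cmod_ge_0.
  - apply sums_bounded_prod; auto; intros x; eapply Rle_trans;
      [apply Cmod_ge_0|apply Hf|apply Cmod_ge_0|apply Hg].
  - assert (E : l = a * b); [|now rewrite <- E].
    apply (has_sum_unique (fun i => f i * b)).
    + apply (has_sum_fubini _ _ _ Hl). intros i; simpl. now apply has_sum_scal.
    + apply (has_sum_ext (fun i => b * f i)); [intros; ring|].
      replace (a * b) with (b * a) by ring. now apply has_sum_scal.
Qed.

(** * Sums over the integers *)

(** The interval from -n to n - 1, listed in the two halves of [Zsum], so that a sum over it splits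
    into the two partial sums of length n. *)
Definition Zrange (n : nat) : list Z :=
  map Z.of_nat (seq 0 n) ++ map (fun k => - Z.of_nat (S k))%Z (seq 0 n).

Lemma in_Zrange n k : (- Z.of_nat n <= k < Z.of_nat n)%Z -> In k (Zrange n).
Proof.
  intros H. apply in_or_app. destruct (Z_lt_le_dec k 0).
  - right. apply in_map_iff. exists (Z.to_nat (- k - 1)). split; [lia|apply in_seq; lia].
  - left. apply in_map_iff. exists (Z.to_nat k). split; [lia|apply in_seq; lia].
Qed.

Lemma NoDup_Zrange n : NoDup (Zrange n).
Proof.
  apply NoDup_app.
  - apply FinFun.Injective_map_NoDup; [intros x y; lia|apply seq_NoDup].
  - apply FinFun.Injective_map_NoDup; [intros x y; lia|apply seq_NoDup].
  - intros k H1 H2. apply in_map_iff in H1, H2.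
    destruct H1 as [a [<- _]]. destruct H2 as [b [E _]]. lia.
Qed.

Lemma incl_Zrange (L : list Z) : exists N, forall n, (N <= n)%nat -> incl L (Zrange n).
Proof.
  induction L as [|a L [N HN]].
  - exists 0%nat. intros n _ x [].
  - exists (max N (S (Z.to_nat (Z.abs a)))). intros n Hn x [<-|Hx].
    + apply in_Zrange. lia.
    + apply (HN n); auto. lia.
Qed.

Lemma Zsums_bounded (g : Z -> R) M :
  (forall k, (0 <= g k)%R) -> (forall n, (lsumR g (Zrange n) <= M)%R) -> sums_bounded g M.
Proof.
  intros Hg H L HL. destruct (incl_Zrange L) as [N HN].
  eapply Rle_trans; [|apply (H N)]. apply lsumR_incl; auto. apply NoDup_Zrange.
Qed.

Lemma has_sum_CSeries (a : nat -> C) l :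
  Clim (fun n => lsum a (seq 0 n)) l -> CSeries a = l.
Proof.
  intros H. apply CSeries_correct.
  assert (E : forall n, sum_n a n = lsum a (seq 0 (S n))).
  { induction n as [|n IH].
    - rewrite sum_O. simpl. ring.
    - rewrite sum_Sn, IH, (seq_S (S n)), lsum_app. simpl. unfold plus; simpl. ring. }
  apply filterlim_locally_ball_norm. intros eps.
  destruct (H eps (cond_pos eps)) as [N HN]. exists N. intros n Hn.
  rewrite E. apply (HN (S n)). lia.
Qed.

Lemma Clim_Zrange (f : Z -> C) l : has_sum f l -> Clim (fun n => lsum f (Zrange n)) l.
Proof.
  intros H eps He. destruct (H eps He) as [L0 H0]. destruct (incl_Zrange L0) as [N HN].
  exists N. intros n Hn. apply H0; [apply NoDup_Zrange|auto].
Qed.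

Lemma Clim_seq (f : nat -> C) l : has_sum f l -> Clim (fun n => lsum f (seq 0 n)) l.
Proof.
  intros H eps He. destruct (H eps He) as [L0 H0].
  assert (HN : exists N, forall n, (N <= n)%nat -> incl L0 (seq 0 n)).
  { clear. induction L0 as [|a L [N HN]].
    - exists 0%nat. intros n _ x [].
    - exists (max N (S a)). intros n Hn x [<-|Hx].
      + apply in_seq. lia.
      + apply (HN n); auto. lia. }
  destruct HN as [N HN]. exists N. intros n Hn. apply H0; [apply seq_NoDup|auto].
Qed.

Lemma Zsum_split (f : Z -> C) (g : Z -> R) M l :
  (forall k, (Cmod (f k) <= g k)%R) -> sums_bounded g M -> has_sum f l ->
  exists a b, has_sum (fun n => f (Z.of_nat n)) a /\
    has_sum (fun n => f (- Z.of_nat (S n))%Z) b /\ l = a + b.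
Proof.
  intros Hg HM Hl.
  destruct (abs_summable (fun n => f (Z.of_nat n)) (fun n => g (Z.of_nat n)) M) as [a Ha].
  { intros; apply Hg. }
  { apply (sums_bounded_inj Z.of_nat); auto. intros; lia. }
  destruct (abs_summable (fun n => f (- Z.of_nat (S n))%Z) (fun n => g (- Z.of_nat (S n))%Z) M) as [b Hb].
  { intros; apply Hg. }
  { apply (sums_bounded_inj (fun n => - Z.of_nat (S n))%Z); auto. intros; lia. }
  exists a, b. repeat split; auto.
  apply (Clim_unique _ _ _ (Clim_Zrange _ _ Hl)).
  apply (Clim_ext (fun n => lsum (fun n => f (Z.of_nat n)) (seq 0 n)
     + lsum (fun n => f (- Z.of_nat (S n))%Z) (seq 0 n))).
  - intros n. unfold Zrange. rewrite lsum_app, !lsum_map. easy.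
  - apply Clim_plus; apply Clim_seq; auto.
Qed.

(** The bridge from the definitions by [Series] to unconditional sums: the domination makes each of
    the two half series converge separately. *)
Lemma Zsum_has_sum (f : Z -> C) (g : Z -> R) M l :
  (forall k, (Cmod (f k) <= g k)%R) -> sums_bounded g M -> has_sum f l -> Zsum f = l.
Proof.
  intros Hg HM Hl. destruct (Zsum_split f g M l Hg HM Hl) as [a [b [Ha [Hb ->]]]].
  unfold Zsum. f_equal; apply has_sum_CSeries; now apply Clim_seq.
Qed.

Lemma has_sum_Zsum (f : Z -> C) (g : Z -> R) M :
  (forall k, (Cmod (f k) <= g k)%R) -> sums_bounded g M -> has_sum f (Zsum f).
Proof.
  intros Hg HM. destruct (abs_summable f g M Hg HM) as [l Hl].
  now rewrite (Zsum_has_sum f g M l Hg HM Hl).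
Qed.

(** * The exponential and complex differentiation *)

Lemma Cexp_plus (z w : C) : Cexp (z + w) = Cexp z * Cexp w.
Proof.
  unfold Cexp. destruct z as [a b], w as [c d]; simpl.
  rewrite exp_plus, cos_plus, sin_plus.
  apply injective_projections; simpl; ring.
Qed.

Lemma Cexp_0 : Cexp 0 = 1.
Proof.
  unfold Cexp; simpl. rewrite exp_0, cos_0, sin_0.
  apply injective_projections; simpl; ring.
Qed.

Lemma Cmod_Cexp (z : C) : Cmod (Cexp z) = exp (Re z).
Proof.
  unfold Cexp. rewrite Cmod_mult, Cmod_R, Rabs_pos_eq by (left; apply exp_pos).
  replace (Cmod (cos (Im z) + Ci * sin (Im z))) with 1%R; [ring|].
  unfold Cmod, Re, Im; simpl. pose proof (sin2_cos2 (snd z)) as E. unfold Rsqr in E.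
  rewrite <- sqrt_1 at 1. apply f_equal. ring_simplify. lra.
Qed.

Lemma Cexp_nz (z : C) : Cexp z <> 0.
Proof. apply Cmod_gt_0. rewrite Cmod_Cexp. apply exp_pos. Qed.

Lemma Cexp_opp (z : C) : Cexp (- z) = / Cexp z.
Proof.
  assert (H : Cexp (- z) * Cexp z = 1).
  { rewrite <- Cexp_plus. replace (- z + z) with (RtoC 0) by ring. apply Cexp_0. }
  rewrite <- (Cmult_1_l (/ Cexp z)), <- H. field. apply Cexp_nz.
Qed.

Lemma Cexp_PI : Cexp (PI * Ci) = -1.
Proof.
  unfold Cexp; simpl.
  replace (PI * 0 - 0 * 1)%R with 0%R by ring. replace (PI * 1 + 0 * 0)%R with PI by ring.
  rewrite exp_0, cos_PI, sin_PI. apply injective_projections; simpl; ring.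
Qed.

Lemma Cexp_PI_half : Cexp (PI * Ci / 2) = Ci.
Proof.
  replace (PI * Ci / 2) with ((0, PI / 2)%R : C).
  - unfold Cexp; simpl. rewrite exp_0, cos_PI2, sin_PI2.
    apply injective_projections; simpl; ring.
  - apply injective_projections; simpl; field.
Qed.

Lemma Cexp_2PI_nat (n : nat) : Cexp (2 * PI * Ci * INR n) = 1.
Proof.
  induction n as [|n IH].
  - simpl. replace (2 * PI * Ci * 0) with (RtoC 0) by ring. apply Cexp_0.
  - rewrite S_INR, RtoC_plus.
    replace (2 * PI * Ci * (INR n + 1)) with (2 * PI * Ci * INR n + (PI * Ci + PI * Ci)) by ring.
    rewrite !Cexp_plus, IH, Cexp_PI. ring.
Qed.

Lemma Cexp_2PI_Z (k : Z) : Cexp (2 * PI * Ci * ZtoC k) = 1.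
Proof.
  unfold ZtoC. destruct (Z_le_gt_dec 0 k).
  - rewrite <- (Z2Nat.id k), <- INR_IZR_INZ by lia. apply Cexp_2PI_nat.
  - replace k with (- Z.of_nat (Z.to_nat (- k)))%Z by lia.
    rewrite opp_IZR, <- INR_IZR_INZ, RtoC_opp.
    replace (2 * PI * Ci * - INR (Z.to_nat (- k)))
      with (- (2 * PI * Ci * INR (Z.to_nat (- k)))) by ring.
    rewrite Cexp_opp, Cexp_2PI_nat. field.
Qed.

Lemma RtoC_PI_nz : RtoC PI <> 0.
Proof. intros X. apply RtoC_inj in X. now apply PI_neq0. Qed.

Lemma two_PI_i_nz : 2 * PI * Ci <> 0.
Proof.
  apply Cmult_neq_0; [apply Cmult_neq_0; [|apply RtoC_PI_nz]|apply Ci_nz].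
  intros X. apply RtoC_inj in X. lra.
Qed.

Lemma Ci_sqr : Ci * Ci = -1.
Proof. apply injective_projections; simpl; ring. Qed.

(** Raises the order of vanishing at 0 by one; chained over exp, cos and sin it takes the place of
    Taylor's formula. *)
Lemma MVT_bound (f f' : R -> R) (B x : R) :
  (forall t, is_derive f t (f' t)) -> f 0%R = 0%R ->
  (forall t, (Rabs t <= Rabs x)%R -> (Rabs (f' t) <= B)%R) -> (Rabs (f x) <= B * Rabs x)%R.
Proof.
  intros Hd H0 HB. destruct (MVT_gen f 0 x f') as [c [Hc E]].
  - intros; apply Hd.
  - intros t _. apply derivable_continuous_pt. exists (f' t). apply is_derive_Reals, Hd.
  - rewrite H0, !Rminus_0_r in E. rewrite E, Rabs_mult.
    apply Rmult_le_compat_r; [apply Rabs_pos|]. apply HB.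
    unfold Rmin, Rmax in Hc. destruct (Rle_dec 0 x); unfold Rabs; repeat destruct Rcase_abs; lra.
Qed.

Lemma exp_le (x y : R) : (x <= y)%R -> (exp x <= exp y)%R.
Proof. intros [H|E]; [left; now apply exp_increasing|rewrite E; lra]. Qed.

Lemma exp_minus_1_bound (x : R) : (Rabs (exp x - 1) <= exp (Rabs x) * Rabs x)%R.
Proof.
  apply (MVT_bound (fun x => exp x - 1)%R exp).
  - intros t. auto_derive; auto. ring.
  - rewrite exp_0. ring.
  - intros t Ht. rewrite Rabs_pos_eq by (left; apply exp_pos).
    apply exp_le. eapply Rle_trans; [apply Rle_abs|auto].
Qed.

Lemma exp_quad_bound (x : R) : (Rabs (exp x - 1 - x) <= exp (Rabs x) * Rabs x * Rabs x)%R.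
Proof.
  apply (MVT_bound (fun x => exp x - 1 - x)%R (fun x => exp x - 1)%R).
  - intros t. auto_derive; auto. ring.
  - rewrite exp_0. ring.
  - intros t Ht. eapply Rle_trans; [apply exp_minus_1_bound|].
    apply Rmult_le_compat; auto using Rabs_pos; [left; apply exp_pos|now apply exp_le].
Qed.

Lemma cos_minus_1_bound (x : R) : (Rabs (cos x - 1) <= Rabs x * Rabs x)%R.
Proof.
  apply (MVT_bound (fun x => cos x - 1)%R (fun x => - sin x)%R).
  - intros t. auto_derive; auto. ring.
  - rewrite cos_0. ring.
  - intros t Ht. rewrite Rabs_Ropp. eapply Rle_trans; [|exact Ht].
    replace (Rabs t) with (1 * Rabs t)%R by ring.
    apply (MVT_bound sin cos).
    + intros s. auto_derive; auto. ring.
    + apply sin_0.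
    + intros s _. apply Rabs_le. apply COS_bound.
Qed.

Lemma sin_quad_bound (x : R) : (Rabs (sin x - x) <= 2 * Rabs x * Rabs x)%R.
Proof.
  destruct (Rle_lt_dec (Rabs x) 1) as [H|H].
  - apply (MVT_bound (fun x => sin x - x)%R (fun x => cos x - 1)%R).
    + intros t. auto_derive; auto. ring.
    + rewrite sin_0. ring.
    + intros t Ht. eapply Rle_trans; [apply cos_minus_1_bound|].
      pose proof (Rabs_pos t). nra.
  - replace (sin x - x)%R with (sin x + - x)%R by ring.
    eapply Rle_trans; [apply Rabs_triang|]. rewrite Rabs_Ropp.
    assert (Rabs (sin x) <= 1)%R by (apply Rabs_le, SIN_bound). nra.
Qed.

Lemma Rabs_re_im (z : C) : (Rabs (fst z) <= Cmod z)%R /\ (Rabs (snd z) <= Cmod z)%R.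
Proof.
  split; (eapply Rle_trans; [|apply Rmax_Cmod]); [apply Rmax_l|apply Rmax_r].
Qed.

Lemma Cmod_le_abs (a b : R) : (Cmod (a, b) <= Rabs a + Rabs b)%R.
Proof.
  replace ((a, b) : C) with (RtoC a + Ci * RtoC b).
  - eapply Rle_trans; [apply Cmod_triangle|]. rewrite Cmod_mult, Cmod_Ci, !Cmod_R. lra.
  - apply injective_projections; simpl; ring.
Qed.

Lemma Cexp_quad (z : C) :
  (Cmod (Cexp z - 1 - z) <= 5 * (Cmod z * Cmod z) * exp (Cmod z))%R.
Proof.
  destruct (Rabs_re_im z) as [Hx Hy]. destruct z as [x y]; simpl in Hx, Hy.
  set (m := Cmod (x, y)) in *.
  (* The real exponential, the cosine and sine errors, and the mixed term contribute 1, 1 + 2 and 1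
     times m^2 exp m; this is the 5 of the statement. *)
  assert (E : Cexp (x, y) - 1 - (x, y) =
    RtoC (exp x - 1 - x) + (RtoC (exp x) * (cos y - 1, sin y - y)%R + (0, y * (exp x - 1))%R)).
  { unfold Cexp; apply injective_projections; simpl; ring. }
  rewrite E. clear E.
  eapply Rle_trans; [apply Cmod_triangle|].
  eapply Rle_trans; [apply Rplus_le_compat_l, Cmod_triangle|].
  rewrite Cmod_mult, !Cmod_R, (Rabs_pos_eq (exp x)) by (left; apply exp_pos).
  pose proof (Cmod_le_abs (cos y - 1) (sin y - y)) as H1.
  pose proof (Cmod_le_abs 0 (y * (exp x - 1))) as H2.
  rewrite Rabs_R0, Rabs_mult in H2.
  pose proof (exp_quad_bound x) as H3. pose proof (exp_minus_1_bound x) as H4.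
  pose proof (cos_minus_1_bound y) as H5. pose proof (sin_quad_bound y) as H6.
  assert (He : (exp (Rabs x) <= exp m)%R) by now apply exp_le.
  assert (He' : (exp x <= exp m)%R) by (apply exp_le; eapply Rle_trans; [apply Rle_abs|auto]).
  pose proof (exp_pos (Rabs x)). pose proof (exp_pos x). pose proof (exp_pos m).
  pose proof (Rabs_pos x). pose proof (Rabs_pos y). pose proof (Rabs_pos (exp x - 1)).
  assert (A1 : (exp (Rabs x) * Rabs x * Rabs x <= exp m * (m * m))%R).
  { rewrite Rmult_assoc. apply Rmult_le_compat; try nra. }
  assert (A2 : (Rabs y * Rabs y <= m * m)%R) by nra.
  assert (A3 : (exp x * Cmod (cos y - 1, sin y - y)%R <= exp m * (3 * (m * m)))%R).
  { apply Rmult_le_compat; [lra|apply Cmod_ge_0|lra|lra]. }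
  assert (A4 : (Rabs y * Rabs (exp x - 1) <= m * (exp m * m))%R).
  { apply Rmult_le_compat; auto. eapply Rle_trans; [exact H4|].
    apply Rmult_le_compat; lra. }
  lra.
Qed.

(* Differentiability with a quadratic error term: all functions below are entire, and
   this form is stable under products and termwise summation. *)
Definition qderiv (f : C -> C) (x l : C) : Prop :=
  exists M d : R, (0 < d)%R /\ (0 <= M)%R /\ forall h : C, (Cmod h <= d)%R ->
    (Cmod (f (x + h) - f x - l * h)%C <= M * (Cmod h * Cmod h))%R.

Lemma qderiv_is_derive f x l : qderiv f x l -> is_derive f x l.
Proof.
  intros [M [d [Hd [HM H]]]]. split.
  - apply is_linear_scal_l.
  - intros y Hy.
    apply (@is_filter_lim_locally_unique _ (AbsRing_NormedModule C_AbsRing)) in Hy. subst y.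
    intros eps.
    assert (Hpos : (0 < Rmin d (eps / (M + 1)))%R).
    { apply Rmin_glb_lt; auto. apply Rdiv_lt_0_compat; [apply cond_pos|lra]. }
    exists (mkposreal _ Hpos). intros z0 Hz. set (z := z0 : C). fold z in Hz |- *.
    clearbody z. change (Cmod (z - x) < Rmin d (eps / (M + 1)))%R in Hz.
    change (Cmod ((f z - f x) - (z - x) * l) <= eps * Cmod (z - x))%R.
    specialize (H (z - x)). replace (x + (z - x)) with z in H by ring.
    replace (f z - f x - (z - x) * l) with (f z - f x - l * (z - x)) by ring.
    pose proof (Rmin_l d (eps / (M + 1))). pose proof (Rmin_r d (eps / (M + 1))).
    eapply Rle_trans; [apply H; lra|]. rewrite <- Rmult_assoc.
    apply Rmult_le_compat_r; [apply Cmod_ge_0|].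
    assert (HE : ((M + 1) * Cmod (z - x) <= eps)%R).
    { replace (pos eps) with ((M + 1) * (eps / (M + 1)))%R by (field; lra).
      apply Rmult_le_compat_l; lra. }
    pose proof (Cmod_ge_0 (z - x)). lra.
Qed.

Lemma qderiv_C_derive f x l : qderiv f x l -> C_derive f x = l.
Proof. intros H. now apply is_C_derive_unique, qderiv_is_derive. Qed.

Lemma qderiv_unique f x l l' : qderiv f x l -> qderiv f x l' -> l = l'.
Proof. intros H H'. now rewrite <- (qderiv_C_derive f x l), <- (qderiv_C_derive f x l'). Qed.

Lemma qderiv_ext f g x l : (forall y, f y = g y) -> qderiv f x l -> qderiv g x l.
Proof.
  intros E [M [d [Hd [HM H]]]]. exists M, d. repeat split; auto. intros h Hh.
  rewrite <- !E. auto.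
Qed.

Lemma qderiv_const c x : qderiv (fun _ => c) x 0.
Proof.
  exists 0%R, 1%R. repeat split; try lra. intros h _.
  replace (c - c - 0 * h) with (RtoC 0) by ring. rewrite Cmod_0. lra.
Qed.

Lemma qderiv_plus f g x l m :
  qderiv f x l -> qderiv g x m -> qderiv (fun y => f y + g y) x (l + m).
Proof.
  intros [M [d [Hd [HM H]]]] [M' [d' [Hd' [HM' H']]]].
  exists (M + M')%R, (Rmin d d'). repeat split; [now apply Rmin_glb_lt|lra|]. intros h Hh.
  pose proof (Rmin_l d d'). pose proof (Rmin_r d d').
  specialize (H h ltac:(lra)). specialize (H' h ltac:(lra)).
  replace (f (x + h) + g (x + h) - (f x + g x) - (l + m) * h)
    with ((f (x + h) - f x - l * h) + (g (x + h) - g x - m * h)) by ring.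
  eapply Rle_trans; [apply Cmod_triangle|lra].
Qed.

Lemma qderiv_mult f g x l m :
  qderiv f x l -> qderiv g x m -> qderiv (fun y => f y * g y) x (l * g x + f x * m).
Proof.
  intros [M [d [Hd [HM H]]]] [M' [d' [Hd' [HM' H']]]].
  set (F := (Cmod (f x) + Cmod l + M)%R).
  exists (F * M' + Cmod (g x) * M + Cmod m * (Cmod l + M))%R, (Rmin 1 (Rmin d d')).
  pose proof (Cmod_ge_0 (f x)). pose proof (Cmod_ge_0 (g x)).
  pose proof (Cmod_ge_0 l). pose proof (Cmod_ge_0 m).
  repeat split; [repeat apply Rmin_glb_lt; auto; lra|unfold F; nra|]. intros h Hh.
  pose proof (Rmin_l 1 (Rmin d d')). pose proof (Rmin_r 1 (Rmin d d')).
  pose proof (Rmin_l d d'). pose proof (Rmin_r d d').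
  specialize (H h ltac:(lra)). specialize (H' h ltac:(lra)).
  pose proof (Cmod_ge_0 h) as Hh0.
  set (e := f (x + h) - f x - l * h) in *. set (e' := g (x + h) - g x - m * h) in *.
  assert (Hdf : (Cmod (l * h + e) <= (Cmod l + M) * Cmod h)%R).
  { eapply Rle_trans; [apply Cmod_triangle|]. rewrite Cmod_mult.
    assert (Cmod h * Cmod h <= Cmod h)%R by nra. nra. }
  assert (HF : (Cmod (f x + (l * h + e)) <= F)%R).
  { eapply Rle_trans; [apply Cmod_triangle|]. unfold F. nra. }
  replace (f (x + h) * g (x + h) - f x * g x - (l * g x + f x * m) * h)
    with ((f x + (l * h + e)) * e' + (g x * e + m * h * (l * h + e)))
    by (unfold e, e'; ring).
  eapply Rle_trans; [apply Cmod_triangle|].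
  eapply Rle_trans; [apply Rplus_le_compat_l, Cmod_triangle|].
  rewrite !Cmod_mult.
  assert (A1 : (Cmod (f x + (l * h + e)) * Cmod e' <= F * (M' * (Cmod h * Cmod h)))%R).
  { apply Rmult_le_compat; auto using Cmod_ge_0. }
  assert (A2 : (Cmod (g x) * Cmod e <= Cmod (g x) * (M * (Cmod h * Cmod h)))%R).
  { apply Rmult_le_compat_l; auto. }
  assert (A3 : (Cmod m * Cmod h * Cmod (l * h + e) <= Cmod m * Cmod h * ((Cmod l + M) * Cmod h))%R).
  { apply Rmult_le_compat_l; auto. apply Rmult_le_pos; auto. }
  lra.
Qed.

Lemma qderiv_scal c f x l : qderiv f x l -> qderiv (fun y => c * f y) x (c * l).
Proof.
  intros H. replace (c * l) with (0 * f x + c * l) by ring.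
  apply (qderiv_mult (fun _ => c)); auto. apply qderiv_const.
Qed.

Lemma qderiv_minus f g x l m :
  qderiv f x l -> qderiv g x m -> qderiv (fun y => f y - g y) x (l - m).
Proof.
  intros H H'. apply (qderiv_ext (fun y => f y + (-1) * g y)); [intros; ring|].
  replace (l - m) with (l + (-1) * m) by ring. apply qderiv_plus, qderiv_scal; auto.
Qed.

Lemma qderiv_affine f c b x l :
  qderiv f (c * x + b) l -> qderiv (fun y => f (c * y + b)) x (c * l).
Proof.
  intros [M [d [Hd [HM H]]]].
  exists (M * (Cmod c * Cmod c))%R, (d / (Cmod c + 1))%R. pose proof (Cmod_ge_0 c).
  repeat split; [apply Rdiv_lt_0_compat; lra|nra|]. intros h Hh.
  replace (c * (x + h) + b) with (c * x + b + c * h) by ring.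
  replace (c * l * h) with (l * (c * h)) by ring.
  eapply Rle_trans; [apply H|].
  - rewrite Cmod_mult. pose proof (Cmod_ge_0 h).
    apply Rle_trans with ((Cmod c + 1) * Cmod h)%R; [nra|].
    replace d with ((Cmod c + 1) * (d / (Cmod c + 1)))%R by (field; lra).
    apply Rmult_le_compat_l; lra.
  - rewrite Cmod_mult. lra.
Qed.

Lemma qderiv_Cexp x : qderiv Cexp x (Cexp x).
Proof.
  exists (Cmod (Cexp x) * (5 * exp 1))%R, 1%R.
  repeat split; [lra|pose proof (Cmod_ge_0 (Cexp x)); pose proof (exp_pos 1); nra|].
  intros h Hh. rewrite Cexp_plus.
  replace (Cexp x * Cexp h - Cexp x - Cexp x * h) with (Cexp x * (Cexp h - 1 - h)) by ring.
  rewrite Cmod_mult, Rmult_assoc. apply Rmult_le_compat_l; [apply Cmod_ge_0|].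
  eapply Rle_trans; [apply Cexp_quad|].
  assert (exp (Cmod h) <= exp 1)%R by now apply exp_le.
  pose proof (Cmod_ge_0 h). assert (0 <= Cmod h * Cmod h)%R by nra. nra.
Qed.

(** * Theta series with real characteristic *)

(** The exponent 3/2 exceeds 1, which gives summability, and is half of 3, which lets a product of
    two weights dominate the cubic decay of a lattice sum. *)
Definition zweight (k : Z) : R := (/ ((1 + IZR (Z.abs k)) * sqrt (1 + IZR (Z.abs k))))%R.

Lemma abs_IZR_pos k : (0 <= IZR (Z.abs k))%R.
Proof. apply IZR_le. lia. Qed.

Lemma zweight_pos k : (0 < zweight k)%R.
Proof.
  pose proof (abs_IZR_pos k).
  apply Rinv_0_lt_compat, Rmult_lt_0_compat; [lra|apply sqrt_lt_R0; lra].
Qed.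

(** Comparison of (1 + t)^(-3/2) with the increment of -2 t^(-1/2); it rests on v - u = 1 / (v + u)
    >= 1 / (2 v) for the two square roots. *)
Lemma sqrt_telescope (t : R) : (1 <= t)%R ->
  (/ ((1 + t) * sqrt (1 + t)) <= 2 * (/ sqrt t - / sqrt (1 + t)))%R.
Proof.
  intros Ht. set (u := sqrt t). set (v := sqrt (1 + t)).
  assert (Hu : (0 < u)%R) by (apply sqrt_lt_R0; lra).
  assert (Hv : (0 < v)%R) by (apply sqrt_lt_R0; lra).
  assert (Eu : (u * u = t)%R) by (apply sqrt_sqrt; lra).
  assert (Ev : (v * v = 1 + t)%R) by (apply sqrt_sqrt; lra).
  assert (Huv : (u < v)%R) by nra.
  rewrite <- Ev.
  assert (E1 : ((v - u) * (v + u) = 1)%R) by nra.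
  assert (E2 : (/ (2 * v) <= v - u)%R).
  { apply (Rmult_le_reg_r (2 * v)); [lra|]. rewrite Rinv_l by lra. nra. }
  replace (/ u - / v)%R with ((v - u) * / (u * v))%R by (field; lra).
  replace (/ (v * v * v))%R with (2 * (/ (2 * v) * / (v * v)))%R by (field; lra).
  apply Rmult_le_compat_l; [lra|].
  apply Rmult_le_compat; auto.
  - left; apply Rinv_0_lt_compat; lra.
  - left; apply Rinv_0_lt_compat; nra.
  - apply Rinv_le_contravar; nra.
Qed.

Lemma zweight_bounded : sums_bounded zweight 6.
Proof.
  apply Zsums_bounded; [intros; left; apply zweight_pos|]. intros n.
  unfold Zrange. rewrite lsumR_app, !lsumR_map.
  assert (A : forall h : nat -> Z, (forall i, (INR i <= IZR (Z.abs (h i)))%R) ->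
    (lsumR (fun i => zweight (h i)) (seq 0 n) <= 3)%R).
  { intros h Hh.
    assert (Hw : forall i, (zweight (h i) <= / ((1 + INR i) * sqrt (1 + INR i)))%R).
    { intros i. pose proof (pos_INR i). specialize (Hh i).
      assert (0 < sqrt (1 + INR i))%R by (apply sqrt_lt_R0; lra).
      apply Rinv_le_contravar; [nra|].
      apply Rmult_le_compat; try lra. apply sqrt_le_1; lra. }
    destruct n as [|n]; [simpl; lra|].
    (* The sharper bound is what the induction preserves: the first term is at most 1 = 3 - 2, and
       each later one is paid for by [sqrt_telescope]. *)
    apply Rle_trans with (3 - 2 * / sqrt (INR (S n)))%R.
    2:{ assert (0 < / sqrt (INR (S n)))%R; [|lra].
        apply Rinv_0_lt_compat, sqrt_lt_R0, lt_0_INR. lia. }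
    induction n as [|n IH].
    - simpl. specialize (Hw 0%nat). simpl in Hw. rewrite Rplus_0_r, sqrt_1 in Hw.
      rewrite sqrt_1. lra.
    - rewrite seq_S, lsumR_app. simpl (lsumR _ (_ :: nil)). rewrite Rplus_0_r.
      change (0 + S n)%nat with (S n).
      specialize (Hw (S n)). pose proof (sqrt_telescope (INR (S n))) as HT.
      rewrite (S_INR (S n)), (Rplus_comm _ 1).
      assert (1 <= INR (S n))%R by (rewrite S_INR; pose proof (pos_INR n); lra).
      specialize (HT H). lra. }
  assert (lsumR (fun i => zweight (Z.of_nat i)) (seq 0 n) <= 3)%R.
  { apply (A Z.of_nat). intros i. rewrite Z.abs_eq, <- INR_IZR_INZ by lia. lra. }
  assert (lsumR (fun i => zweight (- Z.of_nat (S i))) (seq 0 n) <= 3)%R.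
  { apply (A (fun i => - Z.of_nat (S i))%Z). intros i.
    rewrite Z.abs_opp, Z.abs_eq, <- INR_IZR_INZ, S_INR by lia. lra. }
  lra.
Qed.

Lemma exp_le_zweight k : (exp (- 2 * IZR (Z.abs k)) <= zweight k)%R.
Proof.
  pose proof (abs_IZR_pos k). set (t := IZR (Z.abs k)) in *.
  assert (Hs : (1 <= sqrt (1 + t))%R) by (rewrite <- sqrt_1 at 1; apply sqrt_le_1; lra).
  assert (Hs2 : (sqrt (1 + t) * sqrt (1 + t) = 1 + t)%R) by (apply sqrt_sqrt; lra).
  replace (-2 * t)%R with (- (t + t))%R by ring. rewrite exp_Ropp, exp_plus.
  unfold zweight. fold t. pose proof (exp_ineq1_le t).
  apply Rinv_le_contravar; [nra|]. apply Rmult_le_compat; nra.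
Qed.

(** Completing the square: (B + 2)^2 / (4 A) is the maximum of -A s^2 + (B + 2) s. The added 2 pays
    for the factor exp(-2 |k|) compared with the weight, and 2 |a| for passing from |k + a| to
    |k|. *)
Lemma gauss_le_zweight (A B a : R) : (0 < A)%R -> exists K : R, (0 < K)%R /\
  forall k : Z, (exp (- A * (IZR k + a) ^ 2 + B * Rabs (IZR k + a)) <= K * zweight k)%R.
Proof.
  intros HA. exists (exp ((B + 2) * (B + 2) / (4 * A) + 2 * Rabs a)). split; [apply exp_pos|].
  intros k. eapply Rle_trans; [|apply Rmult_le_compat_l; [left; apply exp_pos|apply exp_le_zweight]].
  rewrite <- exp_plus. apply exp_le. rewrite abs_IZR.
  set (t := (IZR k + a)%R).
  assert (H1 : (Rabs (IZR k) <= Rabs t + Rabs a)%R).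
  { replace (IZR k) with (t + - a)%R by (unfold t; ring). rewrite <- (Rabs_Ropp a). apply Rabs_triang. }
  replace (t ^ 2)%R with (Rabs t * Rabs t)%R
    by (rewrite <- Rabs_mult, Rabs_pos_eq; [ring|apply Rle_0_sqr]).
  set (s := Rabs t) in *.
  assert (H2 : (0 <= A * ((s - (B + 2) / (2 * A)) * (s - (B + 2) / (2 * A))))%R).
  { apply Rmult_le_pos; [lra|apply Rle_0_sqr]. }
  replace (A * ((s - (B + 2) / (2 * A)) * (s - (B + 2) / (2 * A))))%R
    with (A * (s * s) - (B + 2) * s + (B + 2) * (B + 2) / (4 * A))%R in H2 by (field; lra).
  lra.
Qed.

(** Here [a] stands for eps/2, while delta/2 is absorbed into the argument x. A real [a] suffices
    and includes the quarters produced by products of theta series. *)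
Definition tcoef (tau : C) (a : R) (k : Z) : C := Cexp (PI * Ci * tau * (IZR k + a)%R ^ 2).
Definition tfreq (a : R) (k : Z) : C := 2 * PI * Ci * (IZR k + a)%R.

(* j-th x-derivative of the general term *)
Definition tterm (tau : C) (a : R) (j : nat) (x : C) (k : Z) : C :=
  tfreq a k ^ j * (tcoef tau a k * Cexp (tfreq a k * x)).

Definition T (tau : C) (a : R) (j : nat) (x : C) : C := Zsum (tterm tau a j x).

Lemma Cmod_tfreq a k : Cmod (tfreq a k) = (2 * PI * Rabs (IZR k + a))%R.
Proof.
  unfold tfreq. rewrite !Cmod_mult, Cmod_Ci, !Cmod_R, (Rabs_pos_eq 2), (Rabs_pos_eq PI).
  - ring.
  - left; apply PI_RGT_0.
  - lra.
Qed.

Lemma Cmod_tcoef tau a k : Cmod (tcoef tau a k) = exp (- (PI * Im tau) * (IZR k + a) ^ 2).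
Proof.
  unfold tcoef. rewrite Cmod_Cexp, <- RtoC_pow. f_equal. destruct tau; simpl. ring.
Qed.

Lemma Cmod_Cexp_le z : (Cmod (Cexp z) <= exp (Cmod z))%R.
Proof.
  rewrite Cmod_Cexp. apply exp_le. eapply Rle_trans; [apply Rle_abs|apply re_le_Cmod].
Qed.

Lemma pow_le_exp (t : R) j : (0 <= t)%R -> (t ^ j <= exp (INR j * t))%R.
Proof.
  intros Ht. induction j as [|j IH].
  - simpl. rewrite Rmult_0_l, exp_0. lra.
  - rewrite S_INR, Rmult_plus_distr_r, Rmult_1_l, exp_plus, Rmult_comm. simpl.
    rewrite (Rmult_comm t). rewrite Rmult_comm. apply Rmult_le_compat; auto.
    + now apply pow_le.
    + pose proof (exp_ineq1_le t). lra.
Qed.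

Lemma tterm_bound tau a j B : (0 < Im tau)%R -> exists K, (0 < K)%R /\
  forall x k, (Cmod x <= B)%R -> (Cmod (tterm tau a j x k) <= K * zweight k)%R.
Proof.
  intros Ht.
  destruct (gauss_le_zweight (PI * Im tau) (2 * PI * (INR j + B)) a) as [K [HK H]].
  { apply Rmult_lt_0_compat; auto. apply PI_RGT_0. }
  exists K. split; auto. intros x k Hx. eapply Rle_trans; [|apply H].
  unfold tterm. rewrite !Cmod_mult, Cmod_pow, Cmod_tcoef, exp_plus, Rmult_comm, Rmult_assoc.
  apply Rmult_le_compat_l; [left; apply exp_pos|].
  set (w := Cmod (tfreq a k)). pose proof (Cmod_ge_0 (tfreq a k)) as Hw. fold w in Hw.
  replace (2 * PI * (INR j + B) * Rabs (IZR k + a))%R with (w * B + INR j * w)%R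
    by (unfold w; rewrite Cmod_tfreq; ring).
  rewrite exp_plus. apply Rmult_le_compat; auto using Cmod_ge_0, pow_le, pow_le_exp.
  eapply Rle_trans; [apply Cmod_Cexp_le|]. apply exp_le. rewrite Cmod_mult. fold w.
  now apply Rmult_le_compat_l.
Qed.

Lemma T_has_sum tau a j x : (0 < Im tau)%R -> has_sum (tterm tau a j x) (T tau a j x).
Proof.
  intros Ht. destruct (tterm_bound tau a j (Cmod x) Ht) as [K [HK H]].
  apply (has_sum_Zsum _ (fun k => K * zweight k)%R (K * 6)).
  - intros k. apply H. lra.
  - apply sums_bounded_scal; [lra|apply zweight_bounded].
Qed.

Lemma qderiv_T tau a j x : (0 < Im tau)%R -> qderiv (T tau a j) x (T tau a (S j) x).
Proof.
  intros Ht.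
  (* With w the frequency, the four summands absorb |w|^j, exp(|w||x|), the factor |w|^2 of the
     quadratic remainder, and exp(|w||h|) for |h| <= 1. *)
  destruct (gauss_le_zweight (PI * Im tau) (2 * PI * (INR j + Cmod x + 2 + 1)) a) as [K [HK H]].
  { apply Rmult_lt_0_compat; auto. apply PI_RGT_0. }
  exists (5 * (K * 6))%R, 1%R. repeat split; try lra. intros h Hh.
  replace (5 * (K * 6) * (Cmod h * Cmod h))%R with (5 * (Cmod h * Cmod h) * (K * 6))%R by ring.
  assert (Hh0 : (0 <= Cmod h * Cmod h)%R) by (apply Rmult_le_pos; apply Cmod_ge_0).
  apply (has_sum_bound (fun k => tterm tau a j (x + h) k - tterm tau a j x k - h * tterm tau a (S j) x k)
    (fun k => 5 * (Cmod h * Cmod h) * (K * zweight k))%R).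
  - replace (T tau a (S j) x * h) with (h * T tau a (S j) x) by ring.
    apply has_sum_minus; [apply has_sum_minus|apply has_sum_scal]; now apply T_has_sum.
  - intros k. unfold tterm. simpl. set (w := tfreq a k).
    rewrite Cmult_plus_distr_l, Cexp_plus.
    replace (w ^ j * (tcoef tau a k * (Cexp (w * x) * Cexp (w * h))) -
      w ^ j * (tcoef tau a k * Cexp (w * x)) - h * (w * w ^ j * (tcoef tau a k * Cexp (w * x))))
      with (tcoef tau a k * (w ^ j * Cexp (w * x) * (Cexp (w * h) - 1 - w * h))) by ring.
    rewrite !Cmod_mult, Cmod_pow, Cmod_tcoef.
    pose proof (Cmod_ge_0 w) as Hw. pose proof (Cmod_ge_0 h) as Hh1.
    pose proof (Cexp_quad (w * h)) as Hq. rewrite Cmod_mult in Hq.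
    specialize (H k). rewrite exp_plus in H.
    replace (2 * PI * (INR j + Cmod x + 2 + 1) * Rabs (IZR k + a))%R
      with (INR j * Cmod w + (Cmod w * Cmod x + (INR 2 * Cmod w + Cmod w)))%R in H
      by (unfold w; rewrite Cmod_tfreq; simpl; ring).
    rewrite !exp_plus in H.
    assert (P1 : (Cmod w ^ j <= exp (INR j * Cmod w))%R) by now apply pow_le_exp.
    assert (P2 : (Cmod w ^ 2 <= exp (INR 2 * Cmod w))%R) by now apply pow_le_exp.
    assert (P3 : (Cmod (Cexp (w * x)) <= exp (Cmod w * Cmod x))%R).
    { rewrite <- Cmod_mult. apply Cmod_Cexp_le. }
    assert (P4 : (exp (Cmod w * Cmod h) <= exp (Cmod w))%R) by (apply exp_le; nra).
    assert (P5 : (Cmod (Cexp (w * h) - 1 - w * h) <=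
      5 * (Cmod h * Cmod h) * (exp (INR 2 * Cmod w) * exp (Cmod w)))%R).
    { eapply Rle_trans; [exact Hq|].
      replace (5 * (Cmod w * Cmod h * (Cmod w * Cmod h)) * exp (Cmod w * Cmod h))%R
        with (5 * (Cmod h * Cmod h) * (Cmod w ^ 2 * exp (Cmod w * Cmod h)))%R by ring.
      apply Rmult_le_compat_l; [lra|].
      apply Rmult_le_compat; auto; [apply pow_le; auto|left; apply exp_pos]. }
    apply Rle_trans with (5 * (Cmod h * Cmod h) * (exp (- (PI * Im tau) * (IZR k + a) ^ 2) *
      (exp (INR j * Cmod w) * (exp (Cmod w * Cmod x) * (exp (INR 2 * Cmod w) * exp (Cmod w))))))%R.
    + replace (5 * (Cmod h * Cmod h) * (exp (- (PI * Im tau) * (IZR k + a) ^ 2) *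
       (exp (INR j * Cmod w) * (exp (Cmod w * Cmod x) * (exp (INR 2 * Cmod w) * exp (Cmod w))))))%R
       with (exp (- (PI * Im tau) * (IZR k + a) ^ 2) * (exp (INR j * Cmod w) * exp (Cmod w * Cmod x) *
         (5 * (Cmod h * Cmod h) * (exp (INR 2 * Cmod w) * exp (Cmod w)))))%R by ring.
      apply Rmult_le_compat_l; [left; apply exp_pos|].
      apply Rmult_le_compat; auto using Cmod_ge_0.
      * apply Rmult_le_pos; auto using Cmod_ge_0, pow_le.
      * apply Rmult_le_compat; auto using Cmod_ge_0, pow_le.
    + apply Rmult_le_compat_l; [lra|exact H].
  - apply sums_bounded_scal; [lra|]. apply sums_bounded_scal; [lra|apply zweight_bounded].
Qed.

(** * Addition formulas *)

Lemma Zsum_ext f g : (forall k, f k = g k) -> Zsum f = Zsum g.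
Proof.
  intros H. unfold Zsum, CSeries. now do 4 (f_equal; try (apply Series_ext; intros; now rewrite H)).
Qed.

Lemma has_sum_bool (G : bool -> C) : has_sum G (G false + G true).
Proof.
  intros eps He. exists (false :: true :: nil). intros L HL Hi.
  assert (HP : Permutation L (false :: true :: nil)).
  { apply NoDup_Permutation; auto.
    - repeat constructor; simpl; intuition discriminate.
    - intros [|]; split; intros; auto; simpl; auto. }
  rewrite (lsum_perm G _ _ HP). simpl.
  replace (G false + (G true + 0) - (G false + G true)) with (RtoC 0) by ring.
  now rewrite Cmod_0.
Qed.

Lemma Im_double_pos (tau : C) : (0 < Im tau)%R -> (0 < Im (2 * tau))%R.
Proof. destruct tau; simpl. lra. Qed.

Lemma T_has_sum_prod tau a b x y : (0 < Im tau)%R ->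
  has_sum (fun p : Z * Z => tterm tau a 0 x (fst p) * tterm tau b 0 y (snd p)) (T tau a 0 x * T tau b 0 y).
Proof.
  intros Ht. destruct (tterm_bound tau a 0 (Cmod x) Ht) as [K [HK H]].
  destruct (tterm_bound tau b 0 (Cmod y) Ht) as [K' [HK' H']].
  apply (has_sum_prod _ _ (fun k => K * zweight k)%R (fun k => K' * zweight k)%R (K * 6) (K' * 6)).
  - intros i. apply H. lra.
  - intros i. apply H'. lra.
  - apply sums_bounded_scal; [lra|apply zweight_bounded].
  - apply sums_bounded_scal; [lra|apply zweight_bounded].
  - now apply T_has_sum.
  - now apply T_has_sum.
Qed.

(* The substitution (m, n) = (p + q + r, p - q), with r the parity of m + n, separates the variables. *)
Lemma T_product tau a b x y : (0 < Im tau)%R ->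
  T tau a 0 (x + y) * T tau b 0 (x - y) =
  T (2 * tau) ((a + b) / 2) 0 (2 * x) * T (2 * tau) ((a - b) / 2) 0 (2 * y) +
  T (2 * tau) ((a + b + 1) / 2) 0 (2 * x) * T (2 * tau) ((a - b + 1) / 2) 0 (2 * y).
Proof.
  intros Ht.
  set (h := fun p : bool * (Z * Z) =>
    (fst (snd p) + snd (snd p) + Z.b2z (fst p), fst (snd p) - snd (snd p))%Z).
  (* The inverse of [h]: the first quotient drops the parity by rounding down, while in the second
     it is subtracted beforehand and the division is exact. *)
  set (k := fun p : Z * Z => (Z.odd (fst p + snd p),
    ((fst p + snd p) / 2, (fst p - snd p - Z.b2z (Z.odd (fst p + snd p))) / 2)%Z)).
  set (F := fun p : Z * Z => tterm tau a 0 (x + y) (fst p) * tterm tau b 0 (x - y) (snd p)).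
  assert (HF : has_sum F (T tau a 0 (x + y) * T tau b 0 (x - y))) 
    by exact (T_has_sum_prod tau a b _ _ Ht).
  apply (has_sum_bij h k) in HF.
  - set (G := fun r : bool =>
      T (2 * tau) ((a + b + if r then 1 else 0) / 2) 0 (2 * x) *
      T (2 * tau) ((a - b + if r then 1 else 0) / 2) 0 (2 * y)).
    replace (T (2 * tau) ((a + b) / 2) 0 (2 * x) * T (2 * tau) ((a - b) / 2) 0 (2 * y) + _)
      with (G false + G true) by (unfold G; now rewrite !Rplus_0_r).
    refine (has_sum_unique G _ _ (has_sum_fubini _ G _ HF _) (has_sum_bool G)).
    intros r. set (e := if r then 1%R else 0%R).
    apply (has_sum_ext (fun p : Z * Z => tterm (2 * tau) ((a + b + e) / 2) 0 (2 * x) (fst p) *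
      tterm (2 * tau) ((a - b + e) / 2) 0 (2 * y) (snd p))).
    (* With m = p + q + e and n = p - q, the exponents agree because (m + a)^2 + (n + b)^2 = 2 (p +
       (a + b + e)/2)^2 + 2 (q + (a - b + e)/2)^2; the factors 2 become the modulus 2 tau. *)
    + intros [p q]. unfold F, h, tterm; simpl. rewrite !Cmult_1_l.
      unfold tcoef, tfreq. rewrite <- !Cexp_plus. f_equal.
      rewrite !plus_IZR, !minus_IZR. replace (IZR (Z.b2z r)) with e by (destruct r; easy).
      rewrite !RtoC_plus, !RtoC_div, !RtoC_minus, !RtoC_plus, !RtoC_minus by lra.
      field.
    + exact (T_has_sum_prod _ _ _ _ _ (Im_double_pos tau Ht)).
  - intros [r [p q]]. unfold k, h; simpl.
    replace (p + q + Z.b2z r + (p - q))%Z with (Z.b2z r + 2 * p)%Z by ring.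
    rewrite Z.odd_add_mul_2. replace (Z.odd (Z.b2z r)) with r by now destruct r.
    f_equal. f_equal.
    + rewrite Z.mul_comm, Z.div_add by lia. now destruct r.
    + replace (p + q + Z.b2z r - (p - q) - Z.b2z r)%Z with (q * 2)%Z by ring.
      now rewrite Z.div_mul.
  - intros [m n]. unfold k, h; simpl.
    pose proof (Z.div_mod (m + n) 2 ltac:(lia)) as E. rewrite Zmod_odd in E.
    set (p := ((m + n) / 2)%Z) in *.
    replace (if Z.odd (m + n) then 1%Z else 0%Z) with (Z.b2z (Z.odd (m + n))) in E
      by now destruct (Z.odd (m + n)).
    set (r := Z.b2z (Z.odd (m + n))) in *.
    replace (m - n - r)%Z with ((p - n) * 2)%Z by lia. rewrite Z.div_mul by lia.
    f_equal; lia.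
Qed.

Lemma T_char_add1 tau a j x : (0 < Im tau)%R -> T tau (a + 1) j x = T tau a j x.
Proof.
  intros Ht. apply (has_sum_unique (tterm tau (a + 1) j x)); [now apply T_has_sum|].
  apply (has_sum_ext (fun k => tterm tau a j x (k + 1)%Z)).
  - intros k. unfold tterm, tcoef, tfreq.
    replace (IZR (k + 1) + a)%R with (IZR k + (a + 1))%R by (rewrite plus_IZR; ring). easy.
  - apply (has_sum_bij (fun k => k + 1)%Z (fun k => k - 1)%Z); try (intros; lia).
    now apply T_has_sum.
Qed.

Lemma T_opp tau a j x : (0 < Im tau)%R -> T tau a j (- x) = (-1) ^ j * T tau (- a) j x.
Proof.
  intros Ht. apply (has_sum_unique (tterm tau a j (- x))); [now apply T_has_sum|].
  apply (has_sum_ext (fun k => (-1) ^ j * tterm tau (- a) j x (- k)%Z)).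
  - intros k. unfold tterm.
    assert (E : tfreq (- a) (- k) = (-1) * tfreq a k).
    { unfold tfreq. rewrite opp_IZR.
      replace (- IZR k + - a)%R with (- (IZR k + a))%R by ring. rewrite RtoC_opp. ring. }
    assert (E' : tcoef tau (- a) (- k) = tcoef tau a k).
    { unfold tcoef. rewrite opp_IZR.
      replace (- IZR k + - a)%R with (- (IZR k + a))%R by ring. rewrite RtoC_opp.
      f_equal. ring. }
    rewrite E, E', Cpow_mult_l.
    replace (-1 * tfreq a k * x) with (tfreq a k * - x) by ring.
    assert (Es : (-1) ^ j * (-1) ^ j = 1).
    { rewrite <- Cpow_mult_l. replace (-1 * -1) with (RtoC 1) by ring. apply Cpow_1_l. }
    rewrite !Cmult_assoc, Es. ring.
  - apply has_sum_scal.
    apply (has_sum_bij (fun k => - k)%Z (fun k => - k)%Z); try (intros; lia).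
    now apply T_has_sum.
Qed.

Lemma T_add1 tau a j x : (0 < Im tau)%R -> T tau a j (x + 1) = Cexp (2 * PI * Ci * a) * T tau a j x.
Proof.
  intros Ht. apply (has_sum_unique (tterm tau a j (x + 1))); [now apply T_has_sum|].
  apply (has_sum_ext (fun k => Cexp (2 * PI * Ci * a) * tterm tau a j x k));
    [|now apply has_sum_scal, T_has_sum].
  intros k. unfold tterm. replace (tfreq a k * (x + 1))
    with (2 * PI * Ci * a + (2 * PI * Ci * ZtoC k + tfreq a k * x)).
  - rewrite !Cexp_plus, Cexp_2PI_Z. ring.
  - unfold tfreq, ZtoC. rewrite RtoC_plus. ring.
Qed.

(** * The four theta functions: derivatives, parity and bilinear formulas *)

Lemma theta_char_T tau (e d : R) x : theta_char e d x tau = T tau (e / 2) 0 (x + d / 2).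
Proof.
  unfold T. apply Zsum_ext. intros k. unfold tterm, tcoef, tfreq, ZtoC.
  rewrite RtoC_plus, RtoC_div by lra. simpl. rewrite Cmult_1_l, <- Cexp_plus.
  f_equal. ring.
Qed.

Opaque T.

(* j-th x-derivative of theta k *)
Definition thd (tau : C) (k : Z) (j : nat) (x : C) : C :=
  match k with
  | 1%Z => - T tau (1 / 2) j (x + 1 / 2)
  | 2%Z => T tau (1 / 2) j x
  | 3%Z => T tau 0 j x
  | 4%Z => T tau 0 j (x + 1 / 2)
  | _ => 0
  end.

Lemma theta_thd tau k x : theta k x tau = thd tau k 0 x.
Proof.
  destruct k as [|[[| |]|[|[]|]|]|]; try easy; simpl; rewrite theta_char_T;
    rewrite ?Rdiv_0_l; try easy; do 2 f_equal; rewrite ?Cdiv_0_l; try easy.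
  all: unfold Cdiv; ring.
Qed.

Lemma qderiv_thd tau k j x : (0 < Im tau)%R -> qderiv (thd tau k j) x (thd tau k (S j) x).
Proof.
  intros Ht.
  assert (H : forall a, qderiv (fun y => T tau a j (y + 1 / 2)) x (T tau a (S j) (x + 1 / 2))).
  { intros a. apply (qderiv_ext (fun y => T tau a j (1 * y + 1 / 2))).
    - intros y. f_equal. ring.
    - replace (T tau a (S j) (x + 1 / 2)) with (1 * T tau a (S j) (1 * x + 1 / 2)).
      + now apply qderiv_affine, qderiv_T.
      + rewrite Cmult_1_l. f_equal. ring. }
  destruct k as [|[[p|p|]|[p|[p|p|]|]|]|p]; try exact (qderiv_const 0 x).
  - exact (qderiv_T tau 0 j x Ht).
  - exact (H 0%R).
  - exact (qderiv_T tau (1 / 2) j x Ht).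
  - change (qderiv (fun y => - T tau (1 / 2) j (y + 1 / 2)) x (- T tau (1 / 2) (S j) (x + 1 / 2))).
    apply (qderiv_ext (fun y => (-1) * T tau (1 / 2) j (y + 1 / 2))); [intros; ring|].
    replace (- T tau (1 / 2) (S j) (x + 1 / 2)) with ((-1) * T tau (1 / 2) (S j) (x + 1 / 2)) by ring.
    apply qderiv_scal, H.
Qed.

Lemma Cexp_PI_R (r : R) (z : C) : Cexp (PI * Ci * r) = z -> Cexp (2 * PI * Ci * (r / 2)%R) = z.
Proof. intros <-. f_equal. rewrite RtoC_div by lra. field. Qed.

Lemma T_half_add1 tau j x : (0 < Im tau)%R -> T tau (1 / 2) j (x + 1) = - T tau (1 / 2) j x.
Proof.
  intros Ht. rewrite T_add1, (Cexp_PI_R 1 (-1)); auto; [ring|].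
  rewrite Cmult_1_r. apply Cexp_PI.
Qed.

Lemma T_0_add1 tau j x : (0 < Im tau)%R -> T tau 0 j (x + 1) = T tau 0 j x.
Proof.
  intros Ht. rewrite T_add1, Cmult_0_r, Cexp_0 by auto. ring.
Qed.

Lemma T_quarter_add1 tau j x : (0 < Im tau)%R -> T tau (1 / 4) j (x + 1) = Ci * T tau (1 / 4) j x.
Proof.
  intros Ht. rewrite T_add1 by auto. f_equal. transitivity (Cexp (PI * Ci / 2)); [|apply Cexp_PI_half].
  f_equal. rewrite RtoC_div by lra. field.
Qed.

Lemma T_3quarter_add1 tau j x : (0 < Im tau)%R -> T tau (3 / 4) j (x + 1) = - Ci * T tau (3 / 4) j x.
Proof.
  intros Ht. rewrite T_add1 by auto. f_equal.
  replace (2 * PI * Ci * (3 / 4)%R) with (PI * Ci + PI * Ci / 2)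
    by (rewrite RtoC_div by lra; field).
  rewrite Cexp_plus, Cexp_PI, Cexp_PI_half. ring.
Qed.

Lemma T_half_opp tau j x : (0 < Im tau)%R -> T tau (1 / 2) j (- x) = (-1) ^ j * T tau (1 / 2) j x.
Proof.
  intros Ht. rewrite T_opp by auto. f_equal. rewrite <- (T_char_add1 tau (- (1 / 2))) by auto.
  f_equal. field.
Qed.

Lemma T_0_opp tau j x : (0 < Im tau)%R -> T tau 0 j (- x) = (-1) ^ j * T tau 0 j x.
Proof. intros Ht. rewrite T_opp by auto. now rewrite Ropp_0. Qed.

Lemma T_3quarter_opp tau j x : (0 < Im tau)%R -> T tau (3 / 4) j (- x) = (-1) ^ j * T tau (1 / 4) j x.
Proof.
  intros Ht. rewrite T_opp by auto. f_equal. rewrite <- (T_char_add1 tau (- (3 / 4))) by auto.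
  f_equal. field.
Qed.

Lemma thd_opp tau k j x : (0 < Im tau)%R ->
  thd tau k j (- x) = (if Z.eqb k 1 then -1 else 1) * (-1) ^ j * thd tau k j x.
Proof.
  intros Ht. destruct k as [|[[| |]|[|[]|]|]|]; simpl; try ring.
  - rewrite T_0_opp by auto. ring.
  - replace (- x + 1 / 2) with (- (x + 1 / 2) + 1) by field.
    rewrite T_0_add1, T_0_opp by auto. ring.
  - rewrite T_half_opp by auto. ring.
  - replace (- x + 1 / 2) with (- (x + 1 / 2) + 1) by field.
    rewrite T_half_add1, T_half_opp by auto. ring.
Qed.

Lemma C_eq_opp_0 (z : C) : z = - z -> z = 0.
Proof.
  intros H. assert (E : z = (z - - z) / 2) by field. rewrite E, <- H. field.
Qed.

(** The condition says that the j-th derivative is odd: theta_1 is odd, the others are even, and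
    each differentiation changes the parity. *)
Lemma thd_zero tau k j : (0 < Im tau)%R -> Nat.even j = Z.eqb k 1 -> thd tau k j 0 = 0.
Proof.
  intros Ht E. apply C_eq_opp_0. rewrite <- Copp_0 at 1. rewrite thd_opp by auto.
  assert (Hj : (-1) ^ j = if Nat.even j then 1 else -1).
  { clear. induction j as [|j IH]; [easy|]. rewrite Nat.even_succ, <- Nat.negb_even.
    simpl. rewrite IH. destruct (Nat.even j); simpl; ring. }
  rewrite Hj, E. destruct (Z.eqb k 1); ring.
Qed.

Lemma T_product_shift tau a b s t x y : (0 < Im tau)%R ->
  T tau a 0 (x + y + s) * T tau b 0 (x - y + t) =
  T (2 * tau) ((a + b) / 2) 0 (2 * x + (s + t)) * T (2 * tau) ((a - b) / 2) 0 (2 * y + (s - t)) +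
  T (2 * tau) ((a + b + 1) / 2) 0 (2 * x + (s + t)) * T (2 * tau) ((a - b + 1) / 2) 0 (2 * y + (s - t)).
Proof.
  intros Ht. replace (2 * x + (s + t)) with (2 * (x + (s + t) / 2)) by field.
  replace (2 * y + (s - t)) with (2 * (y + (s - t) / 2)) by field.
  rewrite <- T_product by auto. f_equal; f_equal; field.
Qed.

Lemma T_product_0_0 tau s t x y : (0 < Im tau)%R ->
  T tau 0 0 (x + y + s) * T tau 0 0 (x - y + t) =
  T (2 * tau) 0 0 (2 * x + (s + t)) * T (2 * tau) 0 0 (2 * y + (s - t)) +
  T (2 * tau) (1 / 2) 0 (2 * x + (s + t)) * T (2 * tau) (1 / 2) 0 (2 * y + (s - t)).
Proof. intros Ht. rewrite T_product_shift by auto. do 2 f_equal; f_equal; field. Qed.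

Lemma T_product_half_half tau s t x y : (0 < Im tau)%R ->
  T tau (1 / 2) 0 (x + y + s) * T tau (1 / 2) 0 (x - y + t) =
  T (2 * tau) (1 / 2) 0 (2 * x + (s + t)) * T (2 * tau) 0 0 (2 * y + (s - t)) +
  T (2 * tau) 0 0 (2 * x + (s + t)) * T (2 * tau) (1 / 2) 0 (2 * y + (s - t)).
Proof.
  intros Ht. rewrite T_product_shift by auto. rewrite <- (T_char_add1 (2 * tau) 0 0 (2 * x + _))
    by now apply Im_double_pos. do 2 f_equal; f_equal; field.
Qed.

Lemma T_product_half_0 tau s t x y : (0 < Im tau)%R ->
  T tau (1 / 2) 0 (x + y + s) * T tau 0 0 (x - y + t) =
  T (2 * tau) (1 / 4) 0 (2 * x + (s + t)) * T (2 * tau) (1 / 4) 0 (2 * y + (s - t)) +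
  T (2 * tau) (3 / 4) 0 (2 * x + (s + t)) * T (2 * tau) (3 / 4) 0 (2 * y + (s - t)).
Proof. intros Ht. rewrite T_product_shift by auto. do 2 f_equal; f_equal; field. Qed.

Lemma th11_product tau x y : (0 < Im tau)%R ->
  thd tau 1 0 (x + y) * thd tau 1 0 (x - y) =
  T (2 * tau) 0 0 (2 * x) * T (2 * tau) (1 / 2) 0 (2 * y) -
  T (2 * tau) (1 / 2) 0 (2 * x) * T (2 * tau) 0 0 (2 * y).
Proof.
  intros Ht. pose proof (Im_double_pos tau Ht) as Ht2.
  unfold thd. pose proof (T_product_half_half tau (1 / 2) (1 / 2) x y Ht) as E.
  replace (2 * x + (1 / 2 + 1 / 2)) with (2 * x + 1) in E by field.
  replace (2 * y + (1 / 2 - 1 / 2)) with (2 * y) in E by field.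
  rewrite T_half_add1, T_0_add1 in E by auto.
  transitivity (T tau (1 / 2) 0 (x + y + 1 / 2) * T tau (1 / 2) 0 (x - y + 1 / 2)); [ring|].
  rewrite E. ring.
Qed.

Lemma th22_product tau x y : (0 < Im tau)%R ->
  thd tau 2 0 (x + y) * thd tau 2 0 (x - y) =
  T (2 * tau) (1 / 2) 0 (2 * x) * T (2 * tau) 0 0 (2 * y) +
  T (2 * tau) 0 0 (2 * x) * T (2 * tau) (1 / 2) 0 (2 * y).
Proof.
  intros Ht. unfold thd. pose proof (T_product_half_half tau 0 0 x y Ht) as E.
  rewrite !Cplus_0_r in E. replace (0 - 0) with (RtoC 0) in E by ring. now rewrite !Cplus_0_r in E.
Qed.

Lemma th33_product tau x y : (0 < Im tau)%R ->
  thd tau 3 0 (x + y) * thd tau 3 0 (x - y) =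
  T (2 * tau) 0 0 (2 * x) * T (2 * tau) 0 0 (2 * y) +
  T (2 * tau) (1 / 2) 0 (2 * x) * T (2 * tau) (1 / 2) 0 (2 * y).
Proof.
  intros Ht. unfold thd. pose proof (T_product_0_0 tau 0 0 x y Ht) as E.
  rewrite !Cplus_0_r in E. replace (0 - 0) with (RtoC 0) in E by ring. now rewrite !Cplus_0_r in E.
Qed.

Lemma th44_product tau x y : (0 < Im tau)%R ->
  thd tau 4 0 (x + y) * thd tau 4 0 (x - y) =
  T (2 * tau) 0 0 (2 * x) * T (2 * tau) 0 0 (2 * y) -
  T (2 * tau) (1 / 2) 0 (2 * x) * T (2 * tau) (1 / 2) 0 (2 * y).
Proof.
  intros Ht. pose proof (Im_double_pos tau Ht) as Ht2.
  unfold thd. pose proof (T_product_0_0 tau (1 / 2) (1 / 2) x y Ht) as E.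
  replace (2 * x + (1 / 2 + 1 / 2)) with (2 * x + 1) in E by field.
  replace (2 * y + (1 / 2 - 1 / 2)) with (2 * y) in E by field.
  rewrite T_half_add1, T_0_add1 in E by auto. rewrite E. ring.
Qed.

Lemma thd_sqr (tau : C) (k : Z) (x : C) (F : C) :
  thd tau k 0 (x + 0) * thd tau k 0 (x - 0) = F -> thd tau k 0 x ^ 2 = F.
Proof.
  replace (x + 0) with x by ring. replace (x - 0) with x by ring. intros <-. ring.
Qed.

(** With A and B the series of modulus 2 tau and characteristics 0 and 1/2, every factor is bilinear
    in the values of A and B at 2x, 2y and 0, and the claim becomes a polynomial identity in these
    values. *)
Lemma theta_addition tau x y : (0 < Im tau)%R ->
  thd tau 1 0 (x + y) * thd tau 1 0 (x - y) * thd tau 2 0 0 ^ 2 =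
  thd tau 1 0 x ^ 2 * thd tau 2 0 y ^ 2 - thd tau 2 0 x ^ 2 * thd tau 1 0 y ^ 2.
Proof.
  intros Ht. rewrite (th11_product tau x y Ht).
  rewrite (thd_sqr _ _ _ _ (th22_product tau 0 0 Ht)), (thd_sqr _ _ _ _ (th22_product tau x 0 Ht)),
    (thd_sqr _ _ _ _ (th22_product tau y 0 Ht)), (thd_sqr _ _ _ _ (th11_product tau x 0 Ht)),
    (thd_sqr _ _ _ _ (th11_product tau y 0 Ht)). ring.
Qed.

(** Again a polynomial identity in the two series of modulus 2 tau. Its second derivative at 0
    serves to eliminate theta_3''(0); [theta_square_24] does the same for theta_4''(0). *)
Lemma theta_square_23 tau x : (0 < Im tau)%R ->
  thd tau 3 0 0 ^ 2 * thd tau 2 0 x ^ 2 - thd tau 2 0 0 ^ 2 * thd tau 3 0 x ^ 2 =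
  - (thd tau 4 0 0 ^ 2 * thd tau 1 0 x ^ 2).
Proof.
  intros Ht.
  rewrite (thd_sqr _ _ _ _ (th22_product tau 0 0 Ht)), (thd_sqr _ _ _ _ (th22_product tau x 0 Ht)),
    (thd_sqr _ _ _ _ (th33_product tau x 0 Ht)), (thd_sqr _ _ _ _ (th33_product tau 0 0 Ht)),
    (thd_sqr _ _ _ _ (th44_product tau 0 0 Ht)), (thd_sqr _ _ _ _ (th11_product tau x 0 Ht)).
  rewrite !Cmult_0_r. ring.
Qed.

Lemma theta_square_24 tau x : (0 < Im tau)%R ->
  thd tau 4 0 0 ^ 2 * thd tau 2 0 x ^ 2 - thd tau 2 0 0 ^ 2 * thd tau 4 0 x ^ 2 =
  - (thd tau 3 0 0 ^ 2 * thd tau 1 0 x ^ 2).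
Proof.
  intros Ht.
  rewrite (thd_sqr _ _ _ _ (th22_product tau 0 0 Ht)), (thd_sqr _ _ _ _ (th22_product tau x 0 Ht)),
    (thd_sqr _ _ _ _ (th44_product tau x 0 Ht)), (thd_sqr _ _ _ _ (th33_product tau 0 0 Ht)),
    (thd_sqr _ _ _ _ (th44_product tau 0 0 Ht)), (thd_sqr _ _ _ _ (th11_product tau x 0 Ht)).
  rewrite !Cmult_0_r. ring.
Qed.

(** * Derivatives of the bilinear formulas *)

Lemma qderiv_add_r f x l : qderiv f x l -> qderiv (fun y => f (x + y)) 0 l.
Proof.
  intros H. apply (qderiv_ext (fun y => f (1 * y + x))); [intros; f_equal; ring|].
  replace l with (1 * l) by ring. apply qderiv_affine.
  now replace (1 * 0 + x) with x by ring.
Qed.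

Lemma qderiv_sub_r f x l : qderiv f x l -> qderiv (fun y => f (x - y)) 0 (- l).
Proof.
  intros H. apply (qderiv_ext (fun y => f ((-1) * y + x))); [intros; f_equal; ring|].
  replace (- l) with ((-1) * l) by ring. apply qderiv_affine.
  now replace (-1 * 0 + x) with x by ring.
Qed.

(* Differentiating f (x + y) g (x - y) in y at y = 0 produces the Wronskian. *)
Lemma wronskian_product (f g P Q : C -> C) (x f' g' p q P' Q' : C) :
  qderiv f x f' -> qderiv g x g' -> qderiv P 0 P' -> qderiv Q 0 Q' ->
  (forall y, f (x + y) * g (x - y) = p * P y + q * Q y) ->
  f' * g x - f x * g' = p * P' + q * Q'.
Proof.
  intros Hf Hg HP HQ H.
  pose proof (qderiv_mult _ _ _ _ _ (qderiv_add_r f x f' Hf) (qderiv_sub_r g x g' Hg)) as H1.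
  pose proof (qderiv_plus _ _ _ _ _ (qderiv_scal p _ _ _ HP) (qderiv_scal q _ _ _ HQ)) as H2.
  apply (qderiv_ext _ _ _ _ H) in H1.
  rewrite <- (qderiv_unique _ _ _ _ H1 H2).
  replace (x + 0) with x by ring. replace (x - 0) with x by ring. ring.
Qed.

Lemma qderiv_T_double tau a s : (0 < Im tau)%R ->
  qderiv (fun y => T tau a 0 (2 * y + s)) 0 (2 * T tau a 1 s).
Proof.
  intros Ht. apply (qderiv_affine (T tau a 0)). replace (2 * 0 + s) with s by ring.
  now apply qderiv_T.
Qed.

(** The Wronskian and theta_3 theta_4 are both constant multiples of the single function T(2 tau) of
    characteristic 0 at 2x + 1/2; comparing them at x = 0 removes the unknown constants. *)
Lemma wronskian_12 tau x : (0 < Im tau)%R ->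
  (thd tau 1 1 x * thd tau 2 0 x - thd tau 1 0 x * thd tau 2 1 x) *
    (thd tau 3 0 0 * thd tau 4 0 0) =
  thd tau 1 1 0 * thd tau 2 0 0 * (thd tau 3 0 x * thd tau 4 0 x).
Proof.
  intros Ht. pose proof (Im_double_pos tau Ht) as Ht2.
  set (h := 1 / 2 : C).
  assert (Ehalf : forall j, T (2 * tau) (1 / 2) j (- h) = - T (2 * tau) (1 / 2) j h).
  { intros j. replace h with (- h + 1) at 2 by (unfold h; field). rewrite T_half_add1 by auto. ring. }
  assert (E0half : forall j, T (2 * tau) 0 j (- h) = T (2 * tau) 0 j h).
  { intros j. replace h with (- h + 1) at 2 by (unfold h; field). now rewrite T_0_add1. }
  (* The point 1/2 is fixed by z -> 1 - z; the reflection changes the sign of both values below, so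
     they vanish and one of the two bilinear terms drops out. *)
  assert (Z1 : T (2 * tau) 0 1 h = 0).
  { apply C_eq_opp_0. rewrite <- E0half at 1. rewrite T_0_opp by auto. simpl. ring. }
  assert (Z2 : T (2 * tau) (1 / 2) 0 h = 0).
  { apply C_eq_opp_0. rewrite <- Ehalf. rewrite T_half_opp by auto. simpl. ring. }
  assert (W : forall z, thd tau 1 1 z * thd tau 2 0 z - thd tau 1 0 z * thd tau 2 1 z =
    - T (2 * tau) (1 / 2) 0 (2 * z + h) * (2 * T (2 * tau) 0 1 h) +
    - T (2 * tau) 0 0 (2 * z + h) * (2 * T (2 * tau) (1 / 2) 1 h)).
  { intros z. apply (wronskian_product (thd tau 1 0) (thd tau 2 0)
      (fun y => T (2 * tau) 0 0 (2 * y + h)) (fun y => T (2 * tau) (1 / 2) 0 (2 * y + h)));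
      try (now apply qderiv_thd); try (now apply qderiv_T_double).
    intros y. unfold thd.
    pose proof (T_product_half_half tau h 0 z y Ht) as E.
    replace (h + 0) with h in E by ring. replace (h - 0) with h in E by ring.
    replace (z - y + 0) with (z - y) in E by ring.
    transitivity (- (T tau (1 / 2) 0 (z + y + h) * T tau (1 / 2) 0 (z - y))); [unfold h; ring|].
    rewrite E. ring. }
  assert (Q : forall z, thd tau 3 0 z * thd tau 4 0 z = T (2 * tau) 0 0 (2 * z + h) * T (2 * tau) 0 0 h).
  { intros z. unfold thd. pose proof (T_product_0_0 tau 0 h z 0 Ht) as E.
    replace (2 * 0 + (0 - h)) with (- h) in E by ring. rewrite Ehalf, E0half, Z2 in E.
    replace (z + 0 + 0) with z in E by ring. replace (z - 0 + h) with (z + h) in E by ring.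
    replace (0 + h) with h in E by ring. fold h. rewrite E. ring. }
  pose proof (W 0) as W0. rewrite (thd_zero tau 1 0), (thd_zero tau 2 1) in W0 by auto.
  replace (thd tau 1 1 0 * thd tau 2 0 0) with (thd tau 1 1 0 * thd tau 2 0 0 - 0 * 0) by ring.
  rewrite W0, W, !Q, Z1. ring.
Qed.

(** Mixed characteristics lead to the quarters 1/4 and 3/4. The reflection exchanges them, so that
    their coefficients at 1/2 are proportional and the Wronskian and theta_2 theta_4 share one
    combination of the two series at 2x + 1/2. *)
Lemma wronskian_13 tau x : (0 < Im tau)%R ->
  (thd tau 1 1 x * thd tau 3 0 x - thd tau 1 0 x * thd tau 3 1 x) *
    (thd tau 2 0 0 * thd tau 4 0 0) =
  thd tau 1 1 0 * thd tau 3 0 0 * (thd tau 2 0 x * thd tau 4 0 x).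
Proof.
  intros Ht. pose proof (Im_double_pos tau Ht) as Ht2.
  set (h := 1 / 2 : C).
  assert (E1 : forall j, T (2 * tau) (1 / 4) j (- h) = - Ci * T (2 * tau) (1 / 4) j h).
  { intros j. replace h with (- h + 1) at 2 by (unfold h; field). rewrite T_quarter_add1 by auto.
    rewrite Cmult_assoc. replace (- Ci * Ci) with (- (Ci * Ci)) by ring. rewrite Ci_sqr. ring. }
  assert (E3 : forall j, T (2 * tau) (3 / 4) j h = (-1) ^ j * (- Ci * T (2 * tau) (1 / 4) j h)).
  { intros j. rewrite <- E1. replace h with (- - h) at 1 by ring. now rewrite T_3quarter_opp. }
  assert (E3' : T (2 * tau) (3 / 4) 0 (- h) = T (2 * tau) (1 / 4) 0 h).
  { rewrite T_3quarter_opp by auto. simpl. ring. }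
  assert (W : forall z, thd tau 1 1 z * thd tau 3 0 z - thd tau 1 0 z * thd tau 3 1 z =
    - T (2 * tau) (1 / 4) 0 (2 * z + h) * (2 * T (2 * tau) (1 / 4) 1 h) +
    - T (2 * tau) (3 / 4) 0 (2 * z + h) * (2 * T (2 * tau) (3 / 4) 1 h)).
  { intros z. apply (wronskian_product (thd tau 1 0) (thd tau 3 0)
      (fun y => T (2 * tau) (1 / 4) 0 (2 * y + h)) (fun y => T (2 * tau) (3 / 4) 0 (2 * y + h)));
      try (now apply qderiv_thd); try (now apply qderiv_T_double).
    intros y. unfold thd.
    pose proof (T_product_half_0 tau h 0 z y Ht) as E.
    replace (h + 0) with h in E by ring. replace (h - 0) with h in E by ring.
    replace (z - y + 0) with (z - y) in E by ring.
    transitivity (- (T tau (1 / 2) 0 (z + y + h) * T tau 0 0 (z - y))); [unfold h; ring|].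
    rewrite E. ring. }
  assert (Q : forall z, thd tau 2 0 z * thd tau 4 0 z =
    (T (2 * tau) (1 / 4) 0 (2 * z + h) * - Ci + T (2 * tau) (3 / 4) 0 (2 * z + h)) *
    T (2 * tau) (1 / 4) 0 h).
  { intros z. unfold thd. pose proof (T_product_half_0 tau 0 h z 0 Ht) as E.
    replace (2 * 0 + (0 - h)) with (- h) in E by ring. rewrite E1, E3' in E.
    replace (z + 0 + 0) with z in E by ring. replace (z - 0 + h) with (z + h) in E by ring.
    replace (0 + h) with h in E by ring. fold h. rewrite E. ring. }
  assert (W' : forall z, thd tau 1 1 z * thd tau 3 0 z - thd tau 1 0 z * thd tau 3 1 z =
    - Ci * (T (2 * tau) (1 / 4) 0 (2 * z + h) * - Ci + T (2 * tau) (3 / 4) 0 (2 * z + h)) *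
    (2 * T (2 * tau) (1 / 4) 1 h)).
  { intros z. rewrite W, E3. simpl.
    replace (- T (2 * tau) (1 / 4) 0 (2 * z + h))
      with (Ci * Ci * T (2 * tau) (1 / 4) 0 (2 * z + h)) by (rewrite Ci_sqr; ring). ring. }
  pose proof (W' 0) as W0. rewrite (thd_zero tau 1 0), (thd_zero tau 3 1) in W0 by auto.
  replace (thd tau 1 1 0 * thd tau 3 0 0) with (thd tau 1 1 0 * thd tau 3 0 0 - 0 * 0) by ring.
  rewrite W0, W', !Q. ring.
Qed.

(** As for [wronskian_13], but both factors carry the shift 1/2; the shifts cancel in y and add up
    to a full period in x, and the common function is the sum of the quarter series at 2x. *)
Lemma wronskian_14 tau x : (0 < Im tau)%R ->
  (thd tau 1 1 x * thd tau 4 0 x - thd tau 1 0 x * thd tau 4 1 x) *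
    (thd tau 2 0 0 * thd tau 3 0 0) =
  thd tau 1 1 0 * thd tau 4 0 0 * (thd tau 2 0 x * thd tau 3 0 x).
Proof.
  intros Ht. pose proof (Im_double_pos tau Ht) as Ht2.
  set (h := 1 / 2 : C).
  assert (E3 : forall j, T (2 * tau) (3 / 4) j 0 = (-1) ^ j * T (2 * tau) (1 / 4) j 0).
  { intros j. rewrite <- Copp_0 at 1. now rewrite T_3quarter_opp. }
  assert (W : forall z, thd tau 1 1 z * thd tau 4 0 z - thd tau 1 0 z * thd tau 4 1 z =
    - (Ci * T (2 * tau) (1 / 4) 0 (2 * z)) * (2 * T (2 * tau) (1 / 4) 1 0) +
    Ci * T (2 * tau) (3 / 4) 0 (2 * z) * (2 * T (2 * tau) (3 / 4) 1 0)).
  { intros z. apply (wronskian_product (thd tau 1 0) (thd tau 4 0)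
      (fun y => T (2 * tau) (1 / 4) 0 (2 * y + 0)) (fun y => T (2 * tau) (3 / 4) 0 (2 * y + 0)));
      try (now apply qderiv_thd); try (now apply qderiv_T_double).
    intros y. unfold thd.
    pose proof (T_product_half_0 tau h h z y Ht) as E.
    replace (h + h) with (RtoC 1) in E by (unfold h; field). replace (h - h) with (RtoC 0) in E by ring.
    rewrite T_quarter_add1, T_3quarter_add1 in E by auto.
    transitivity (- (T tau (1 / 2) 0 (z + y + h) * T tau 0 0 (z - y + h))); [unfold h; ring|].
    rewrite E. ring. }
  assert (Q : forall z, thd tau 2 0 z * thd tau 3 0 z =
    (T (2 * tau) (1 / 4) 0 (2 * z) + T (2 * tau) (3 / 4) 0 (2 * z)) * T (2 * tau) (1 / 4) 0 0).
  { intros z. unfold thd. pose proof (T_product_half_0 tau 0 0 z 0 Ht) as E.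
    replace (0 - 0) with (RtoC 0) in E by ring. replace (z - 0) with z in E by ring.
    rewrite Cmult_0_r, !Cplus_0_r, E3 in E. simpl in E. rewrite E. ring. }
  pose proof (W 0) as W0. rewrite (thd_zero tau 1 0), (thd_zero tau 4 1) in W0 by auto.
  replace (thd tau 1 1 0 * thd tau 4 0 0) with (thd tau 1 1 0 * thd tau 4 0 0 - 0 * 0) by ring.
  rewrite W0, W, !Q, !E3. simpl. ring.
Qed.

Lemma qderiv_thd_mult tau k l i j x : (0 < Im tau)%R ->
  qderiv (fun y => thd tau k i y * thd tau l j y) x
    (thd tau k (S i) x * thd tau l j x + thd tau k i x * thd tau l (S j) x).
Proof. intros Ht. apply qderiv_mult; now apply qderiv_thd. Qed.

Lemma qderiv_thd_sqr tau k x : (0 < Im tau)%R ->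
  qderiv (fun y => thd tau k 0 y ^ 2) x (2 * (thd tau k 0 x * thd tau k 1 x)).
Proof.
  intros Ht. apply (qderiv_ext (fun y => thd tau k 0 y * thd tau k 0 y)); [intros; ring|].
  replace (2 * (thd tau k 0 x * thd tau k 1 x))
    with (thd tau k 1 x * thd tau k 0 x + thd tau k 0 x * thd tau k 1 x) by ring.
  now apply qderiv_thd_mult.
Qed.

Lemma qderiv_thd_add tau k j x y : (0 < Im tau)%R ->
  qderiv (fun y => thd tau k j (x + y)) y (thd tau k (S j) (x + y)).
Proof.
  intros Ht. apply (qderiv_ext (fun y => thd tau k j (1 * y + x))); [intros; f_equal; ring|].
  replace (thd tau k (S j) (x + y)) with (1 * thd tau k (S j) (1 * y + x))
    by (rewrite Cmult_1_l; f_equal; ring).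
  now apply qderiv_affine, qderiv_thd.
Qed.

Lemma qderiv_thd_sub tau k j x y : (0 < Im tau)%R ->
  qderiv (fun y => thd tau k j (x - y)) y (- thd tau k (S j) (x - y)).
Proof.
  intros Ht. apply (qderiv_ext (fun y => thd tau k j ((-1) * y + x))); [intros; f_equal; ring|].
  replace (- thd tau k (S j) (x - y)) with ((-1) * thd tau k (S j) ((-1) * y + x))
    by (replace (-1 * y + x) with (x - y) by ring; ring).
  now apply qderiv_affine, qderiv_thd.
Qed.

Lemma second_derivative_unique (F G F1 G1 : C -> C) (x F2 G2 : C) :
  (forall y, F y = G y) -> (forall y, qderiv F y (F1 y)) -> (forall y, qderiv G y (G1 y)) ->
  qderiv F1 x F2 -> qderiv G1 x G2 -> F2 = G2.
Proof.
  intros E HF HG HF1 HG1. assert (E1 : forall y, F1 y = G1 y).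
  { intros y. apply (qderiv_unique G y); auto. now apply (qderiv_ext F). }
  apply (qderiv_unique G1 x); auto. now apply (qderiv_ext F1).
Qed.

Lemma Cmult_2_inj (a b : C) : 2 * a = 2 * b -> a = b.
Proof. intros H. replace a with (2 * a / 2) by field. rewrite H. field. Qed.

(** Half of the second y-derivative of [theta_addition] at y = 0; theta_1(0) = 0 and theta_2'(0) = 0
    leave one term from each square on the right. *)
Lemma theta1_second_derivative tau x : (0 < Im tau)%R ->
  (thd tau 1 2 x * thd tau 1 0 x - thd tau 1 1 x ^ 2) * thd tau 2 0 0 ^ 2 =
  thd tau 1 0 x ^ 2 * (thd tau 2 0 0 * thd tau 2 2 0) - thd tau 2 0 x ^ 2 * thd tau 1 1 0 ^ 2.
Proof.
  intros Ht. set (c := thd tau 2 0 0 ^ 2).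
  assert (E := second_derivative_unique
    (fun y => c * (thd tau 1 0 (x + y) * thd tau 1 0 (x - y)))
    (fun y => thd tau 1 0 x ^ 2 * thd tau 2 0 y ^ 2 - thd tau 2 0 x ^ 2 * thd tau 1 0 y ^ 2)
    (fun y => c * (thd tau 1 1 (x + y) * thd tau 1 0 (x - y)
       + thd tau 1 0 (x + y) * - thd tau 1 1 (x - y)))
    (fun y => thd tau 1 0 x ^ 2 * (2 * (thd tau 2 0 y * thd tau 2 1 y))
       - thd tau 2 0 x ^ 2 * (2 * (thd tau 1 0 y * thd tau 1 1 y))) 0
    (c * ((thd tau 1 2 (x + 0) * thd tau 1 0 (x - 0) + thd tau 1 1 (x + 0) * - thd tau 1 1 (x - 0))
       + (thd tau 1 1 (x + 0) * - thd tau 1 1 (x - 0) + thd tau 1 0 (x + 0) * (-1 * - thd tau 1 2 (x - 0)))))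
    (thd tau 1 0 x ^ 2 * (2 * (thd tau 2 1 0 * thd tau 2 1 0 + thd tau 2 0 0 * thd tau 2 2 0))
       - thd tau 2 0 x ^ 2 * (2 * (thd tau 1 1 0 * thd tau 1 1 0 + thd tau 1 0 0 * thd tau 1 2 0)))).
  rewrite (thd_zero tau 1 0), (thd_zero tau 2 1) in E by auto.
  replace (x + 0) with x in E by ring. replace (x - 0) with x in E by ring.
  apply Cmult_2_inj. transitivity (c * (thd tau 1 2 x * thd tau 1 0 x + thd tau 1 1 x * - thd tau 1 1 x +
      (thd tau 1 1 x * - thd tau 1 1 x + thd tau 1 0 x * (-1 * - thd tau 1 2 x)))); [ring|].
  rewrite E; [ring| | | | |].
  - intros y. rewrite <- theta_addition by auto. unfold c. ring.
  - intros y. apply qderiv_scal.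
    exact (qderiv_mult _ _ _ _ _ (qderiv_thd_add tau 1 0 x y Ht) (qderiv_thd_sub tau 1 0 x y Ht)).
  - intros y. apply qderiv_minus; apply qderiv_scal; now apply qderiv_thd_sqr.
  - pose proof (fun k j => qderiv_thd_add tau k j x 0 Ht) as Hp.
    pose proof (fun k j => qderiv_thd_sub tau k j x 0 Ht) as Hm.
    replace (x + 0) with x in Hp by ring. replace (x - 0) with x in Hm by ring.
    assert (Hm' : qderiv (fun y => - thd tau 1 1 (x - y)) 0 (-1 * - thd tau 1 2 x)).
    { apply (qderiv_ext (fun y => (-1) * thd tau 1 1 (x - y))); [intros; ring|].
      now apply qderiv_scal. }
    pose proof (qderiv_mult _ _ _ _ _ (Hp 1%Z 1%nat) (Hm 1%Z 0%nat)) as H1.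
    pose proof (qderiv_mult _ _ _ _ _ (Hp 1%Z 0%nat) Hm') as H2.
    cbv beta in H1, H2.
    replace (x + 0) with x in H1, H2 by ring. replace (x - 0) with x in H1, H2 by ring.
    apply qderiv_scal, (qderiv_plus _ _ _ _ _ H1 H2).
  - pose proof (qderiv_thd_mult tau 2 2 0 1 0 Ht) as H1.
    pose proof (qderiv_thd_mult tau 1 1 0 1 0 Ht) as H2.
    rewrite (thd_zero tau 1 0) in H2 by auto. rewrite (thd_zero tau 2 1) in H1 by auto.
    apply qderiv_minus; apply qderiv_scal, qderiv_scal; auto.
Qed.

Lemma qderiv_thd_sqr2 tau k : (0 < Im tau)%R ->
  qderiv (fun y => 2 * (thd tau k 0 y * thd tau k 1 y)) 0
    (2 * (thd tau k 1 0 * thd tau k 1 0 + thd tau k 0 0 * thd tau k 2 0)).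
Proof. intros Ht. now apply qderiv_scal, qderiv_thd_mult. Qed.

(** Half of the second derivative at 0 of a relation between squares: it expresses theta_k''(0)
    through theta_2''(0) and theta_1'(0). *)
Lemma square_second_derivative tau (k : Z) (a b c : C) : (0 < Im tau)%R -> (2 <= k <= 4)%Z ->
  (forall x, a * thd tau 2 0 x ^ 2 - b * thd tau k 0 x ^ 2 = - (c * thd tau 1 0 x ^ 2)) ->
  a * (thd tau 2 0 0 * thd tau 2 2 0) - b * (thd tau k 0 0 * thd tau k 2 0) = - (c * thd tau 1 1 0 ^ 2).
Proof.
  intros Ht Hk H.
  assert (E := second_derivative_unique
    (fun y => a * thd tau 2 0 y ^ 2 - b * thd tau k 0 y ^ 2)
    (fun y => (- c) * thd tau 1 0 y ^ 2)
    (fun y => a * (2 * (thd tau 2 0 y * thd tau 2 1 y)) - b * (2 * (thd tau k 0 y * thd tau k 1 y)))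
    (fun y => (- c) * (2 * (thd tau 1 0 y * thd tau 1 1 y))) 0
    (a * (2 * (thd tau 2 1 0 * thd tau 2 1 0 + thd tau 2 0 0 * thd tau 2 2 0)) -
     b * (2 * (thd tau k 1 0 * thd tau k 1 0 + thd tau k 0 0 * thd tau k 2 0)))
    ((- c) * (2 * (thd tau 1 1 0 * thd tau 1 1 0 + thd tau 1 0 0 * thd tau 1 2 0)))).
  assert (Z : thd tau k 1 0 = 0).
  { apply thd_zero; auto. destruct (Z.eqb_spec k 1); auto; lia. }
  rewrite Z, (thd_zero tau 1 0), (thd_zero tau 2 1) in E by auto.
  apply Cmult_2_inj.
  transitivity (a * (2 * (0 * 0 + thd tau 2 0 0 * thd tau 2 2 0)) -
    b * (2 * (0 * 0 + thd tau k 0 0 * thd tau k 2 0))); [ring|].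
  rewrite E; [ring| | | | |].
  - intros y. rewrite H. ring.
  - intros y. apply qderiv_minus; apply qderiv_scal; now apply qderiv_thd_sqr.
  - intros y. apply qderiv_scal. now apply qderiv_thd_sqr.
  - pose proof (qderiv_thd_sqr2 tau 2 Ht) as H1. pose proof (qderiv_thd_sqr2 tau k Ht) as H2.
    rewrite (thd_zero tau 2 1) in H1 by auto. rewrite Z in H2.
    apply qderiv_minus; apply qderiv_scal; auto.
  - pose proof (qderiv_thd_sqr2 tau 1 Ht) as H1. rewrite (thd_zero tau 1 0) in H1 by auto.
    now apply qderiv_scal.
Qed.

(** The second derivative of [wronskian_12] at 0. Divided out, it says that theta_1'''/theta_1' is
    the sum of theta_k''/theta_k over k = 2, 3, 4, all at 0. *)
Lemma theta1_third_derivative tau : (0 < Im tau)%R ->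
  (thd tau 1 3 0 * thd tau 2 0 0 - thd tau 1 1 0 * thd tau 2 2 0) * (thd tau 3 0 0 * thd tau 4 0 0) =
  thd tau 1 1 0 * thd tau 2 0 0 * (thd tau 3 2 0 * thd tau 4 0 0 + thd tau 3 0 0 * thd tau 4 2 0).
Proof.
  intros Ht. set (c := thd tau 3 0 0 * thd tau 4 0 0). set (d := thd tau 1 1 0 * thd tau 2 0 0).
  assert (Hp : forall k l i j x, qderiv (fun y => thd tau k i y * thd tau l j y) x
    (thd tau k (S i) x * thd tau l j x + thd tau k i x * thd tau l (S j) x))
    by (intros; now apply qderiv_thd_mult).
  assert (E := second_derivative_unique
    (fun y => c * (thd tau 1 1 y * thd tau 2 0 y - thd tau 1 0 y * thd tau 2 1 y))
    (fun y => d * (thd tau 3 0 y * thd tau 4 0 y))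
    (fun y => c * ((thd tau 1 2 y * thd tau 2 0 y + thd tau 1 1 y * thd tau 2 1 y) -
      (thd tau 1 1 y * thd tau 2 1 y + thd tau 1 0 y * thd tau 2 2 y)))
    (fun y => d * (thd tau 3 1 y * thd tau 4 0 y + thd tau 3 0 y * thd tau 4 1 y)) 0
    (c * (((thd tau 1 3 0 * thd tau 2 0 0 + thd tau 1 2 0 * thd tau 2 1 0) +
           (thd tau 1 2 0 * thd tau 2 1 0 + thd tau 1 1 0 * thd tau 2 2 0)) -
          ((thd tau 1 2 0 * thd tau 2 1 0 + thd tau 1 1 0 * thd tau 2 2 0) +
           (thd tau 1 1 0 * thd tau 2 2 0 + thd tau 1 0 0 * thd tau 2 3 0))))
    (d * ((thd tau 3 2 0 * thd tau 4 0 0 + thd tau 3 1 0 * thd tau 4 1 0) +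
          (thd tau 3 1 0 * thd tau 4 1 0 + thd tau 3 0 0 * thd tau 4 2 0)))).
  rewrite (thd_zero tau 1 0), (thd_zero tau 1 2), (thd_zero tau 2 1),
    (thd_zero tau 3 1), (thd_zero tau 4 1) in E by auto.
  replace (d * (thd tau 3 2 0 * thd tau 4 0 0 + thd tau 3 0 0 * thd tau 4 2 0))
    with (d * (thd tau 3 2 0 * thd tau 4 0 0 + 0 * 0 + (0 * 0 + thd tau 3 0 0 * thd tau 4 2 0))) by ring.
  rewrite <- E; [ring| | | | |].
  - intros y. unfold c, d. rewrite <- wronskian_12 by auto. ring.
  - intros y. apply qderiv_scal, qderiv_minus; apply Hp.
  - intros y. apply qderiv_scal, Hp.
  - pose proof (Hp 1%Z 2%Z 2%nat 0%nat 0) as A1. pose proof (Hp 1%Z 2%Z 1%nat 1%nat 0) as A2.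
    pose proof (Hp 1%Z 2%Z 0%nat 2%nat 0) as A3.
    rewrite (thd_zero tau 1 2), (thd_zero tau 2 1) in A1, A2 by auto.
    rewrite (thd_zero tau 1 0) in A3 by auto.
    exact (qderiv_scal c _ _ _ (qderiv_minus _ _ _ _ _ (qderiv_plus _ _ _ _ _ A1 A2)
      (qderiv_plus _ _ _ _ _ A2 A3))).
  - pose proof (Hp 3%Z 4%Z 1%nat 0%nat 0) as A1. pose proof (Hp 3%Z 4%Z 0%nat 1%nat 0) as A2.
    rewrite (thd_zero tau 3 1), (thd_zero tau 4 1) in A1, A2 by auto.
    exact (qderiv_scal d _ _ _ (qderiv_plus _ _ _ _ _ A1 A2)).
Qed.

(* Both nontrivial equations for theta_k' and theta_1'' reduce to the two constants
   theta_1'(0) and theta_1'''(0) / theta_1'(0). *)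
Lemma theta2_second_derivative_at_0 tau e : (0 < Im tau)%R ->
  thd tau 2 0 0 <> 0 -> thd tau 3 0 0 <> 0 -> thd tau 4 0 0 <> 0 ->
  thd tau 1 1 0 = PI * (thd tau 2 0 0 * thd tau 3 0 0 * thd tau 4 0 0) ->
  thd tau 1 3 0 = - 12 * e * thd tau 1 1 0 ->
  thd tau 2 2 0 = thd tau 2 0 0 *
    (- 4 * (e + PI ^ 2 / 12 * (thd tau 3 0 0 ^ 4 + thd tau 4 0 0 ^ 4))).
Proof.
  intros Ht H2 H3 H4 H1 He.
  pose proof (theta1_third_derivative tau Ht) as E.
  pose proof (square_second_derivative tau 3 _ _ _ Ht ltac:(lia) (fun x => theta_square_23 tau x Ht)) as E3.
  pose proof (square_second_derivative tau 4 _ _ _ Ht ltac:(lia) (fun x => theta_square_24 tau x Ht)) as E4.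
  pose proof RtoC_PI_nz as HPI.
  rewrite He, H1 in E. rewrite H1 in E3, E4.
  set (c2 := thd tau 2 0 0) in *. set (c3 := thd tau 3 0 0) in *. set (c4 := thd tau 4 0 0) in *.
  set (A := thd tau 2 2 0) in *. set (B := thd tau 3 2 0) in *. set (D := thd tau 4 2 0) in *.
  (* The square relations are solved for theta_3''(0) and theta_4''(0), which turns [E] into a
     linear equation for A = theta_2''(0). *)
  assert (EB : B = (c3 ^ 2 * (c2 * A) + c4 ^ 2 * (PI * (c2 * c3 * c4)) ^ 2) / (c2 ^ 2 * c3)).
  { replace (c3 ^ 2 * (c2 * A)) with (c2 ^ 2 * (c3 * B) + (c3 ^ 2 * (c2 * A) - c2 ^ 2 * (c3 * B))) by ring.
    rewrite E3. field. auto. }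
  assert (ED : D = (c4 ^ 2 * (c2 * A) + c3 ^ 2 * (PI * (c2 * c3 * c4)) ^ 2) / (c2 ^ 2 * c4)).
  { replace (c4 ^ 2 * (c2 * A)) with (c2 ^ 2 * (c4 * D) + (c4 ^ 2 * (c2 * A) - c2 ^ 2 * (c4 * D))) by ring.
    rewrite E4. field. auto. }
  rewrite EB, ED in E.
  set (L := (- 12 * e * (PI * (c2 * c3 * c4)) * c2 - PI * (c2 * c3 * c4) * A) * (c3 * c4)) in E.
  (* A equals the claimed value minus a multiple of the difference of the sides of [E]. The
     multiplier is, up to sign, the inverse of the coefficient of A there, to which theta_2'',
     theta_3'' and theta_4'' contribute equally; hence the 3. *)
  assert (F : A = c2 * (- 4 * (e + PI ^ 2 / 12 * (c3 ^ 4 + c4 ^ 4))) -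
    (L - PI * (c2 * c3 * c4) * c2 * ((c3 ^ 2 * (c2 * A) + c4 ^ 2 * (PI * (c2 * c3 * c4)) ^ 2) / (c2 ^ 2 * c3) * c4 +
     c3 * ((c4 ^ 2 * (c2 * A) + c3 ^ 2 * (PI * (c2 * c3 * c4)) ^ 2) / (c2 ^ 2 * c4)))) *
     (1 / (3 * PI * c2 * c3 ^ 2 * c4 ^ 2))).
  { unfold L. field. auto. }
  rewrite E in F. rewrite F at 1. ring.
Qed.

(** * The triple product, as a limit of finite products *)

(** The power q^(s/2) of q = exp(2 pi i tau), with the branch fixed by tau, so that real exponents
    simply add. *)
Definition qe (tau : C) (s : R) : C := Cexp (PI * Ci * tau * s).

Lemma qe_plus tau s t : qe tau (s + t) = qe tau s * qe tau t.
Proof. unfold qe. rewrite <- Cexp_plus, RtoC_plus. f_equal. ring. Qed.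

Lemma qe_0 tau : qe tau 0 = 1.
Proof. unfold qe. rewrite Cmult_0_r. apply Cexp_0. Qed.

Lemma Cmod_qe tau s : Cmod (qe tau s) = exp (- (PI * Im tau) * s).
Proof. unfold qe. rewrite Cmod_Cexp. f_equal. destruct tau; simpl. ring. Qed.

Lemma Cmod_qe_lt_1 tau s : (0 < Im tau)%R -> (0 < s)%R -> (Cmod (qe tau s) < 1)%R.
Proof.
  intros Ht Hs. rewrite Cmod_qe, <- exp_0. apply exp_increasing.
  assert (0 < PI * Im tau * s)%R 
    by (apply Rmult_lt_0_compat; auto; apply Rmult_lt_0_compat; auto; apply PI_RGT_0). lra.
Qed.

Lemma one_plus_neq_0 (z : C) : (Cmod z < 1)%R -> 1 + z <> 0.
Proof.
  intros H E. assert (Ez : z = -1) by (transitivity (1 + z - 1); [ring|rewrite E; ring]).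
  rewrite Ez, Cmod_R in H. unfold Rabs in H. destruct (Rcase_abs (-1)); lra.
Qed.

Lemma one_minus_neq_0 (z : C) : (Cmod z < 1)%R -> 1 - z <> 0.
Proof. intros H. apply one_plus_neq_0. now rewrite Cmod_opp. Qed.

Fixpoint cprod (f : nat -> C) (n : nat) : C :=
  match n with O => 1 | S n => cprod f n * f n end.

Lemma cprod_ext f g n : (forall i, f i = g i) -> cprod f n = cprod g n.
Proof. intros H. induction n as [|n IH]; simpl; [easy|now rewrite IH, H]. Qed.

Lemma cprod_mult f g n : cprod (fun i => f i * g i) n = cprod f n * cprod g n.
Proof. induction n as [|n IH]; simpl; [ring|rewrite IH; ring]. Qed.

Lemma cprod_add f m n : cprod f (m + n) = cprod f m * cprod (fun i => f (m + i)%nat) n.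
Proof.
  induction n as [|n IH]; [rewrite Nat.add_0_r; simpl; ring|].
  rewrite Nat.add_succ_r. simpl. rewrite IH. ring.
Qed.

(** Weierstrass' inequality: the modulus of the product is at least 1 minus the sum of the |z_j|,
    here the partial geometric sum, which is what the induction carries. *)
Lemma cprod_tail_lower (z : nat -> C) (D r : R) n :
  (0 <= r < 1)%R -> (0 <= D)%R -> (D / (1 - r) <= 1 / 2)%R ->
  (forall j, (Cmod (z j) <= D * r ^ j)%R) ->
  (1 / 2 <= Cmod (cprod (fun j => 1 + z j)%C n))%R.
Proof.
  intros Hr HD Hs Hz.
  assert (Hrn : forall n, (0 <= r ^ n <= 1)%R).
  { intros i. split; [apply pow_le; lra|]. rewrite <- (pow1 i). apply pow_incr. lra. }
  assert (H1r : (0 < / (1 - r))%R) by (apply Rinv_0_lt_compat; lra).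
  apply Rle_trans with (1 - D * (1 - r ^ n) / (1 - r))%R.
  { specialize (Hrn n). unfold Rdiv in *. assert (D * (1 - r ^ n) <= D)%R by nra. nra. }
  induction n as [|n IH]; simpl; [rewrite Cmod_1; unfold Rdiv; lra|].
  rewrite Cmod_mult.
  assert (H1 : (1 - D * r ^ n <= Cmod (1 + z n))%R).
  { pose proof (Cmod_triangle (1 + z n) (- z n)) as HT. rewrite Cmod_opp in HT.
    replace (1 + z n + - z n) with (RtoC 1) in HT by ring. rewrite Cmod_1 in HT.
    specialize (Hz n). lra. }
  set (S := (D * (1 - r ^ n) / (1 - r))%R) in *.
  replace (D * (1 - r * r ^ n) / (1 - r))%R with (S + D * r ^ n)%R by (unfold S; field; lra).
  assert (HS : (0 <= S <= 1 / 2)%R).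
  { specialize (Hrn n). unfold S, Rdiv in *. split.
    - apply Rmult_le_pos; [|lra]. apply Rmult_le_pos; lra.
    - eapply Rle_trans; [|exact Hs]. apply Rmult_le_compat_r; [lra|]. nra. }
  assert (HDr : (0 <= D * r ^ n <= 1)%R).
  { specialize (Hrn n). split; [apply Rmult_le_pos; lra|].
    assert (D <= 1)%R; [|nra]. assert (D * / (1 - r) * (1 - r) = D)%R by (field; lra).
    unfold Rdiv in Hs. nra. }
  apply Rle_trans with ((1 - S) * (1 - D * r ^ n))%R; [nra|].
  apply Rmult_le_compat; lra.
Qed.

(** Finitely many nonzero partial products have a positive minimum, and the remaining factors lose
    at most a half. Being uniform in n, the bound survives passage to the limit and proves that
    theta values do not vanish. *)
Lemma cprod_lower (z : nat -> C) (D r : R) :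
  (0 <= r < 1)%R -> (0 <= D)%R -> (forall j, (Cmod (z j) <= D * r ^ j)%R) ->
  (forall j, 1 + z j <> 0) ->
  exists m, (0 < m)%R /\ forall n, (m <= Cmod (cprod (fun j => 1 + z j)%C n))%R.
Proof.
  intros Hr HD Hz Hnz.
  (* From J on, the geometric tail D r^J / (1 - r) is at most 1/2; D + 1 replaces D to keep the
     denominator positive when D = 0. *)
  destruct (pow_lt_1_zero r) with (y := ((1 - r) / (2 * (D + 1)))%R) as [J HJ].
  { rewrite Rabs_pos_eq; lra. }
  { apply Rdiv_lt_0_compat; lra. }
  specialize (HJ J (le_n _)). rewrite Rabs_pos_eq in HJ by (apply pow_le; lra).
  assert (HDJ : (D * r ^ J / (1 - r) <= 1 / 2)%R).
  { apply (Rmult_lt_compat_l (2 * (D + 1))) in HJ; [|lra].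
    replace (2 * (D + 1) * ((1 - r) / (2 * (D + 1))))%R with (1 - r)%R in HJ by (field; lra).
    apply (Rmult_le_reg_r (1 - r)); [lra|].
    replace (D * r ^ J / (1 - r) * (1 - r))%R with (D * r ^ J)%R by (field; lra).
    assert (0 <= r ^ J)%R by (apply pow_le; lra). nra. }
  assert (Hpos : forall n, cprod (fun j => 1 + z j)%C n <> 0).
  { induction n as [|n IH]; simpl; [apply C1_nz|]. apply Cmult_neq_0; auto. }
  assert (Hfin : forall K, exists m, (0 < m)%R /\ forall n, (n <= K)%nat ->
    (m <= Cmod (cprod (fun j => 1 + z j)%C n))%R).
  { induction K as [|K [m [Hm IH]]].
    - exists 1%R. split; [lra|]. intros n Hn. replace n with 0%nat by lia. simpl.
      rewrite Cmod_1. lra.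
    - exists (Rmin m (Cmod (cprod (fun j => 1 + z j)%C (S K)))). split.
      + apply Rmin_glb_lt; auto. apply Cmod_gt_0, Hpos.
      + intros n Hn. destruct (Nat.eq_dec n (S K)) as [->|]; [apply Rmin_r|].
        eapply Rle_trans; [apply Rmin_l|]. apply IH. lia. }
  destruct (Hfin J) as [m [Hm H]]. exists (m * (1 / 2))%R. split; [lra|]. intros n.
  destruct (le_lt_dec n J) as [Hn|Hn]; [specialize (H n Hn); lra|].
  replace n with (J + (n - J))%nat by lia. rewrite cprod_add, Cmod_mult.
  apply Rmult_le_compat; [lra|lra|apply H; lia|].
  apply (cprod_tail_lower (fun i => z (J + i)%nat) (D * r ^ J) r); auto.
  - apply Rmult_le_pos; auto. apply pow_le. lra.
  - intros j. rewrite Rmult_assoc, <- pow_add. apply Hz.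
Qed.

Lemma cprod_upper (z : nat -> C) (D r : R) :
  (0 <= r < 1)%R -> (0 <= D)%R -> (forall j, (Cmod (z j) <= D * r ^ j)%R) ->
  forall n, (Cmod (cprod (fun j => 1 + z j)%C n) <= exp (D / (1 - r)))%R.
Proof.
  intros Hr HD Hz n.
  apply Rle_trans with (exp (D * (1 - r ^ n) / (1 - r))).
  - induction n as [|n IH]; simpl.
    + rewrite Cmod_1. replace (D * (1 - 1) / (1 - r))%R with 0%R by (field; lra).
      rewrite exp_0. lra.
    + rewrite Cmod_mult.
      replace (D * (1 - r * r ^ n) / (1 - r))%R
        with (D * (1 - r ^ n) / (1 - r) + D * r ^ n)%R by (field; lra).
      rewrite exp_plus. apply Rmult_le_compat; auto using Cmod_ge_0.
      eapply Rle_trans; [apply Cmod_triangle|]. rewrite Cmod_1.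
      eapply Rle_trans; [|apply exp_ineq1_le]. specialize (Hz n). lra.
  - apply exp_le. unfold Rdiv. apply Rmult_le_compat_r; [left; apply Rinv_0_lt_compat; lra|].
    assert (0 <= r ^ n)%R by (apply pow_le; lra). nra.
Qed.

Lemma Cmod_qe_geom tau s j : Cmod (qe tau (2 * INR j + s)) = (Cmod (qe tau s) * Cmod (qe tau 2) ^ j)%R.
Proof.
  induction j as [|j IH].
  - simpl. rewrite Rmult_0_r, Rplus_0_l, Rmult_1_r. easy.
  - replace (2 * INR (S j) + s)%R with (2 + (2 * INR j + s))%R by (rewrite S_INR; ring).
    rewrite qe_plus, Cmod_mult, IH. simpl. ring.
Qed.

(* Euler's product prod_(j = 1)^n (1 - q^j), with q = exp(2 pi i tau). *)
Definition eulerP (tau : C) (n : nat) : C := cprod (fun j => 1 + - qe tau (2 * INR j + 2)) n.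

Lemma eulerP_S tau n : eulerP tau (S n) = eulerP tau n * (1 - qe tau (2 * INR n + 2)).
Proof. easy. Qed.

Lemma eulerP_bounds tau : (0 < Im tau)%R -> exists m M, (0 < m)%R /\
  forall n, (m <= Cmod (eulerP tau n) <= M)%R.
Proof.
  intros Ht. set (r := Cmod (qe tau 2)).
  assert (Hr : (0 <= r < 1)%R) by (split; [apply Cmod_ge_0|apply Cmod_qe_lt_1; auto; lra]).
  assert (Hz : forall j, (Cmod (- qe tau (2 * INR j + 2)) <= r * r ^ j)%R).
  { intros j. rewrite Cmod_opp, Cmod_qe_geom. unfold r. lra. }
  destruct (cprod_lower (fun j => - qe tau (2 * INR j + 2)) r r Hr (proj1 Hr) Hz) as [m [Hm H]].
  { intros j. apply one_minus_neq_0, Cmod_qe_lt_1; auto. pose proof (pos_INR j). lra. }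
  exists m, (exp (r / (1 - r))). split; auto. intros n. split; [apply H|].
  apply (cprod_upper (fun j => - qe tau (2 * INR j + 2))); auto. apply Hr.
Qed.

Lemma eulerP_nz tau n : (0 < Im tau)%R -> eulerP tau n <> 0.
Proof.
  intros Ht. destruct (eulerP_bounds tau Ht) as [m [M [Hm H]]].
  apply Cmod_gt_0. specialize (H n). lra.
Qed.

(* The value 0 on negative integers makes [rP_step] hold on all of Z and encodes the
   finite support of the Gaussian binomials below. *)
Definition rP (tau : C) (n : Z) : C :=
  match n with Z.neg _ => 0 | _ => / eulerP tau (Z.to_nat n) end.

Lemma rP_nat tau n : rP tau (Z.of_nat n) = / eulerP tau n.
Proof.
  transitivity (/ eulerP tau (Z.to_nat (Z.of_nat n))); [now destruct n|now rewrite Nat2Z.id].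
Qed.

Lemma rP_neg tau n : (n < 0)%Z -> rP tau n = 0.
Proof. destruct n; simpl; try lia; easy. Qed.

Lemma rP_step tau n : (0 < Im tau)%R -> (1 - qe tau (2 * IZR n)) * rP tau n = rP tau (n - 1).
Proof.
  intros Ht. destruct (Z_lt_le_dec n 0) as [Hn|Hn].
  - rewrite !rP_neg by lia. ring.
  - destruct (Z.eq_dec n 0) as [->|Hn0].
    + rewrite Rmult_0_r, qe_0. simpl. ring.
    + replace n with (Z.of_nat (S (Z.to_nat (n - 1)))) by lia. set (m := Z.to_nat (n - 1)).
      replace (Z.of_nat (S m) - 1)%Z with (Z.of_nat m) by lia. rewrite !rP_nat, eulerP_S.
      rewrite <- INR_IZR_INZ, S_INR. replace (2 * (INR m + 1))%R with (2 * INR m + 2)%R by ring.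
      field. split; [apply eulerP_nz; auto|].
      apply one_minus_neq_0, Cmod_qe_lt_1; auto. pose proof (pos_INR m). lra.
Qed.

(** The Gaussian binomial of 2N + d over N - k in base q, times q^((k + d/2)^2 / 2). The value d = 0
    belongs to theta_3 and theta_4, d = 1 to theta_1 and theta_2. *)
Definition gcoef (tau : C) (d N : nat) (k : Z) : C :=
  eulerP tau (2 * N + d) * (rP tau (Z.of_nat (N + d) + k) * rP tau (Z.of_nat N - k)) *
  tcoef tau (INR d / 2) k.

Lemma tcoef_qe tau a k : tcoef tau a k = qe tau ((IZR k + a) ^ 2).
Proof. unfold tcoef, qe. now rewrite RtoC_pow. Qed.

(** The f in the N-th pair of factors (1 + f w)(1 + f / w) of the triple product. *)
Definition qfactor (tau : C) (d N : nat) : C := qe tau (2 * INR N + (1 + INR d)).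

(** The coefficient form of multiplication by (1 + f w)(1 + f / w) = 1 + f^2 + f (w + 1/w), that is,
    two q-Pascal steps at once. It is valid for all k in Z because [rP] vanishes on negative
    integers. *)
Lemma gcoef_S tau d N k : (0 < Im tau)%R ->
  gcoef tau d (S N) k = (1 + qfactor tau d N ^ 2) * gcoef tau d N k +
    qfactor tau d N * (gcoef tau d N (k - 1) + gcoef tau d N (k + 1)).
Proof.
  intros Ht. unfold gcoef.
  set (i := (Z.of_nat (N + d) + k)%Z). set (j := (Z.of_nat N - k)%Z).
  replace (Z.of_nat (S N + d) + k)%Z with (i + 1)%Z by (unfold i; lia).
  replace (Z.of_nat (S N) - k)%Z with (j + 1)%Z by (unfold j; lia).
  replace (Z.of_nat (N + d) + (k - 1))%Z with (i + 1 - 1 - 1)%Z by (unfold i; lia).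
  replace (Z.of_nat N - (k - 1))%Z with (j + 1)%Z by (unfold j; lia).
  replace (Z.of_nat (N + d) + (k + 1))%Z with (i + 1)%Z by (unfold i; lia).
  replace (Z.of_nat N - (k + 1))%Z with (j + 1 - 1 - 1)%Z by (unfold j; lia).
  replace i with (i + 1 - 1)%Z at 2 by lia. replace j with (j + 1 - 1)%Z at 2 by lia.
  rewrite <- !rP_step by auto.
  replace (2 * S N + d)%nat with (S (S (2 * N + d))) by lia. rewrite !eulerP_S.
  replace (2 * IZR (i + 1 - 1))%R with (2 * IZR i)%R by (f_equal; f_equal; lia).
  replace (2 * IZR (j + 1 - 1))%R with (2 * IZR j)%R by (f_equal; f_equal; lia).
  replace (2 * IZR (i + 1))%R with (2 * IZR i + 2)%R by (rewrite plus_IZR; ring).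
  replace (2 * IZR (j + 1))%R with (2 * IZR j + 2)%R by (rewrite plus_IZR; ring).
  set (X := qe tau (2 * IZR i)). set (Y := qe tau (2 * IZR j)). set (q := qe tau 2).
  assert (Ei : IZR i = (INR N + INR d + IZR k)%R).
  { unfold i. now rewrite plus_IZR, <- INR_IZR_INZ, plus_INR. }
  assert (Ej : IZR j = (INR N - IZR k)%R).
  { unfold j. now rewrite minus_IZR, <- INR_IZR_INZ. }
  assert (E1 : qe tau (2 * INR (2 * N + d) + 2) = X * Y * q).
  { unfold X, Y, q. rewrite <- !qe_plus. f_equal. rewrite Ei, Ej, plus_INR, mult_INR. simpl. ring. }
  assert (E2 : qe tau (2 * INR (S (2 * N + d)) + 2) = X * Y * q * q).
  { rewrite S_INR. unfold X, Y, q. rewrite <- !qe_plus. f_equal. rewrite Ei, Ej, plus_INR, mult_INR. simpl. ring. }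
  assert (E3 : qfactor tau d N ^ 2 = X * Y * q).
  { unfold qfactor, X, Y, q. simpl. rewrite Cmult_1_r, <- !qe_plus. f_equal. rewrite Ei, Ej. ring. }
  assert (E4 : qfactor tau d N * tcoef tau (INR d / 2) (k - 1) = Y * q * tcoef tau (INR d / 2) k).
  { unfold qfactor, Y, q. rewrite !tcoef_qe, <- !qe_plus. f_equal.
    rewrite Ej, minus_IZR. field. }
  assert (E5 : qfactor tau d N * tcoef tau (INR d / 2) (k + 1) = X * q * tcoef tau (INR d / 2) k).
  { unfold qfactor, X, q. rewrite !tcoef_qe, <- !qe_plus. f_equal.
    rewrite Ei, plus_IZR. field. }
  rewrite E1, E2, E3. rewrite !qe_plus. fold X Y q.
  set (t := tcoef tau (INR d / 2) k) in *. set (t1 := tcoef tau (INR d / 2) (k - 1)) in *.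
  set (t2 := tcoef tau (INR d / 2) (k + 1)) in *. set (f := qfactor tau d N) in *.
  set (P := eulerP tau (2 * N + d)). set (a := rP tau (i + 1)). set (b := rP tau (j + 1)).
  (* By [rP_step] all reciprocals are multiples of a and b. Only the shifted Gaussian factors t1 and
     t2 remain, and f t1 = Y q t, f t2 = X q t leave a polynomial identity in X, Y, q. *)
  transitivity ((1 + X * Y * q) * (P * ((1 - X * q) * a * ((1 - Y * q) * b)) * t) +
    (P * ((1 - X) * ((1 - X * q) * a) * b) * (f * t1) +
     P * (a * ((1 - Y) * ((1 - Y * q) * b))) * (f * t2))); [|ring].
  rewrite E4, E5. ring.
Qed.

Lemma has_sum_support {I : Type} (f : I -> C) (L0 : list I) :
  NoDup L0 -> (forall i, ~ In i L0 -> f i = 0) -> has_sum f (lsum f L0).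
Proof.
  intros HL0 H eps He. exists L0. intros L HL Hi.
  destruct (NoDup_complement L0 L HL0 Hi HL) as [R [HR [_ HRd]]].
  rewrite (lsum_perm f _ _ HR), lsum_app.
  assert (E : lsum f R = 0).
  { clear HR. induction R as [|a R IH]; simpl; [easy|].
    rewrite IH, (H a); [ring|apply HRd; now left|]. intros x Hx. apply HRd. now right. }
  rewrite E. replace (lsum f L0 + 0 - lsum f L0) with (RtoC 0) by ring. now rewrite Cmod_0.
Qed.

Lemma gcoef_out tau d N k : (k < - Z.of_nat (N + d) \/ Z.of_nat N < k)%Z -> gcoef tau d N k = 0.
Proof.
  intros [H|H]; unfold gcoef; [rewrite (rP_neg tau (_ + _)) by lia|rewrite (rP_neg tau (_ - _)) by lia]; ring.
Qed.

Lemma gcoef_sum_exists tau d N (phi : Z -> C) : exists v, has_sum (fun k => gcoef tau d N k * phi k) v.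
Proof.
  exists (lsum (fun k => gcoef tau d N k * phi k) (Zrange (S (N + d)))).
  apply has_sum_support; [apply NoDup_Zrange|]. intros k Hk.
  rewrite gcoef_out; [ring|]. apply NNPP. intros Hn. apply Hk, in_Zrange. lia.
Qed.

(** The recursion transposed onto the test function. Any [phi] for which phi(k + 1) + phi(k - 1) is
    again summable in closed form can be treated: exponentials for the product, polynomials times
    exponentials for derivatives. *)
Lemma gcoef_sum_S tau d N (phi : Z -> C) v v' : (0 < Im tau)%R ->
  has_sum (fun k => gcoef tau d N k * phi k) v ->
  has_sum (fun k => gcoef tau d N k * (phi (k + 1)%Z + phi (k - 1)%Z)) v' ->
  has_sum (fun k => gcoef tau d (S N) k * phi k)
    ((1 + qfactor tau d N ^ 2) * v + qfactor tau d N * v').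
Proof.
  intros Ht Hv Hv'.
  destruct (gcoef_sum_exists tau d N (fun k => phi (k + 1)%Z)) as [v1 H1].
  destruct (gcoef_sum_exists tau d N (fun k => phi (k - 1)%Z)) as [v2 H2].
  assert (E : v' = v1 + v2).
  { apply (has_sum_unique _ _ _ Hv'). apply (has_sum_ext _ _ _ (fun k => eq_sym (Cmult_plus_distr_l _ _ _))).
    now apply has_sum_plus. }
  subst v'.
  apply (has_sum_bij (fun k => k - 1)%Z (fun k => k + 1)%Z) in H1; [|intros; lia|intros; lia].
  apply (has_sum_bij (fun k => k + 1)%Z (fun k => k - 1)%Z) in H2; [|intros; lia|intros; lia].
  apply (has_sum_ext (fun k => (1 + qfactor tau d N ^ 2) * (gcoef tau d N k * phi k) +
    qfactor tau d N * (gcoef tau d N (k - 1) * phi (k - 1 + 1)%Z + gcoef tau d N (k + 1) * phi (k + 1 - 1)%Z))).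
  - intros k. rewrite gcoef_S by auto. replace (k - 1 + 1)%Z with k by lia.
    replace (k + 1 - 1)%Z with k by lia. ring.
  - apply has_sum_plus; apply has_sum_scal; auto. now apply has_sum_plus.
Qed.

(** Chosen so that the normalized binomial is a product of two ratios of Euler products, each
    tending to 1; the limiting coefficient is then exactly that of the theta series. *)
Definition gnorm (tau : C) (d N : nat) : C := eulerP tau (N + d) * eulerP tau N / eulerP tau (2 * N + d).

Lemma Clim_qe_0 tau s : (0 < Im tau)%R -> Clim (fun N => qe tau (2 * INR N + s)) 0.
Proof.
  intros Ht eps He. pose proof (Cmod_ge_0 (qe tau s)) as Hs.
  destruct (pow_lt_1_zero (Cmod (qe tau 2))) with (y := (eps / (Cmod (qe tau s) + 1))%R) as [N HN].
  { rewrite Rabs_pos_eq by apply Cmod_ge_0. apply Cmod_qe_lt_1; auto; lra. }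
  { apply Rdiv_lt_0_compat; lra. }
  exists N. intros n Hn. specialize (HN n Hn). rewrite Rabs_pos_eq in HN by (apply pow_le, Cmod_ge_0).
  replace (qe tau (2 * INR n + s) - 0) with (qe tau (2 * INR n + s)) by ring.
  rewrite Cmod_qe_geom. apply (Rmult_lt_compat_l (Cmod (qe tau s) + 1)) in HN; [|lra].
  replace ((Cmod (qe tau s) + 1) * (eps / (Cmod (qe tau s) + 1)))%R with eps in HN by (field; lra).
  assert (0 <= Cmod (qe tau 2) ^ n)%R by (apply pow_le, Cmod_ge_0). lra.
Qed.

Lemma Clim_shift u l d : Clim u l -> Clim (fun n => u (n + d)%nat) l.
Proof. intros H eps He. destruct (H eps He) as [N HN]. exists N. intros n Hn. apply HN. lia. Qed.

Lemma Clim_one_minus_qe tau s u : (0 < Im tau)%R -> Clim u 1 ->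
  Clim (fun N => (1 - qe tau (2 * INR N + s)) * u N) 1.
Proof.
  intros Ht Hu. assert (H : Clim (fun N => 1 - qe tau (2 * INR N + s)) (1 + (-1) * 0)).
  { apply (Clim_ext (fun N => 1 + (-1) * qe tau (2 * INR N + s))); [intros; ring|].
    apply Clim_plus; [apply Clim_const|]. now apply Clim_scal, Clim_qe_0. }
  pose proof (Clim_mult _ _ _ _ H Hu) as H'.
  replace ((1 + (-1) * 0) * 1) with (RtoC 1) in H' by ring. exact H'.
Qed.

Lemma rP_ratio_lim tau k : (0 < Im tau)%R ->
  Clim (fun N => eulerP tau N * rP tau (Z.of_nat N + k)) 1.
Proof.
  intros Ht. assert (Hup : forall i : nat, Clim (fun N => eulerP tau N * rP tau (Z.of_nat N + Z.of_nat i)) 1).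
  { intros i. replace (RtoC 1) with (/ 1) by field.
    apply (Clim_ext (fun N => / (eulerP tau (N + i) / eulerP tau N))).
    { intros N. rewrite <- Nat2Z.inj_add, rP_nat. field. split; apply eulerP_nz; auto. }
    apply Clim_inv; [apply C1_nz|]. induction i as [|i IH].
    - apply (Clim_ext (fun _ => 1)); [|apply Clim_const].
      intros N. rewrite Nat.add_0_r. field. now apply eulerP_nz.
    - apply (Clim_ext (fun N => (1 - qe tau (2 * INR N + (2 * INR i + 2))) *
        (eulerP tau (N + i) / eulerP tau N))); [|now apply Clim_one_minus_qe].
      intros N. rewrite Nat.add_succ_r, eulerP_S, plus_INR.
      replace (2 * (INR N + INR i) + 2)%R with (2 * INR N + (2 * INR i + 2))%R by ring.
      field. now apply eulerP_nz. }
  destruct (Z_le_gt_dec 0 k) as [Hk|Hk].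
  - replace k with (Z.of_nat (Z.to_nat k)) by lia. apply Hup.
  - replace k with (- Z.of_nat (Z.to_nat (- k)))%Z by lia. set (i := Z.to_nat (- k)). clearbody i.
    induction i as [|i IH]; [apply (Hup 0%nat)|].
    apply (Clim_ext (fun N => (1 - qe tau (2 * INR N + - (2 * INR i))) *
      (eulerP tau N * rP tau (Z.of_nat N + - Z.of_nat i)))); [|now apply Clim_one_minus_qe].
    intros N. replace (Z.of_nat N + - Z.of_nat (S i))%Z with (Z.of_nat N + - Z.of_nat i - 1)%Z by lia.
    rewrite <- rP_step, plus_IZR, opp_IZR, <- !INR_IZR_INZ by auto.
    replace (2 * (INR N + - INR i))%R with (2 * INR N + - (2 * INR i))%R by ring. ring.
Qed.

Lemma gcoef_normalized tau d N k : (0 < Im tau)%R ->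
  gnorm tau d N * gcoef tau d N k =
  (eulerP tau (N + d) * rP tau (Z.of_nat (N + d) + k)) *
  (eulerP tau N * rP tau (Z.of_nat N + - k)) * tcoef tau (INR d / 2) k.
Proof. intros Ht. unfold gnorm, gcoef, Z.sub. field. now apply eulerP_nz. Qed.

(** Dominated convergence with the normalized binomials bounded by (M/m)^2, M and m being bounds of
    the Euler products. The power [j] of the frequency covers derivatives of the theta series as
    well. *)
Lemma T_triple_product_lim tau d j x (v : nat -> C) : (0 < Im tau)%R ->
  (forall N, has_sum (fun k => gcoef tau d N k *
     (tfreq (INR d / 2) k ^ j * Cexp (tfreq (INR d / 2) k * x))) (v N)) ->
  Clim (fun N => gnorm tau d N * v N) (T tau (INR d / 2) j x).
Proof.
  intros Ht Hv. destruct (eulerP_bounds tau Ht) as [m [M [Hm HM]]].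
  assert (HM0 : (0 < M)%R) by (specialize (HM 0%nat); lra).
  assert (HrP : forall n, (Cmod (rP tau n) <= / m)%R).
  { intros n. destruct (Z_lt_le_dec n 0).
    - rewrite rP_neg, Cmod_0 by auto. left. now apply Rinv_0_lt_compat.
    - replace n with (Z.of_nat (Z.to_nat n)) by lia. rewrite rP_nat, Cmod_inv by now apply eulerP_nz.
      apply Rinv_le_contravar; auto. apply HM. }
  assert (Hu : forall N n, (Cmod (eulerP tau N * rP tau n) <= M * / m)%R).
  { intros N n. rewrite Cmod_mult. apply Rmult_le_compat; auto using Cmod_ge_0. apply HM. }
  destruct (tterm_bound tau (INR d / 2) j (Cmod x) Ht) as [K [HK HKb]].
  set (w := fun k => tfreq (INR d / 2) k ^ j * Cexp (tfreq (INR d / 2) k * x)) in *.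
  apply (tannery (fun N k => gnorm tau d N * (gcoef tau d N k * w k))
    (tterm tau (INR d / 2) j x) (fun k => ((M * / m) * (M * / m)) * (K * zweight k))%R
    (((M * / m) * (M * / m)) * (K * 6)) _ _ 0).
  - intros k. unfold tterm.
    apply (Clim_ext (fun N => ((eulerP tau (N + d) * rP tau (Z.of_nat (N + d) + k)) *
      (eulerP tau N * rP tau (Z.of_nat N + - k))) * (tcoef tau (INR d / 2) k * w k))).
    { intros N. rewrite !Cmult_assoc, gcoef_normalized by auto. ring. }
    replace (tfreq (INR d / 2) k ^ j * (tcoef tau (INR d / 2) k * Cexp (tfreq (INR d / 2) k * x)))
      with ((1 * 1) * (tcoef tau (INR d / 2) k * w k)) by (unfold w; ring).
    apply Clim_mult; [|apply Clim_const]. apply Clim_mult.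
    + apply (Clim_shift (fun N => eulerP tau N * rP tau (Z.of_nat N + k))). now apply rP_ratio_lim.
    + now apply rP_ratio_lim.
  - intros N k _. rewrite Cmult_assoc, gcoef_normalized by auto.
    rewrite <- Cmult_assoc, Cmod_mult. apply Rmult_le_compat; auto using Cmod_ge_0.
    + rewrite Cmod_mult. apply Rmult_le_compat; auto using Cmod_ge_0.
    + eapply Rle_trans; [|apply (HKb x k (Rle_refl _))]. unfold tterm, w. apply Req_le. f_equal. ring.
  - apply sums_bounded_scal; [apply Rle_0_sqr|].
    apply sums_bounded_scal; [lra|apply zweight_bounded].
  - intros N. apply has_sum_scal, Hv.
  - now apply T_has_sum.
Qed.

Lemma gcoef_sum_0_0 tau (phi : Z -> C) : has_sum (fun k => gcoef tau 0 0 k * phi k) (phi 0%Z).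
Proof.
  assert (E : phi 0%Z = lsum (fun k => gcoef tau 0 0 k * phi k) (0%Z :: nil)).
  { simpl. unfold gcoef. simpl. rewrite tcoef_qe.
    replace ((0 + 0 / 2) ^ 2)%R with 0%R by field. rewrite qe_0. unfold eulerP; simpl. field. }
  rewrite E. apply has_sum_support; [repeat constructor; easy|].
  intros k Hk. rewrite gcoef_out; [ring|]. simpl in *. lia.
Qed.

(** At the start N = 0 with d = 1 the support is k = 0 and k = -1, where k + 1/2 is 1/2 or -1/2;
    both squares give the exponent 1/4. *)
Lemma gcoef_sum_1_0 tau (phi : Z -> C) : (0 < Im tau)%R ->
  has_sum (fun k => gcoef tau 1 0 k * phi k) (qe tau (1 / 4) * (phi 0%Z + phi (-1)%Z)).
Proof.
  intros Ht. pose proof (eulerP_nz tau 1 Ht) as H1.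
  assert (E : qe tau (1 / 4) * (phi 0%Z + phi (-1)%Z) =
    lsum (fun k => gcoef tau 1 0 k * phi k) (0%Z :: (-1)%Z :: nil)).
  { assert (E0 : gcoef tau 1 0 0 = qe tau (1 / 4)).
    { unfold gcoef. rewrite tcoef_qe.
      change (Z.of_nat (0 + 1) + 0)%Z with (Z.of_nat 1). change (Z.of_nat 0 - 0)%Z with (Z.of_nat 0).
      change (2 * 0 + 1)%nat with 1%nat. rewrite !rP_nat. simpl (INR 1).
      replace ((0 + 1 / 2) ^ 2)%R with (1 / 4)%R by field. change (eulerP tau 0) with (RtoC 1).
      field. auto. }
    assert (E1 : gcoef tau 1 0 (-1) = qe tau (1 / 4)).
    { unfold gcoef. rewrite tcoef_qe.
      change (Z.of_nat (0 + 1) + -1)%Z with (Z.of_nat 0). change (Z.of_nat 0 - -1)%Z with (Z.of_nat 1).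
      change (2 * 0 + 1)%nat with 1%nat. rewrite !rP_nat. simpl (INR 1).
      replace ((-1 + 1 / 2) ^ 2)%R with (1 / 4)%R by field. change (eulerP tau 0) with (RtoC 1).
      field. auto. }
    simpl. rewrite E0, E1. ring. }
  rewrite E. apply has_sum_support.
  - repeat constructor; simpl; intuition discriminate.
  - intros k Hk. rewrite gcoef_out; [ring|]. simpl in *. lia.
Qed.

(** The finite triple product: on the exponential with w = exp(2 pi i x) the two shifts act as
    multiplication by w and 1/w, so each step of the recursion multiplies the sum by one pair of
    factors. *)
Lemma gcoef_sum_exp tau d x G : (0 < Im tau)%R ->
  has_sum (fun k => gcoef tau d 0 k * Cexp (tfreq (INR d / 2) k * x)) G ->
  forall N, has_sum (fun k => gcoef tau d N k * Cexp (tfreq (INR d / 2) k * x))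
    (G * cprod (fun j => (1 + qfactor tau d j * Cexp (2 * PI * Ci * x)) *
                         (1 + qfactor tau d j * / Cexp (2 * PI * Ci * x))) N).
Proof.
  intros Ht H0 N. set (w := Cexp (2 * PI * Ci * x)). assert (Hw : w <> 0) by apply Cexp_nz.
  induction N as [|N IH]; simpl.
  - now replace (G * 1) with G by ring.
  - match type of IH with has_sum _ ?v => set (v0 := v) in * end.
    replace (G * (cprod _ N * _)) with
      ((1 + qfactor tau d N ^ 2) * v0 + qfactor tau d N * ((w + / w) * v0)) by (unfold v0; field; auto).
    apply gcoef_sum_S; auto.
    apply (has_sum_ext (fun k => (w + / w) * (gcoef tau d N k * Cexp (tfreq (INR d / 2) k * x))));
      [|now apply has_sum_scal].
    intros k.
    replace (tfreq (INR d / 2) (k + 1) * x) with (2 * PI * Ci * x + tfreq (INR d / 2) k * x)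
      by (unfold tfreq; rewrite plus_IZR, !RtoC_plus; ring).
    replace (tfreq (INR d / 2) (k - 1) * x) with (- (2 * PI * Ci * x) + tfreq (INR d / 2) k * x)
      by (unfold tfreq; rewrite minus_IZR, !RtoC_plus, RtoC_minus; ring).
    rewrite !Cexp_plus, Cexp_opp. fold w. ring.
Qed.

Lemma T_triple_product tau d x G : (0 < Im tau)%R ->
  has_sum (fun k => gcoef tau d 0 k * Cexp (tfreq (INR d / 2) k * x)) G ->
  Clim (fun N => gnorm tau d N *
    (G * cprod (fun j => (1 + qfactor tau d j * Cexp (2 * PI * Ci * x)) *
                         (1 + qfactor tau d j * / Cexp (2 * PI * Ci * x))) N))
    (T tau (INR d / 2) 0 x).
Proof.
  intros Ht HG.
  apply (T_triple_product_lim tau d 0 x (fun N => G *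
    cprod (fun j => (1 + qfactor tau d j * Cexp (2 * PI * Ci * x)) *
                    (1 + qfactor tau d j * / Cexp (2 * PI * Ci * x))) N)); auto.
  intros N. apply (has_sum_ext _ _ _ (fun k => f_equal (Cmult (gcoef tau d N k)) (eq_sym (Cmult_1_l _)))).
  now apply gcoef_sum_exp.
Qed.

Lemma gnorm_lower tau d : (0 < Im tau)%R -> exists m, (0 < m)%R /\ forall N, (m <= Cmod (gnorm tau d N))%R.
Proof.
  intros Ht. destruct (eulerP_bounds tau Ht) as [m [M [Hm HM]]].
  assert (HM0 : (0 < M)%R) by (specialize (HM 0%nat); lra).
  exists (m * m * / M)%R. split.
  - apply Rmult_lt_0_compat; [nra|now apply Rinv_0_lt_compat].
  - intros N. unfold gnorm, Cdiv. rewrite !Cmod_mult, Cmod_inv by now apply eulerP_nz.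
    apply Rmult_le_compat; [nra|left; now apply Rinv_0_lt_compat| |].
    + apply Rmult_le_compat; try lra; apply HM.
    + apply Rinv_le_contravar; [|apply HM]. apply Cmod_gt_0. now apply eulerP_nz.
Qed.

Lemma Cmod_qfactor tau d j : Cmod (qfactor tau d j) = (Cmod (qe tau (1 + INR d)) * Cmod (qe tau 2) ^ j)%R.
Proof. apply Cmod_qe_geom. Qed.

(** All factors of the approximating products have moduli bounded below uniformly in N, hence so has
    their limit. *)
Lemma T_nz tau d x G : (0 < Im tau)%R ->
  has_sum (fun k => gcoef tau d 0 k * Cexp (tfreq (INR d / 2) k * x)) G -> G <> 0 ->
  (forall j, 1 + qfactor tau d j * Cexp (2 * PI * Ci * x) <> 0) ->
  (forall j, 1 + qfactor tau d j * / Cexp (2 * PI * Ci * x) <> 0) ->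
  T tau (INR d / 2) 0 x <> 0.
Proof.
  intros Ht HG HG0 H1 H2. set (w := Cexp (2 * PI * Ci * x)) in *.
  assert (Hr : (0 <= Cmod (qe tau 2) < 1)%R) by (split; [apply Cmod_ge_0|apply Cmod_qe_lt_1; auto; lra]).
  assert (Hlow : forall z : C, (forall j, 1 + qfactor tau d j * z <> 0) ->
    exists m, (0 < m)%R /\ forall n, (m <= Cmod (cprod (fun j => 1 + qfactor tau d j * z)%C n))%R).
  { intros z Hz. apply (cprod_lower (fun j => qfactor tau d j * z)
      (Cmod (qe tau (1 + INR d)) * Cmod z) (Cmod (qe tau 2))); auto.
    - apply Rmult_le_pos; apply Cmod_ge_0.
    - intros j. rewrite Cmod_mult, Cmod_qfactor. lra. }
  destruct (Hlow w H1) as [m1 [Hm1 L1]]. destruct (Hlow (/ w) H2) as [m2 [Hm2 L2]].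
  destruct (gnorm_lower tau d Ht) as [m3 [Hm3 L3]].
  apply Cmod_gt_0 in HG0. apply Cmod_gt_0.
  apply Rlt_le_trans with (m3 * (Cmod G * (m1 * m2)))%R.
  { repeat apply Rmult_lt_0_compat; auto. }
  apply (Clim_lower _ _ _ (T_triple_product tau d x G Ht HG)).
  intros N. rewrite cprod_mult, !Cmod_mult. fold w.
  apply Rmult_le_compat; auto; [lra|apply Rmult_le_pos; [lra|apply Rmult_le_pos; lra]|].
  apply Rmult_le_compat_l; [lra|]. apply Rmult_le_compat; auto; lra.
Qed.

(** * Zeros of theta_1 and products for the theta constants *)

Lemma Cexp_eq_1 (z : C) : Cexp z = 1 -> exists k : Z, z = 2 * PI * Ci * ZtoC k.
Proof.
  intros H. assert (Hre : Re z = 0%R).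
  { apply exp_inv. rewrite <- Cmod_Cexp, H, exp_0. apply Cmod_1. }
  destruct z as [a b]. simpl in Hre. subst a. unfold Cexp in H. simpl in H.
  rewrite exp_0 in H. injection H as Hc _.
  assert (Hcos : cos b = 1%R) by lra.
  assert (Hs : sin (b / 2) = 0%R).
  { replace b with (2 * (b / 2))%R in Hcos by field. rewrite cos_2a_sin in Hcos.
    assert (sin (b / 2) * sin (b / 2) = 0)%R by lra. nra. }
  apply sin_eq_0_0 in Hs. destruct Hs as [k Hk]. exists k.
  apply injective_projections; simpl; [ring|]. unfold ZtoC. simpl. lra.
Qed.

Lemma qfactor_1 tau j : qfactor tau 1 j = qe tau (2 * INR j + 2).
Proof. easy. Qed.

Lemma Cmod_qfactor_lt_1 tau d j : (0 < Im tau)%R -> (Cmod (qfactor tau d j) < 1)%R.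
Proof.
  intros Ht. apply Cmod_qe_lt_1; auto. pose proof (pos_INR j). pose proof (pos_INR d). lra.
Qed.

Lemma tfreq_0_0 x : Cexp (tfreq (INR 0 / 2) 0 * x) = 1.
Proof.
  unfold tfreq. simpl. replace (0 + 0 / 2)%R with 0%R by field.
  replace (2 * PI * Ci * 0 * x) with (RtoC 0) by ring. apply Cexp_0.
Qed.

(** A factor of the product vanishes only if q^n exp(2 pi i u) = 1 for some integer n, and this puts
    u into the lattice: positive and negative n come from the two families of factors, n = 0 from
    the initial value. *)
Lemma theta1_nz tau u : (0 < Im tau)%R -> ~ (exists a b : Z, u = ZtoC a * tau + ZtoC b) ->
  thd tau 1 0 u <> 0.
Proof.
  intros Ht Hu.
  assert (Hlat : forall n : Z, Cexp (2 * PI * Ci * (ZtoC n * tau + u)) <> 1).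
  { intros n H. apply Cexp_eq_1 in H. destruct H as [k Hk]. apply Hu. exists (- n)%Z, k.
    pose proof two_PI_i_nz as HPI.
    set (p := 2 * PI * Ci) in *. clearbody p.
    assert (E : ZtoC n * tau + u = ZtoC k).
    { replace (ZtoC n * tau + u) with (p * (ZtoC n * tau + u) / p) by (field; auto).
      rewrite Hk. field. auto. }
    rewrite <- E. unfold ZtoC. rewrite opp_IZR, RtoC_opp. ring. }
  assert (HT : T tau (INR 1 / 2) 0 (u + 1 / 2) <> 0).
  { assert (Ew : Cexp (2 * PI * Ci * (u + 1 / 2)) = - Cexp (2 * PI * Ci * u)).
    { replace (2 * PI * Ci * (u + 1 / 2)) with (PI * Ci + 2 * PI * Ci * u) by field.
      rewrite Cexp_plus, Cexp_PI. ring. }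
    assert (Eq : forall j, qfactor tau 1 j = Cexp (2 * PI * Ci * (ZtoC (Z.of_nat j + 1) * tau))).
    { intros j. rewrite qfactor_1. unfold qe, ZtoC. f_equal.
      rewrite plus_IZR, <- INR_IZR_INZ, !RtoC_plus, RtoC_mult. ring. }
    apply (T_nz tau 1 _ _ Ht (gcoef_sum_1_0 tau _ Ht)).
    (* The two initial terms differ by the factor exp(2 pi i (u + 1/2)) = -exp(2 pi i u), so their
       sum contains 1 - exp(2 pi i u). *)
    - apply Cmult_neq_0; [apply Cexp_nz|].
      replace (tfreq (INR 1 / 2) 0 * (u + 1 / 2))
        with (2 * PI * Ci * (u + 1 / 2) + tfreq (INR 1 / 2) (-1) * (u + 1 / 2))
        by (unfold tfreq; rewrite !RtoC_plus; ring).
      rewrite Cexp_plus, Ew. set (e := Cexp (tfreq _ _ * _)).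
      replace (- Cexp (2 * PI * Ci * u) * e + e) with (e * (1 - Cexp (2 * PI * Ci * u))) by ring.
      apply Cmult_neq_0; [apply Cexp_nz|]. intros H. apply (Hlat 0%Z).
      replace (ZtoC 0 * tau + u) with u by (unfold ZtoC; ring).
      rewrite <- (Cplus_0_r (Cexp _)), <- H. ring.
    - intros j. rewrite Ew, Eq. intros H. apply (Hlat (Z.of_nat j + 1)%Z).
      rewrite Cmult_plus_distr_l, Cexp_plus, <- (Cplus_0_r (_ * _)), <- H. ring.
    - intros j. rewrite Ew, Eq. intros H. apply (Hlat (- (Z.of_nat j + 1))%Z).
      replace (2 * PI * Ci * (ZtoC (- (Z.of_nat j + 1)) * tau + u))
        with (2 * PI * Ci * u - 2 * PI * Ci * (ZtoC (Z.of_nat j + 1) * tau))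
        by (unfold ZtoC; rewrite opp_IZR, RtoC_opp; ring).
      unfold Cminus. rewrite Cexp_plus, Cexp_opp.
      set (A := Cexp (2 * PI * Ci * u)) in *. set (B := Cexp (2 * PI * Ci * (ZtoC (Z.of_nat j + 1) * tau))) in *.
      assert (HA : A <> 0) by apply Cexp_nz. assert (HB : B <> 0) by apply Cexp_nz.
      replace (A * / B) with (/ (B * / A)) by (field; auto).
      replace (B * / A) with (1 - (1 + B * / - A)) by (field; auto). rewrite H. field. }
  change (- T tau (INR 1 / 2) 0 (u + 1 / 2) <> 0). intros H. apply HT.
  transitivity (- - T tau (INR 1 / 2) 0 (u + 1 / 2)); [ring|rewrite H; ring].
Qed.

Lemma theta2_constant_product tau : (0 < Im tau)%R ->
  Clim (fun N => gnorm tau 1 N * (2 * qe tau (1 / 4) *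
    cprod (fun j => (1 + qe tau (2 * INR j + 2)) ^ 2) N)) (thd tau 2 0 0).
Proof.
  intros Ht. pose proof (T_triple_product tau 1 0 _ Ht (gcoef_sum_1_0 tau _ Ht)) as H.
  refine (Clim_ext _ _ _ _ H). intros N. cbv beta. f_equal. f_equal.
  - rewrite !Cmult_0_r, Cexp_0. ring.
  - apply cprod_ext. intros j. rewrite Cmult_0_r, Cexp_0, qfactor_1. field.
Qed.

Lemma theta3_constant_product tau : (0 < Im tau)%R ->
  Clim (fun N => gnorm tau 0 N * cprod (fun j => (1 + qe tau (2 * INR j + 1)) ^ 2) N) (thd tau 3 0 0).
Proof.
  intros Ht. pose proof (T_triple_product tau 0 0 _ Ht (gcoef_sum_0_0 tau _)) as H.
  simpl (INR 0) in H. rewrite Rdiv_0_l in H.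
  refine (Clim_ext _ _ _ _ H). intros N. cbv beta. f_equal. rewrite Cmult_0_r, Cexp_0, Cmult_1_l.
  apply cprod_ext. intros j. unfold qfactor. simpl (INR 0). rewrite Rplus_0_r, Cmult_0_r, Cexp_0. field.
Qed.

Lemma theta4_constant_product tau : (0 < Im tau)%R ->
  Clim (fun N => gnorm tau 0 N * cprod (fun j => (1 - qe tau (2 * INR j + 1)) ^ 2) N) (thd tau 4 0 0).
Proof.
  intros Ht. pose proof (T_triple_product tau 0 (0 + 1 / 2) _ Ht (gcoef_sum_0_0 tau _)) as H.
  rewrite tfreq_0_0 in H. simpl (INR 0) in H. rewrite Rdiv_0_l in H.
  refine (Clim_ext _ _ _ _ H). intros N. cbv beta. f_equal. rewrite Cmult_1_l.
  apply cprod_ext. intros j. unfold qfactor. simpl (INR 0). rewrite Rplus_0_r.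
  replace (2 * PI * Ci * (0 + 1 / 2)) with (PI * Ci) by field. rewrite Cexp_PI. field.
Qed.

Lemma thd_constants_nz tau : (0 < Im tau)%R ->
  thd tau 2 0 0 <> 0 /\ thd tau 3 0 0 <> 0 /\ thd tau 4 0 0 <> 0.
Proof.
  intros Ht.
  assert (Hq : forall d j, 1 + qfactor tau d j * 1 <> 0).
  { intros d j. rewrite Cmult_1_r. now apply one_plus_neq_0, Cmod_qfactor_lt_1. }
  assert (Hq' : forall d j, 1 + qfactor tau d j * -1 <> 0).
  { intros d j. replace (qfactor tau d j * -1) with (- qfactor tau d j) by ring.
    now apply one_minus_neq_0, Cmod_qfactor_lt_1. }
  assert (Ez : forall x, T tau 0 0 x = T tau (INR 0 / 2) 0 x) by (intros; simpl (INR 0); now rewrite Rdiv_0_l).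
  assert (E1 : / RtoC 1 = 1) by field. assert (E2 : / RtoC (-1) = -1) by field.
  repeat split.
  - apply (T_nz tau 1 0 _ Ht (gcoef_sum_1_0 tau _ Ht)).
    + rewrite !Cmult_0_r, Cexp_0. apply Cmult_neq_0; [apply Cexp_nz|].
      intros X. rewrite <- RtoC_plus in X. apply RtoC_inj in X. lra.
    + intros j. rewrite Cmult_0_r, Cexp_0. auto.
    + intros j. rewrite Cmult_0_r, Cexp_0, E1. auto.
  - unfold thd. rewrite Ez. apply (T_nz tau 0 0 _ Ht (gcoef_sum_0_0 tau _)).
    + apply Cexp_nz.
    + intros j. rewrite Cmult_0_r, Cexp_0. auto.
    + intros j. rewrite Cmult_0_r, Cexp_0, E1. auto.
  - unfold thd. rewrite Ez. apply (T_nz tau 0 _ _ Ht (gcoef_sum_0_0 tau _)).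
    + apply Cexp_nz.
    + intros j. replace (2 * PI * Ci * (0 + 1 / 2)) with (PI * Ci) by field. rewrite Cexp_PI. auto.
    + intros j. replace (2 * PI * Ci * (0 + 1 / 2)) with (PI * Ci) by field. rewrite Cexp_PI, E2. auto.
Qed.

(** * Derivatives of theta_1 at 0 from moments of the finite product *)

Definition moment1 (tau : C) (N : nat) : C :=
  Ci * qe tau (1 / 4) * cprod (fun j => (1 - qe tau (2 * INR j + 2)) ^ 2) N.

(* Partial sums of the Lambert series sum q^j / (1 - q^j)^2. *)
Definition lambert (tau : C) (N : nat) : C :=
  lsum (fun j => qe tau (2 * INR j + 2) / (1 - qe tau (2 * INR j + 2)) ^ 2) (seq 0 N).

Lemma Cexp_tfreq_half_shift k :
  Cexp (tfreq (1 / 2) (k + 1) * (1 / 2)) = - Cexp (tfreq (1 / 2) k * (1 / 2)).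
Proof.
  replace (tfreq (1 / 2) (k + 1) * (1 / 2)) with (PI * Ci + tfreq (1 / 2) k * (1 / 2)).
  - rewrite Cexp_plus, Cexp_PI. ring.
  - unfold tfreq. rewrite plus_IZR, !RtoC_plus. field.
Qed.

Lemma Cexp_tfreq_half_0 : Cexp (tfreq (1 / 2) 0 * (1 / 2)) = Ci.
Proof.
  transitivity (Cexp (PI * Ci / 2)); [|apply Cexp_PI_half]. f_equal. unfold tfreq.
  rewrite RtoC_plus, RtoC_div by lra. field.
Qed.

(** At x = 1/2 the exponential changes sign under k -> k + 1. With t = k + 1/2, (t + 1) + (t - 1) =
    2t multiplies the first moment by 1 + f^2 - 2f = (1 - f)^2, and (t + 1)^3 + (t - 1)^3 = 2t^3 +
    6t lowers the ratio of the third moment to the first by 6f / (1 - f)^2, a Lambert term. The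
    ratio starts at (1/2)^2 = 1/4. *)
Lemma gcoef_moments tau : (0 < Im tau)%R -> forall N,
  has_sum (fun k => gcoef tau 1 N k * ((IZR k + 1 / 2)%R * Cexp (tfreq (1 / 2) k * (1 / 2))))
    (moment1 tau N) /\
  has_sum (fun k => gcoef tau 1 N k * ((IZR k + 1 / 2)%R ^ 3 * Cexp (tfreq (1 / 2) k * (1 / 2))))
    (moment1 tau N * (1 / 4 - 6 * lambert tau N)).
Proof.
  intros Ht. set (e := fun k => Cexp (tfreq (1 / 2) k * (1 / 2))).
  assert (He : forall k, e (k + 1)%Z = - e k) by apply Cexp_tfreq_half_shift.
  assert (He' : forall k, e (k - 1)%Z = - e k).
  { intros k. replace k with (k - 1 + 1)%Z at 2 by lia. rewrite He. ring. }
  assert (E0 : e 0%Z = Ci) by apply Cexp_tfreq_half_0.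
  assert (Em : e (-1)%Z = - Ci) by (rewrite <- E0, <- He'; easy).
  assert (EA : RtoC (0 + 1 / 2)%R = 1 / 2) by (rewrite RtoC_plus, RtoC_div by lra; field).
  assert (EB : RtoC (-1 + 1 / 2)%R = - (1 / 2)) by (rewrite RtoC_plus, RtoC_div by lra; field).
  induction N as [|N [IH1 IH3]].
  - split.
    + pose proof (gcoef_sum_1_0 tau (fun k => (IZR k + 1 / 2)%R * e k) Ht) as H.
      cbv beta in H. rewrite E0, Em, EA, EB in H.
      replace (qe tau (1 / 4) * (1 / 2 * Ci + - (1 / 2) * - Ci)) with (moment1 tau 0) in H
        by (unfold moment1; simpl; field). exact H.
    + pose proof (gcoef_sum_1_0 tau (fun k => (IZR k + 1 / 2)%R ^ 3 * e k) Ht) as H.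
      cbv beta in H. rewrite E0, Em, EA, EB in H.
      replace (qe tau (1 / 4) * ((1 / 2) ^ 3 * Ci + (- (1 / 2)) ^ 3 * - Ci))
        with (moment1 tau 0 * (1 / 4 - 6 * lambert tau 0)) in H
        by (unfold moment1, lambert; simpl; field). exact H.
  - set (m1 := moment1 tau N) in *. set (L := lambert tau N) in *.
    set (f := qe tau (2 * INR N + 2)).
    assert (Hf : 1 - f <> 0).
    { apply one_minus_neq_0, Cmod_qe_lt_1; auto. pose proof (pos_INR N). lra. }
    assert (EL : lambert tau (S N) = L + f / (1 - f) ^ 2).
    { transitivity (L + (f / (1 - f) ^ 2 + 0)); [|ring].
      unfold L, lambert. now rewrite seq_S, lsum_app. }
    assert (EM : moment1 tau (S N) = m1 * (1 - f) ^ 2).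
    { unfold m1, moment1.
      change (cprod _ (S N)) with (cprod (fun j => (1 - qe tau (2 * INR j + 2)) ^ 2) N * (1 - f) ^ 2).
      ring. }
    rewrite EL, EM. split.
    + replace (m1 * (1 - f) ^ 2) with ((1 + qfactor tau 1 N ^ 2) * m1 + qfactor tau 1 N * (-2 * m1))
        by (rewrite qfactor_1; fold f; ring).
      apply (gcoef_sum_S tau 1 N (fun k => (IZR k + 1 / 2)%R * e k)); auto.
      refine (has_sum_ext _ _ _ _ (has_sum_scal (-2) _ _ IH1)). intros k. cbv beta.
      rewrite He, He', plus_IZR, minus_IZR, !RtoC_plus, RtoC_minus. fold (e k). ring.
    + replace (m1 * (1 - f) ^ 2 * (1 / 4 - 6 * (L + f / (1 - f) ^ 2)))
        with ((1 + qfactor tau 1 N ^ 2) * (m1 * (1 / 4 - 6 * L)) +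
          qfactor tau 1 N * (-2 * (m1 * (1 / 4 - 6 * L)) + -6 * m1))
        by (rewrite qfactor_1; fold f; field; auto).
      apply (gcoef_sum_S tau 1 N (fun k => (IZR k + 1 / 2)%R ^ 3 * e k)); auto.
      refine (has_sum_ext _ _ _ _ (has_sum_plus _ _ _ _ (has_sum_scal (-2) _ _ IH3)
        (has_sum_scal (-6) _ _ IH1))).
      intros k. cbv beta.
      rewrite He, He', plus_IZR, minus_IZR, !RtoC_plus, RtoC_minus. fold (e k). ring.
Qed.

Lemma theta1_derivative_product tau : (0 < Im tau)%R ->
  Clim (fun N => gnorm tau 1 N * (2 * PI * Ci * moment1 tau N)) (T tau (1 / 2) 1 (1 / 2)).
Proof.
  intros Ht. apply (T_triple_product_lim tau 1 1 (1 / 2) (fun N => 2 * PI * Ci * moment1 tau N)); auto.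
  intros N. refine (has_sum_ext _ _ _ _ (has_sum_scal (2 * PI * Ci) _ _ (proj1 (gcoef_moments tau Ht N)))).
  intros k. cbv beta. simpl (INR 1). unfold tfreq at 2. ring.
Qed.

Lemma theta1_third_derivative_product tau : (0 < Im tau)%R ->
  Clim (fun N => gnorm tau 1 N * ((2 * PI * Ci) ^ 3 * (moment1 tau N * (1 / 4 - 6 * lambert tau N))))
    (T tau (1 / 2) 3 (1 / 2)).
Proof.
  intros Ht. apply (T_triple_product_lim tau 1 3 (1 / 2)
    (fun N => (2 * PI * Ci) ^ 3 * (moment1 tau N * (1 / 4 - 6 * lambert tau N)))); auto.
  intros N. refine (has_sum_ext _ _ _ _ (has_sum_scal ((2 * PI * Ci) ^ 3) _ _ (proj2 (gcoef_moments tau Ht N)))).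
  intros k. cbv beta. simpl (INR 1). unfold tfreq at 2. ring.
Qed.

(** Pairing 1 - q^j with 1 + q^j gives the even factors 1 - q^(2j), and pairing the half-integral
    powers gives the odd ones. *)
Lemma eulerP_double tau N :
  eulerP tau N * cprod (fun j => 1 + qe tau (2 * INR j + 2)) N *
    (cprod (fun j => 1 + qe tau (2 * INR j + 1)) N * cprod (fun j => 1 - qe tau (2 * INR j + 1)) N) =
  eulerP tau (2 * N).
Proof.
  induction N as [|N IH]; [unfold eulerP; simpl; ring|].
  replace (2 * S N)%nat with (S (S (2 * N))) by lia. rewrite !eulerP_S, <- IH. simpl cprod.
  rewrite S_INR, mult_INR. simpl (INR 2).
  replace (2 * ((1 + 1) * INR N) + 2)%R with ((2 * INR N + 1) + (2 * INR N + 1))%R by ring.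
  replace (2 * ((1 + 1) * INR N + 1) + 2)%R with ((2 * INR N + 2) + (2 * INR N + 2))%R by ring.
  rewrite !qe_plus. ring.
Qed.

Lemma cprod_sqr f n : cprod (fun j => f j ^ 2) n = cprod f n ^ 2.
Proof.
  rewrite (cprod_ext _ (fun j => f j * f j)) by (intros; ring). rewrite cprod_mult. ring.
Qed.

(* The relation already holds between the finite products, for every N. *)
Lemma jacobi_derivative_formula tau : (0 < Im tau)%R ->
  thd tau 1 1 0 = PI * (thd tau 2 0 0 * thd tau 3 0 0 * thd tau 4 0 0).
Proof.
  intros Ht. change (thd tau 1 1 0) with (- T tau (1 / 2) 1 (0 + 1 / 2)). rewrite Cplus_0_l.
  pose proof (Clim_scal (-1) _ _ (theta1_derivative_product tau Ht)) as H1.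
  pose proof (Clim_scal PI _ _ (Clim_mult _ _ _ _ (Clim_mult _ _ _ _ (theta2_constant_product tau Ht)
    (theta3_constant_product tau Ht)) (theta4_constant_product tau Ht))) as H2.
  replace (- T tau (1 / 2) 1 (1 / 2)) with (-1 * T tau (1 / 2) 1 (1 / 2)) by ring.
  refine (Clim_unique _ _ _ H1 (Clim_ext _ _ _ _ H2)). intros N. cbv beta.
  unfold moment1. rewrite !cprod_sqr.
  change (cprod (fun j => 1 - qe tau (2 * INR j + 2)) N) with (eulerP tau N).
  pose proof (eulerP_double tau N) as E.
  assert (E0 : gnorm tau 0 N = eulerP tau N * eulerP tau N / eulerP tau (2 * N)).
  { unfold gnorm. now rewrite !Nat.add_0_r. }
  rewrite E0. set (g := gnorm tau 1 N). set (P := eulerP tau N) in *. set (Q := eulerP tau (2 * N)) in *.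
  assert (HP : P <> 0) by now apply eulerP_nz. assert (HQ : Q <> 0) by now apply eulerP_nz.
  set (A := cprod (fun j => 1 + qe tau (2 * INR j + 2)) N) in *.
  set (B := cprod (fun j => 1 + qe tau (2 * INR j + 1)) N) in *.
  set (D := cprod (fun j => 1 - qe tau (2 * INR j + 1)) N) in *.
  (* The products are grouped so that [eulerP_double] turns the first square into Q^2, cancelling
     the denominators of the two norms with d = 0. *)
  transitivity (2 * PI * g * qe tau (1 / 4) * (P * A * (B * D)) ^ 2 * (P / Q) ^ 2); [field; auto|].
  rewrite E. transitivity (- (Ci * Ci) * (2 * PI * g * qe tau (1 / 4) * P ^ 2)); [|ring].
  rewrite Ci_sqr. field. auto.
Qed.

(** The ratio of moments 1/4 - 6s times (2 pi i)^2, the two additional frequencies of the third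
    derivative. *)
Lemma theta1_third_derivative_lambert tau s : (0 < Im tau)%R -> Clim (lambert tau) s ->
  thd tau 1 3 0 = (- PI ^ 2 + 24 * PI ^ 2 * s) * thd tau 1 1 0.
Proof.
  intros Ht Hs. change (thd tau 1 1 0) with (- T tau (1 / 2) 1 (0 + 1 / 2)).
  change (thd tau 1 3 0) with (- T tau (1 / 2) 3 (0 + 1 / 2)). rewrite !Cplus_0_l.
  pose proof (theta1_third_derivative_product tau Ht) as H3.
  pose proof (Clim_mult _ _ _ _ (theta1_derivative_product tau Ht)
    (Clim_scal ((2 * PI * Ci) ^ 2) _ _ (Clim_plus _ _ _ _ (Clim_const (1 / 4)) (Clim_scal (-6) _ _ Hs)))) as H1.
  assert (E : T tau (1 / 2) 3 (1 / 2) =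
    T tau (1 / 2) 1 (1 / 2) * ((2 * PI * Ci) ^ 2 * (1 / 4 + -6 * s))).
  { refine (Clim_unique _ _ _ H3 (Clim_ext _ _ _ _ H1)). intros N. cbv beta. field. }
  rewrite E. replace ((2 * PI * Ci) ^ 2) with (4 * PI ^ 2 * (Ci * Ci)) by ring. rewrite Ci_sqr. field.
Qed.

(** * The quasi-period eta *)

(* pi^2 / sin^2 (pi z) *)
Definition csc2 (z : C) : C :=
  -4 * PI ^ 2 * (Cexp (2 * PI * Ci * z) / (1 - Cexp (2 * PI * Ci * z)) ^ 2).

(** Halving z replaces the exponential by its two square roots f and -f. Both signs of [a] are
    allowed so that, on iteration, the shifts can be kept near 0. *)
Lemma csc2_duplication (z a : C) : a = 1 \/ a = -1 -> Cexp (2 * PI * Ci * z) <> 1 ->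
  csc2 z = / 4 * csc2 (z / 2) + / 4 * csc2 ((z + a) / 2).
Proof.
  intros Ha Hz. unfold csc2. set (f := Cexp (2 * PI * Ci * (z / 2))).
  assert (Ef : Cexp (2 * PI * Ci * z) = f * f).
  { unfold f. rewrite <- Cexp_plus. f_equal. field. }
  assert (Ea : Cexp (2 * PI * Ci * ((z + a) / 2)) = - f).
  { destruct Ha as [-> | ->].
    - replace (2 * PI * Ci * ((z + 1) / 2)) with (PI * Ci + 2 * PI * Ci * (z / 2)) by field.
      rewrite Cexp_plus, Cexp_PI. fold f. ring.
    - replace (2 * PI * Ci * ((z + -1) / 2)) with (- (PI * Ci) + 2 * PI * Ci * (z / 2)) by field.
      rewrite Cexp_plus, Cexp_opp, Cexp_PI. fold f. field. }
  rewrite Ea, Ef. rewrite Ef in Hz.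
  assert (H1 : 1 - f <> 0).
  { intros H. apply Hz. replace f with (1 - (1 - f)) by ring. rewrite H. ring. }
  assert (H2 : 1 + f <> 0).
  { intros H. apply Hz. replace f with ((1 + f) - 1) by ring. rewrite H. ring. }
  assert (H3 : 1 - f * f <> 0).
  { replace (1 - f * f) with ((1 - f) * (1 + f)) by ring. now apply Cmult_neq_0. }
  assert (H4 : 1 - - f <> 0) by (replace (1 - - f) with (1 + f) by ring; auto).
  field. auto.
Qed.

Lemma in_Zrange_iff n k : In k (Zrange n) <-> (- Z.of_nat n <= k < Z.of_nat n)%Z.
Proof.
  split; [|apply in_Zrange]. intros H. apply in_app_or in H.
  destruct H as [H|H]; apply in_map_iff in H; destruct H as [i [<- Hi]]; apply in_seq in Hi; lia.
Qed.

(** One duplication turns the index k into k and k -+ 2n. Subtracting for k >= 0 and adding for k <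
    0 keeps the indices in the symmetric range, which the bound on |Re w| in [csc2_has_sum] relies
    on. *)
Lemma Zrange_double n :
  Permutation (Zrange (2 * n)) (Zrange n ++
    map (fun k => if Z.leb 0 k then k - 2 * Z.of_nat n else k + 2 * Z.of_nat n)%Z (Zrange n)).
Proof.
  apply NoDup_Permutation; [apply NoDup_Zrange| |].
  - apply NoDup_app; [apply NoDup_Zrange| |].
    + apply NoDup_map_NoDup_ForallPairs; [|apply NoDup_Zrange].
      intros x y Hx Hy. apply in_Zrange_iff in Hx, Hy.
      destruct (Z.leb_spec 0 x), (Z.leb_spec 0 y); lia.
    + intros k H1 H2. apply in_Zrange_iff in H1. apply in_map_iff in H2.
      destruct H2 as [i [E Hi]]. apply in_Zrange_iff in Hi. destruct (Z.leb_spec 0 i); lia.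
  - intros k. rewrite in_app_iff, !in_Zrange_iff, in_map_iff. split.
    + intros H. destruct (Z_lt_le_dec k (- Z.of_nat n)).
      * right. exists (k + 2 * Z.of_nat n)%Z. rewrite in_Zrange_iff.
        destruct (Z.leb_spec 0 (k + 2 * Z.of_nat n)); lia.
      * destruct (Z_lt_le_dec k (Z.of_nat n)); [left; lia|]. right.
        exists (k - 2 * Z.of_nat n)%Z. rewrite in_Zrange_iff.
        destruct (Z.leb_spec 0 (k - 2 * Z.of_nat n)); lia.
    + intros [H|[i [E Hi]]]; [lia|]. apply in_Zrange_iff in Hi. destruct (Z.leb_spec 0 i); lia.
Qed.

Lemma pow2_nz n : RtoC (2 ^ n) <> 0.
Proof. intros H. apply RtoC_inj in H. apply (pow_nonzero 2 n) in H; lra. Qed.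

Lemma Cexp_dyadic_neq_1 z k m : (forall k : Z, z <> ZtoC k) ->
  Cexp (2 * PI * Ci * ((ZtoC k + z) / RtoC (2 ^ m))) <> 1.
Proof.
  intros Hz H. apply Cexp_eq_1 in H. destruct H as [j Hj].
  pose proof two_PI_i_nz as HP. pose proof (pow2_nz m) as H2. apply (Hz (j * 2 ^ Z.of_nat m - k)%Z).
  set (p := 2 * PI * Ci) in *. clearbody p.
  replace z with (p * ((ZtoC k + z) / RtoC (2 ^ m)) / p * RtoC (2 ^ m) - ZtoC k) by (field; auto).
  rewrite Hj. unfold ZtoC. rewrite minus_IZR, mult_IZR, <- pow_IZR, RtoC_minus, RtoC_mult.
  field. auto.
Qed.

Lemma csc2_dyadic z N : (forall k : Z, z <> ZtoC k) ->
  csc2 z = lsum (fun k => / RtoC (4 ^ (S N)) * csc2 ((ZtoC k + z) / RtoC (2 ^ (S N)))) (Zrange (2 ^ N)).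
Proof.
  intros Hz. pose proof (fun k m => Cexp_dyadic_neq_1 z k m Hz) as Hnz.
  induction N as [|N IH].
  - simpl. rewrite (csc2_duplication z (-1)); auto.
    + unfold ZtoC. rewrite !Rmult_1_r.
      replace (z + -1) with (-1 + z) by ring. replace (0 + z) with z by ring. ring.
    + specialize (Hnz 0%Z 0%nat). replace ((ZtoC 0 + z) / RtoC (2 ^ 0)) with z in Hnz; auto.
      unfold ZtoC. simpl. field.
  - replace (2 ^ S N)%nat with (2 * 2 ^ N)%nat by (simpl; lia).
    rewrite (lsum_perm _ _ _ (Zrange_double (2 ^ N))), lsum_app, lsum_map, <- lsum_plus, IH.
    apply lsum_ext. intros k. set (m := S N). pose proof (pow2_nz m) as H2.
    assert (H4 : RtoC (4 ^ m) <> 0) by (intros H; apply RtoC_inj in H; apply (pow_nonzero 4 m) in H; lra).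
    assert (E2 : RtoC (2 ^ S m) = 2 * RtoC (2 ^ m)) by (simpl; now rewrite RtoC_mult).
    assert (E4 : RtoC (4 ^ S m) = 4 * RtoC (4 ^ m)) by (simpl; now rewrite RtoC_mult).
    assert (EZ : IZR (2 * Z.of_nat (2 ^ N)) = (2 ^ m)%R).
    { rewrite mult_IZR, <- INR_IZR_INZ, pow_INR. unfold m. now change (INR 2) with 2%R. }
    rewrite E2, E4.
    rewrite (csc2_duplication _ (if Z.leb 0 k then -1 else 1)); [|destruct (Z.leb 0 k); auto|apply Hnz].
    replace ((ZtoC k + z) / RtoC (2 ^ m) / 2) with ((ZtoC k + z) / (2 * RtoC (2 ^ m))) by (field; auto).
    replace (((ZtoC k + z) / RtoC (2 ^ m) + (if Z.leb 0 k then -1 else 1)) / 2)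
      with ((ZtoC (if Z.leb 0 k then k - 2 * Z.of_nat (2 ^ N) else k + 2 * Z.of_nat (2 ^ N)) + z) /
        (2 * RtoC (2 ^ m))).
    + field. auto.
    + unfold ZtoC. destruct (Z.leb 0 k); [rewrite minus_IZR, RtoC_minus|rewrite plus_IZR, RtoC_plus];
        rewrite EZ; field; auto.
Qed.

(** Up to 1/4 the quadratic bound gives sin t >= t/2; beyond, sin t >= sin(1/4) >= 1/8 by
    monotonicity and reflection at pi/2, and t <= 3 since pi <= 4. Hence 24 = 3 * 8. *)
Lemma sin_lower (t : R) : (Rabs t <= 3 * (PI / 4))%R -> (Rabs t / 24 <= Rabs (sin t))%R.
Proof.
  assert (Hpos : forall t, (0 <= t <= 3 * (PI / 4))%R -> (t / 24 <= sin t)%R).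
  { intros x Hx. pose proof PI_4 as HPI. pose proof PI2_1 as HPI1.
    assert (Hq : (1 / 8 <= sin (1 / 4))%R).
    { pose proof (sin_quad_bound (1 / 4)) as H. rewrite (Rabs_pos_eq (1 / 4)) in H by lra.
      apply Rabs_le_between in H. lra. }
    destruct (Rle_lt_dec x (1 / 4)).
    - pose proof (sin_quad_bound x) as H. rewrite (Rabs_pos_eq x) in H by lra.
      apply Rabs_le_between in H. nra.
    - apply Rle_trans with (1 / 8)%R; [lra|].
      destruct (Rle_lt_dec x (PI / 2)).
      + eapply Rle_trans; [exact Hq|]. apply sin_incr_1; lra.
      + replace x with (PI - (PI - x))%R by ring. rewrite sin_PI_x.
        eapply Rle_trans; [exact Hq|]. unfold PI2 in *. apply sin_incr_1; lra. }
  intros Ht. destruct (Rle_lt_dec 0 t).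
  - rewrite Rabs_pos_eq in * by lra. eapply Rle_trans; [apply Hpos; lra|apply Rle_abs].
  - rewrite (Rabs_left t) in * by lra.
    eapply Rle_trans; [apply Hpos; lra|]. rewrite sin_neg, <- Rabs_Ropp. apply Rle_abs.
Qed.

(** For w = a + ib, |sin(pi w)|^2 = sin^2(pi a) + sinh^2(pi b) is bounded below by a multiple of a^2
    + b^2, the first part by [sin_lower]; 576 is 24^2. *)
Lemma csc2_bound (w : C) : w <> 0 -> (Rabs (Re w) <= 3 / 4)%R ->
  (Cmod (csc2 w) <= 4 * PI ^ 2 * 576 * / (Cmod w * Cmod w))%R.
Proof.
  intros Hw Ha. pose proof PI_RGT_0 as HPI. pose proof PI2_1 as HPI2.
  set (e := Cexp (PI * Ci * w)). assert (He : e <> 0) by apply Cexp_nz.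
  assert (E : Cexp (2 * PI * Ci * w) = e * e).
  { unfold e. rewrite <- Cexp_plus. f_equal. ring. }
  assert (Hb : (Cmod w * Cmod w <= 576 * (Cmod (e - / e) * Cmod (e - / e)))%R).
  { unfold e. rewrite <- Cexp_opp. destruct w as [a b]. simpl in Ha.
    set (p := exp (- (PI * b))). set (q := exp (PI * b)).
    assert (Ed : Cexp (PI * Ci * (a, b)) - Cexp (- (PI * Ci * (a, b))) =
      ((p - q) * cos (PI * a), (p + q) * sin (PI * a))%R).
    { unfold Cexp.
      replace (Re (PI * Ci * (a, b))) with (- (PI * b))%R by (simpl; ring).
      replace (Im (PI * Ci * (a, b))) with (PI * a)%R by (simpl; ring).
      replace (Re (- (PI * Ci * (a, b)))) with (PI * b)%R by (simpl; ring).
      replace (Im (- (PI * Ci * (a, b)))) with (- (PI * a))%R by (simpl; ring).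
      rewrite cos_neg, sin_neg. fold p q. apply injective_projections; simpl; ring. }
    rewrite Ed.
    assert (Hsq : forall z : C, (Cmod z * Cmod z = Re z ^ 2 + Im z ^ 2)%R).
    { intros z. rewrite <- Cmod2_alt. ring. }
    rewrite !Hsq. simpl Re. simpl Im.
    assert (Hpq : (p * q = 1)%R).
    { unfold p, q. rewrite <- exp_plus, <- exp_0. f_equal. ring. }
    pose proof (sin2_cos2 (PI * a)) as Hsc. unfold Rsqr in Hsc.
    set (s := sin (PI * a)) in *. set (c := cos (PI * a)) in *.
    replace (((p - q) * c) ^ 2 + ((p + q) * s) ^ 2)%R
      with ((p - q) ^ 2 * (s * s + c * c) + 4 * (p * q) * (s * s))%R by ring.
    rewrite Hsc, Hpq.
    assert (Hs : (a ^ 2 <= 576 * (s * s))%R).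
    { pose proof (sin_lower (PI * a)) as H. rewrite Rabs_mult, (Rabs_pos_eq PI) in H by lra.
      specialize (H ltac:(nra)). fold s in H.
      assert (H' : (Rabs a <= 24 * Rabs s)%R).
      { unfold PI2 in *. assert (1 <= PI)%R by lra. pose proof (Rabs_pos a). nra. }
      replace (a ^ 2)%R with (Rabs a * Rabs a)%R by (rewrite <- Rabs_mult, Rabs_pos_eq by nra; ring).
      replace (s * s)%R with (Rabs s * Rabs s)%R by (rewrite <- Rabs_mult, Rabs_pos_eq by nra; ring).
      pose proof (Rabs_pos a). nra. }
    assert (Hpqb : (b ^ 2 <= (p - q) ^ 2)%R).
    { assert (Hexp : forall t, (0 <= t)%R -> (t <= exp t - exp (- t))%R).
      { intros t Ht. pose proof (exp_ineq1_le t). assert (exp (- t) <= 1)%R; [|lra].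
        rewrite <- exp_0. apply exp_le. lra. }
      assert (1 <= PI)%R by (unfold PI2 in *; lra).
      destruct (Rle_lt_dec 0 b) as [Hb0|Hb0].
      - specialize (Hexp (PI * b)%R ltac:(nra)). fold p q in Hexp. assert (b <= q - p)%R by nra. nra.
      - specialize (Hexp (- (PI * b))%R ltac:(nra)). rewrite Ropp_involutive in Hexp.
        fold p q in Hexp. assert (- b <= p - q)%R by nra. nra. }
    nra. }
  assert (Hne : e - / e <> 0).
  { intros H. rewrite H, Cmod_0 in Hb. apply Cmod_gt_0 in Hw. nra. }
  assert (Eq : csc2 w = -4 * PI ^ 2 * (/ (e - / e) * / (e - / e))).
  { unfold csc2. rewrite E. f_equal.
    assert (H1 : 1 - e * e <> 0).
    { replace (1 - e * e) with (- e * (e - / e)) by (field; auto).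
      apply Cmult_neq_0; auto. intros H. apply He. replace e with (- - e) by ring. rewrite H. ring. }
    field. repeat split; auto. intros H. apply H1. replace (1 - e * e) with (- (e * e - 1)) by ring. rewrite H. ring. }
  rewrite Eq. rewrite !Cmod_mult, Cmod_inv, Cmod_R by auto.
  rewrite <- RtoC_pow, Cmod_R, (Rabs_pos_eq (PI ^ 2)) by (apply pow_le; lra).
  replace (Rabs (-4)) with 4%R by (rewrite Rabs_left; lra).
  rewrite (Rmult_assoc (4 * PI ^ 2)). apply Rmult_le_compat_l; [assert (0 <= PI ^ 2)%R by (apply pow_le; lra); lra|].
  apply Cmod_gt_0 in Hw. apply Cmod_gt_0 in Hne. set (x := Cmod (e - / e)) in *.
  assert (Hw2 : (0 < Cmod w * Cmod w)%R) by nra.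
  apply (Rmult_le_reg_r (Cmod w * Cmod w)); auto.
  rewrite (Rmult_assoc 576), Rinv_l, Rmult_1_r by lra.
  apply (Rmult_le_reg_l (x * x)); [nra|].
  replace (x * x * (/ x * / x * (Cmod w * Cmod w)))%R with (Cmod w * Cmod w)%R by (field; lra).
  lra.
Qed.

Lemma Clim_geom (u : nat -> C) (l : C) (K : R) :
  (forall n, (Cmod (u n - l) <= K * (1 / 2) ^ n)%R) -> Clim u l.
Proof.
  intros H eps He.
  destruct (pow_lt_1_zero (1 / 2)) with (y := (eps / (Rabs K + 1))%R) as [N HN].
  { rewrite Rabs_pos_eq; lra. }
  { pose proof (Rabs_pos K). apply Rdiv_lt_0_compat; lra. }
  exists N. intros n Hn. specialize (HN n Hn). rewrite Rabs_pos_eq in HN by (apply pow_le; lra).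
  eapply Rle_lt_trans; [apply H|]. pose proof (Rabs_pos K). pose proof (Rle_abs K).
  assert (Hp : (0 <= (1 / 2) ^ n)%R) by (apply pow_le; lra).
  apply Rle_lt_trans with ((Rabs K + 1) * (1 / 2) ^ n)%R; [nra|].
  replace eps with ((Rabs K + 1) * (eps / (Rabs K + 1)))%R by (field; lra).
  apply Rmult_lt_compat_l; lra.
Qed.

Lemma Cmod_inv_pow2 n : Cmod (/ RtoC (2 ^ n)) = ((1 / 2) ^ n)%R.
Proof.
  rewrite Cmod_inv by apply pow2_nz. rewrite Cmod_R, Rabs_pos_eq by (apply pow_le; lra).
  rewrite <- pow_inv by lra. f_equal. field.
Qed.

(** With t = 2^(-m) and a = 2 pi i v, the quotient (exp(a t) - 1) / t tends to a, so t^2 csc2(t v)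
    tends to -4 pi^2 / a^2 = 1 / v^2. *)
Lemma csc2_scaled_lim z k : (forall k : Z, z <> ZtoC k) ->
  Clim (fun N => / RtoC (4 ^ (S N)) * csc2 ((ZtoC k + z) / RtoC (2 ^ (S N)))) (/ (ZtoC k + z) ^ 2).
Proof.
  intros Hz. set (v := ZtoC k + z). set (a := 2 * PI * Ci * v).
  assert (Hv : v <> 0).
  { intros H. apply (Hz (- k)%Z). unfold v in H. unfold ZtoC. rewrite opp_IZR, RtoC_opp.
    replace z with (- RtoC (IZR k) + (ZtoC k + z)) by (unfold ZtoC; ring). rewrite H. ring. }
  assert (Ha : a <> 0) by (apply Cmult_neq_0; auto using two_PI_i_nz).
  set (t := fun N => / RtoC (2 ^ (S N))). set (e := fun N => Cexp (a * t N)).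
  assert (Htm : forall N, (Cmod (t N) <= (1 / 2) ^ N)%R).
  { intros N. unfold t. rewrite Cmod_inv_pow2. simpl. assert (0 <= (1 / 2) ^ N)%R by (apply pow_le; lra). lra. }
  assert (Ht1 : forall N, (Cmod (t N) <= 1)%R).
  { intros N. eapply Rle_trans; [apply Htm|].
    pose proof (pow_incr (1 / 2) 1 N ltac:(lra)) as H. now rewrite pow1 in H. }
  assert (Htn : forall N, t N <> 0).
  { intros N. apply Cmod_gt_0. unfold t. rewrite Cmod_inv_pow2. apply pow_lt. lra. }
  assert (Hd : Clim (fun N => (e N - 1) / t N) a).
  { apply (Clim_geom _ _ (5 * (Cmod a * Cmod a) * exp (Cmod a))). intros N.
    replace ((e N - 1) / t N - a) with ((e N - 1 - a * t N) * / t N) by (field; auto).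
    rewrite Cmod_mult, Cmod_inv by auto.
    pose proof (Cexp_quad (a * t N)) as HQ. fold (e N) in HQ. rewrite Cmod_mult in HQ.
    specialize (Htm N). specialize (Ht1 N). pose proof (proj1 (Cmod_gt_0 _) (Htn N)) as Hp.
    set (x := Cmod (t N)) in *. set (A := Cmod a) in *.
    assert (HA : (0 <= A)%R) by apply Cmod_ge_0.
    assert (HE : (exp (A * x) <= exp A)%R) by (apply exp_le; nra).
    apply (Rmult_le_reg_r x); auto. rewrite Rmult_assoc, Rinv_l, Rmult_1_r by lra.
    eapply Rle_trans; [exact HQ|].
    apply Rle_trans with (5 * (A * x * (A * x)) * exp A)%R.
    - apply Rmult_le_compat_l; auto. nra.
    - pose proof (exp_pos A). assert (0 <= A * A * exp A)%R by (apply Rmult_le_pos; [nra|lra]).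
      replace (5 * (A * x * (A * x)) * exp A)%R with (5 * (A * A * exp A) * x * x)%R by ring.
      replace (5 * (A * A) * exp A * (1 / 2) ^ N * x)%R with (5 * (A * A * exp A) * (1 / 2) ^ N * x)%R by ring.
      apply Rmult_le_compat_r; [lra|]. apply Rmult_le_compat_l; lra. }
  assert (Ht0 : Clim t 0).
  { apply (Clim_geom _ _ 1). intros N. replace (t N - 0) with (t N) by ring. rewrite Rmult_1_l. auto. }
  assert (He : Clim e 1).
  { pose proof (Clim_plus _ _ _ _ (Clim_const 1) (Clim_mult _ _ _ _ Hd Ht0)) as H.
    replace (1 + a * 0) with (RtoC 1) in H by ring. refine (Clim_ext _ _ _ _ H).
    intros N. cbv beta. field. auto. }
  pose proof (Clim_scal (-4 * PI ^ 2) _ _ (Clim_mult _ _ _ _ He (Clim_mult _ _ _ _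
    (Clim_inv _ _ Ha Hd) (Clim_inv _ _ Ha Hd)))) as H.
  replace (/ v ^ 2) with (-4 * PI ^ 2 * (1 * (/ a * / a))).
  - refine (Clim_ext _ _ _ _ H). intros N. cbv beta. unfold csc2.
    assert (E4 : RtoC (4 ^ S N) = RtoC (2 ^ S N) * RtoC (2 ^ S N)).
    { rewrite <- RtoC_mult. f_equal. rewrite <- Rpow_mult_distr. f_equal. }
    assert (Ee : Cexp (2 * PI * Ci * (v / RtoC (2 ^ S N))) = e N).
    { unfold e, t, a. f_equal. unfold Cdiv. ring. }
    pose proof (Cexp_dyadic_neq_1 z k (S N) Hz) as Hn. fold v in Hn. rewrite Ee in Hn. rewrite Ee, E4.
    unfold t. pose proof (pow2_nz (S N)) as H2. set (P := RtoC (2 ^ S N)) in *.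
    assert (H1 : 1 - e N <> 0).
    { now apply Cminus_eq_contra, not_eq_sym. }
    assert (H1' : e N - 1 <> 0).
    { now apply Cminus_eq_contra. }
    field. auto.
  - unfold a. replace (1 * (/ (2 * PI * Ci * v) * / (2 * PI * Ci * v)))
      with (/ (4 * PI ^ 2 * (Ci * Ci) * v ^ 2)).
    + rewrite Ci_sqr.
      field. auto using RtoC_PI_nz.
    + field. auto using Ci_nz, RtoC_PI_nz.
Qed.

Lemma inv_sqr_le_zweight k : (/ ((1 + IZR (Z.abs k)) * (1 + IZR (Z.abs k))) <= zweight k)%R.
Proof.
  pose proof (abs_IZR_pos k). unfold zweight. set (t := IZR (Z.abs k)) in *.
  assert (Hs : (1 <= sqrt (1 + t))%R) by (rewrite <- sqrt_1 at 1; apply sqrt_le_1; lra).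
  assert (Hs2 : (sqrt (1 + t) * sqrt (1 + t) = 1 + t)%R) by (apply sqrt_sqrt; lra).
  apply Rinv_le_contravar; nra.
Qed.

Lemma inv_sqr_bound (v : C) (c : R) k : (0 < c)%R -> (c * (1 + IZR (Z.abs k)) <= Cmod v)%R ->
  (/ (Cmod v * Cmod v) <= / (c * c) * zweight k)%R.
Proof.
  intros Hc Hv. pose proof (abs_IZR_pos k).
  eapply Rle_trans; [|apply Rmult_le_compat_l; [|apply inv_sqr_le_zweight]].
  - rewrite <- Rinv_mult. apply Rinv_le_contravar; [|].
    + apply Rmult_lt_0_compat; [nra|]. nra.
    + replace (c * c * ((1 + IZR (Z.abs k)) * (1 + IZR (Z.abs k))))%R
        with ((c * (1 + IZR (Z.abs k))) * (c * (1 + IZR (Z.abs k))))%R by ring.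
      apply Rmult_le_compat; nra.
  - left. apply Rinv_0_lt_compat. nra.
Qed.

Lemma lsum_ext_in {I : Type} (f g : I -> C) L :
  (forall i, In i L -> f i = g i) -> lsum f L = lsum g L.
Proof.
  induction L as [|a L IH]; simpl; intros H; [easy|]. rewrite IH, (H a); auto.
Qed.

(* Herglotz' duplication argument in Tannery form: in the dyadic expansion of csc2 z
   every term tends to 1 / (z + k)^2. *)
Lemma csc2_has_sum z c : (0 < c)%R ->
  (forall k, (c * (1 + IZR (Z.abs k)) <= Cmod (ZtoC k + z))%R) ->
  has_sum (fun k => / (ZtoC k + z) ^ 2) (csc2 z).
Proof.
  intros Hc Hz.
  assert (Hpos : forall k, (0 < Cmod (ZtoC k + z))%R).
  { intros k. pose proof (abs_IZR_pos k). specialize (Hz k). nra. }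
  assert (Hv : forall k, ZtoC k + z <> 0) by (intros k; apply Cmod_gt_0, Hpos).
  assert (Hzk : forall k : Z, z <> ZtoC k).
  { intros k E. apply (Hv (- k)%Z). rewrite E. unfold ZtoC. rewrite opp_IZR, RtoC_opp. ring. }
  assert (Hin : forall k, (/ (Cmod (ZtoC k + z) * Cmod (ZtoC k + z)) <= / (c * c) * zweight k)%R).
  { intros k. now apply inv_sqr_bound. }
  destruct (abs_summable (fun k => / (ZtoC k + z) ^ 2) (fun k => / (c * c) * zweight k)%R (/ (c * c) * 6))
    as [l Hl].
  { intros k. rewrite Cmod_inv by (apply Cpow_nz; auto).
    replace (Cmod ((ZtoC k + z) ^ 2)) with (Cmod (ZtoC k + z) * Cmod (ZtoC k + z))%R; [apply Hin|].
    rewrite Cmod_pow. ring. }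
  { apply sums_bounded_scal; [|apply zweight_bounded]. left. apply Rinv_0_lt_compat. nra. }
  assert (E : csc2 z = l); [|now rewrite E].
  set (g := fun N k => / RtoC (4 ^ (S N)) * csc2 ((ZtoC k + z) / RtoC (2 ^ (S N)))).
  (* Extending by 0 makes the finite expansion an unconditional sum over Z; outside its range
     [csc2_bound] would not apply. *)
  set (f := fun N k => if in_dec Z.eq_dec k (Zrange (2 ^ N)) then g N k else 0).
  (* From N0 on, |Re z| is at most a quarter of 2^(N+1). With |k| <= 2^N this places the scaled
     argument in the strip |Re w| <= 3/4 of [csc2_bound]. *)
  destruct (pow_lt_1_zero (1 / 2)) with (y := (/ (4 * (Rabs (Re z) + 1)))%R) as [N0 HN0].
  { rewrite Rabs_pos_eq; lra. }
  { apply Rinv_0_lt_compat. pose proof (Rabs_pos (Re z)). lra. }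
  apply (Clim_unique (fun _ => csc2 z)); [apply Clim_const|].
  set (K := (4 * PI ^ 2 * 576)%R).
  assert (HK : (0 <= K)%R) by (unfold K; assert (0 <= PI ^ 2)%R by (apply pow_le, Rlt_le, PI_RGT_0); lra).
  apply (tannery f (fun k => / (ZtoC k + z) ^ 2) (fun k => K * (/ (c * c) * zweight k))%R
    (K * (/ (c * c) * 6)) (fun _ => csc2 z) l N0).
  - intros k eps He. destruct (csc2_scaled_lim z k Hzk eps He) as [N1 HN1].
    exists (max N1 (Z.to_nat (Z.abs k) + 1)). intros N HN. unfold f.
    destruct in_dec as [_|Hno]; [apply HN1; lia|]. exfalso. apply Hno, in_Zrange.
    assert (N < 2 ^ N)%nat by (apply Nat.pow_gt_lin_r; lia). lia.
  - intros N k HN. unfold f. destruct in_dec as [Hk|_].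
    2:{ rewrite Cmod_0. apply Rmult_le_pos; auto. apply Rmult_le_pos; [left; apply Rinv_0_lt_compat; nra|].
        left; apply zweight_pos. }
    apply in_Zrange_iff in Hk.
    assert (H2 : (0 < 2 ^ S N)%R) by (apply pow_lt; lra).
    set (P := (2 ^ S N)%R) in *.
    assert (E4 : (4 ^ S N = P * P)%R).
    { unfold P. rewrite <- Rpow_mult_distr. f_equal. }
    assert (HP : RtoC P <> 0) by apply pow2_nz.
    assert (HkR : (Rabs (IZR k) <= P / 2)%R).
    { rewrite <- abs_IZR. replace (P / 2)%R with (IZR (Z.of_nat (2 ^ N))).
      - apply IZR_le. lia.
      - rewrite <- INR_IZR_INZ, pow_INR. unfold P. change (INR 2) with 2%R. simpl. field. }
    assert (HzR : (Rabs (Re z) <= P / 4)%R).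
    { specialize (HN0 (S N) ltac:(lia)). rewrite Rabs_pos_eq in HN0 by (apply pow_le; lra).
      replace ((1 / 2) ^ S N)%R with (/ P)%R in HN0.
      - pose proof (Rabs_pos (Re z)). apply (Rmult_lt_compat_l (P * (4 * (Rabs (Re z) + 1)))) in HN0.
        + replace (P * (4 * (Rabs (Re z) + 1)) * / P)%R with (4 * (Rabs (Re z) + 1))%R in HN0 by (field; lra).
          replace (P * (4 * (Rabs (Re z) + 1)) * / (4 * (Rabs (Re z) + 1)))%R with P in HN0 by (field; lra). lra.
        + apply Rmult_lt_0_compat; lra.
      - unfold P. rewrite <- pow_inv. f_equal. field. }
    unfold g. set (w := (ZtoC k + z) / RtoC P).
    assert (Hw : w <> 0).
    { intros X. apply (Hv k). replace (ZtoC k + z) with (w * RtoC P) by (unfold w; field; auto). rewrite X. ring. }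
    assert (HRe : (Rabs (Re w) <= 3 / 4)%R).
    { replace (Re w) with ((IZR k + Re z) / P)%R.
      - rewrite Rabs_div, (Rabs_pos_eq P) by lra.
        apply (Rmult_le_reg_r P); auto. unfold Rdiv at 1. rewrite Rmult_assoc, Rinv_l, Rmult_1_r by lra.
        eapply Rle_trans; [apply Rabs_triang|]. lra.
      - unfold w, Cdiv. rewrite <- RtoC_inv by lra. rewrite re_scal_r. unfold ZtoC, Rdiv. f_equal. }
    fold P. rewrite Cmod_mult. fold w.
    assert (HP4 : Cmod (/ RtoC (4 ^ S N)) = (/ (P * P))%R).
    { rewrite E4, Cmod_inv, Cmod_R, Rabs_pos_eq; [easy|nra|].
      intros X. apply RtoC_inj in X. nra. }
    rewrite HP4.
    assert (Hmw : Cmod (ZtoC k + z) = (Cmod w * P)%R).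
    { unfold w. rewrite Cmod_div, Cmod_R, Rabs_pos_eq by (auto; lra). field. lra. }
    specialize (Hin k). rewrite Hmw in Hin.
    pose proof (csc2_bound w Hw HRe) as HB. fold K in HB.
    apply Rle_trans with (K * / (Cmod w * P * (Cmod w * P)))%R; [|apply Rmult_le_compat_l; auto].
    apply Cmod_gt_0 in Hw.
    replace (K * / (Cmod w * P * (Cmod w * P)))%R with (/ (P * P) * (K * / (Cmod w * Cmod w)))%R by (field; lra).
    apply Rmult_le_compat_l; auto. left. apply Rinv_0_lt_compat. nra.
  - apply sums_bounded_scal; auto. apply sums_bounded_scal; [|apply zweight_bounded].
    left. apply Rinv_0_lt_compat. nra.
  - intros N. rewrite (csc2_dyadic z N Hzk). fold (g N).
    replace (lsum _ (Zrange (2 ^ N))) with (lsum (f N) (Zrange (2 ^ N))).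
    + apply has_sum_support; [apply NoDup_Zrange|]. intros k Hk. unfold f. now destruct in_dec.
    + apply lsum_ext_in. intros k Hk. unfold f. now destruct in_dec.
  - exact Hl.
Qed.

(** * Lattice estimates and the rows of the eta series *)

Lemma csc2_half : csc2 (1 / 2) = PI ^ 2.
Proof.
  unfold csc2. replace (2 * PI * Ci * (1 / 2)) with (PI * Ci) by field. rewrite Cexp_PI. field.
Qed.

Lemma csc2_opp z : csc2 (- z) = csc2 z.
Proof.
  unfold csc2. replace (2 * PI * Ci * - z) with (- (2 * PI * Ci * z)) by ring. rewrite Cexp_opp.
  set (e := Cexp (2 * PI * Ci * z)). assert (He : e <> 0) by apply Cexp_nz. f_equal.
  destruct (classic (1 - e = 0)) as [H|H].
  - replace e with (1 - (1 - e)) by ring. rewrite H. replace (1 - 0) with (RtoC 1) by ring.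
    now replace (/ 1) with (RtoC 1) by field.
  - field. repeat split; auto. intros X. apply H. replace (1 - e) with (- (e - 1)) by ring. rewrite X. ring.
Qed.

(** The imaginary part controls n, and the triangle inequality then controls m. *)
Lemma lattice_lower tau : (0 < Im tau)%R -> exists c, (0 < c)%R /\ forall m n : Z,
  (c * (IZR (Z.abs m) + IZR (Z.abs n)) <= Cmod (ZtoC m + ZtoC n * tau))%R.
Proof.
  intros Ht. set (y := Im tau) in *. set (K := (1 + (Cmod tau + 1) / y)%R).
  pose proof (Cmod_ge_0 tau) as Hc.
  assert (HK : (0 < K)%R).
  { unfold K. assert (0 < (Cmod tau + 1) / y)%R by (apply Rdiv_lt_0_compat; lra). lra. }
  exists (/ K)%R. split; [now apply Rinv_0_lt_compat|]. intros m n. set (W := ZtoC m + ZtoC n * tau).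
  assert (H1 : (IZR (Z.abs n) * y <= Cmod W)%R).
  { eapply Rle_trans; [|apply Rabs_re_im]. rewrite abs_IZR.
    replace (snd W) with (IZR n * y)%R.
    - rewrite Rabs_mult, (Rabs_pos_eq y); lra.
    - unfold W, ZtoC, y. destruct tau; simpl. ring. }
  assert (H2 : (IZR (Z.abs m) <= Cmod W + IZR (Z.abs n) * Cmod tau)%R).
  { rewrite !abs_IZR, <- !Cmod_R, <- Cmod_mult. change (RtoC (IZR m)) with (ZtoC m).
    replace (ZtoC m) with (W + - (ZtoC n * tau)) by (unfold W; ring).
    eapply Rle_trans; [apply Cmod_triangle|]. rewrite Cmod_opp. apply Rle_refl. }
  assert (H3 : (IZR (Z.abs n) <= Cmod W / y)%R).
  { apply (Rmult_le_reg_r y); auto. replace (Cmod W / y * y)%R with (Cmod W) by (field; lra). lra. }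
  apply (Rmult_le_reg_l K); auto. rewrite <- Rmult_assoc, Rinv_r, Rmult_1_l by lra.
  replace (K * Cmod W)%R with (Cmod W + Cmod W / y * (Cmod tau + 1))%R by (unfold K; field; lra).
  nra.
Qed.

Lemma has_sum_parity (f : Z -> C) a b l :
  has_sum (fun p => f (2 * p)%Z) a -> has_sum (fun p => f (2 * p + 1)%Z) b -> has_sum f l -> l = a + b.
Proof.
  intros Ha Hb Hl.
  apply (has_sum_bij (fun p : bool * Z => 2 * snd p + Z.b2z (fst p))%Z (fun n => (Z.odd n, n / 2)%Z)) in Hl.
  - set (G := fun r : bool => if r then b else a).
    refine (has_sum_unique G _ _ (has_sum_fubini _ G _ Hl _) (has_sum_bool G)).
    intros [|]; simpl; auto. apply (has_sum_ext (fun p => f (2 * p)%Z)); auto.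
    intros p. f_equal. simpl. lia.
  - intros [r p]. simpl fst. simpl snd. rewrite Z.add_comm, Z.odd_add_mul_2. f_equal; [now destruct r|].
    rewrite Z.mul_comm, Z.div_add by lia. now destruct r.
  - intros n. pose proof (Z.div_mod n 2 ltac:(lia)) as E. rewrite Zmod_odd in E. revert E.
    cbn [fst snd]. destruct (Z.odd n); cbn [Z.b2z]; lia.
Qed.

Definition inv_sqr (k : Z) : C := if Z.eqb k 0 then 0 else / ZtoC k ^ 2.

(* The case z = 1/2 of csc2_has_sum sums the odd terms, 1/4 of the total is the even part. *)
Lemma basel : has_sum inv_sqr (PI ^ 2 / 3).
Proof.
  assert (Hhalf : has_sum (fun k => / (ZtoC k + 1 / 2) ^ 2) (PI ^ 2)).
  { rewrite <- csc2_half. apply (csc2_has_sum (1 / 2) (1 / 4)); [lra|]. intros k.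
    replace (ZtoC k + 1 / 2) with (RtoC (IZR k + 1 / 2))
      by (unfold ZtoC; rewrite RtoC_plus, RtoC_div by lra; easy).
    rewrite Cmod_R, abs_IZR.
    destruct (Z_lt_le_dec k 0) as [H|H].
    - assert (H' : (IZR k <= -1)%R) by (apply IZR_le; lia).
      unfold Rabs; repeat destruct Rcase_abs; lra.
    - assert (H' : (0 <= IZR k)%R) by (now apply IZR_le).
      unfold Rabs; repeat destruct Rcase_abs; lra. }
  destruct (abs_summable inv_sqr (fun k => / (1 / 2 * (1 / 2)) * zweight k)%R (/ (1 / 2 * (1 / 2)) * 6)) as [b Hb].
  { intros k. unfold inv_sqr. destruct (Z.eqb_spec k 0) as [E|E].
    - rewrite Cmod_0. pose proof (zweight_pos k). lra.
    - assert (Hk : ZtoC k <> 0) by (intros X; apply RtoC_inj in X; now apply eq_IZR_R0 in X).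
      rewrite Cmod_inv, Cmod_pow by (apply Cpow_nz; auto).
      replace (Cmod (ZtoC k) ^ 2)%R with (Cmod (ZtoC k) * Cmod (ZtoC k))%R by ring.
      apply inv_sqr_bound; [lra|]. unfold ZtoC. rewrite Cmod_R, <- abs_IZR.
      assert (1 <= IZR (Z.abs k))%R by (apply IZR_le; lia). lra. }
  { apply sums_bounded_scal; [lra|apply zweight_bounded]. }
  assert (E : b = / 4 * b + / 4 * PI ^ 2).
  { apply (has_sum_parity inv_sqr); auto.
    - refine (has_sum_ext _ _ _ _ (has_sum_scal (/ 4) _ _ Hb)). intros p. cbv beta. unfold inv_sqr.
      destruct (Z.eqb_spec p 0) as [Ep|Ep]; [subst; simpl; ring|].
      destruct (Z.eqb_spec (2 * p) 0); [lia|].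
      assert (Hk : ZtoC p <> 0) by (intros X; apply RtoC_inj in X; now apply eq_IZR_R0 in X).
      unfold ZtoC in *. rewrite mult_IZR, RtoC_mult. field. auto.
    - refine (has_sum_ext _ _ _ _ (has_sum_scal (/ 4) _ _ Hhalf)). intros p. cbv beta. unfold inv_sqr.
      destruct (Z.eqb_spec (2 * p + 1) 0); [lia|].
      assert (Hk : ZtoC (2 * p + 1) <> 0) by (intros X; apply RtoC_inj in X; apply eq_IZR_R0 in X; lia).
      unfold ZtoC in *. rewrite plus_IZR, mult_IZR, RtoC_plus, RtoC_mult in *.
      replace (RtoC (IZR p) + 1 / 2) with ((2 * IZR p + 1) / 2) by field. field. auto. }
  replace (PI ^ 2 / 3) with b; auto.
  assert (E' : 3 * b = PI ^ 2).
  { replace (3 * b) with (4 * b - b) by ring. rewrite E at 1. field. }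
  rewrite <- E'. field.
Qed.

Lemma lsum_Zrange_S (f : Z -> C) n :
  lsum f (Zrange (S n)) = lsum f (Zrange n) + f (Z.of_nat n) + f (- Z.of_nat (S n))%Z.
Proof.
  unfold Zrange. rewrite !seq_S, !map_app, !lsum_app. cbn [map lsum].
  change (0 + n)%nat with n. ring.
Qed.

Lemma Clim_inv_nat (x : nat -> C) K : (forall n, (Cmod (x n) * (1 + INR n) <= K)%R) -> Clim x 0.
Proof.
  intros H eps He.
  assert (HK : (0 <= K)%R).
  { eapply Rle_trans; [|apply (H 0%nat)]. simpl. pose proof (Cmod_ge_0 (x 0%nat)). lra. }
  destruct (INR_unbounded (K / eps)) as [N HN]. exists N. intros n Hn.
  replace (x n - 0) with (x n) by ring. specialize (H n).
  assert (HNn : (INR N <= INR n)%R) by now apply le_INR.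
  pose proof (pos_INR n). apply (Rmult_lt_reg_r (1 + INR n)); [lra|].
  assert (K < eps * (1 + INR n))%R; [|lra].
  replace K with (eps * (K / eps))%R by (field; lra). apply Rmult_lt_compat_l; lra.
Qed.

(** With u(m) = 1 / (2m - 1 + c), the general term is (u(m + 1) - u(m)) / 2. The lower bound makes
    every denominator nonzero and sends u to 0 at both ends. *)
Lemma telescoping_sum (c : C) (d : R) v : (0 < d)%R ->
  (forall m, (d * (1 + IZR (Z.abs m)) <= Cmod (ZtoC (2 * m - 1) + c))%R) ->
  has_sum (fun m => / (1 - (2 * ZtoC m + c) ^ 2)) v -> v = 0.
Proof.
  intros Hd Hc Hv. set (u := fun m => / (ZtoC (2 * m - 1) + c)).
  assert (Hnz : forall m, ZtoC (2 * m - 1) + c <> 0).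
  { intros m. apply Cmod_gt_0. specialize (Hc m). pose proof (abs_IZR_pos m). nra. }
  assert (Hu : forall h : nat -> Z, (forall n, Z.abs (h n) = Z.of_nat n) -> Clim (fun n => u (h n)) 0).
  { intros h Hh. apply (Clim_inv_nat _ (/ d)). intros n. unfold u. rewrite Cmod_inv by auto.
    specialize (Hc (h n)). rewrite Hh, <- INR_IZR_INZ in Hc. pose proof (pos_INR n).
    specialize (Hnz (h n)). apply Cmod_gt_0 in Hnz. set (x := Cmod (ZtoC (2 * h n - 1) + c)) in *.
    apply (Rmult_le_reg_l (x * d)); [now apply Rmult_lt_0_compat|].
    replace (x * d * (/ x * (1 + INR n)))%R with (d * (1 + INR n))%R by (field; lra).
    replace (x * d * / d)%R with x by (field; lra). auto. }
  apply Clim_Zrange in Hv.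
  assert (E : forall n, lsum (fun m => / (1 - (2 * ZtoC m + c) ^ 2)) (Zrange n) =
    / 2 * (u (Z.of_nat n) + (-1) * u (- Z.of_nat n)%Z)).
  { assert (Et : forall m, / (1 - (2 * ZtoC m + c) ^ 2) = / 2 * (u (m + 1)%Z - u m)).
    { intros m. unfold u. pose proof (Hnz m) as A1. pose proof (Hnz (m + 1)%Z) as A2.
      replace (ZtoC (2 * (m + 1) - 1)) with (2 * ZtoC m + 1) in *
        by (unfold ZtoC; rewrite minus_IZR, mult_IZR, plus_IZR, RtoC_minus, RtoC_mult, RtoC_plus; ring).
      replace (ZtoC (2 * m - 1)) with (2 * ZtoC m - 1) in *
        by (unfold ZtoC; rewrite minus_IZR, mult_IZR, RtoC_minus, RtoC_mult; ring).
      assert (A3 : 1 - (2 * ZtoC m + c) ^ 2 <> 0).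
      { replace (1 - (2 * ZtoC m + c) ^ 2) with (- ((2 * ZtoC m + 1 + c) * (2 * ZtoC m - 1 + c))) by ring.
        intros X. apply (Cmult_neq_0 _ _ A2 A1).
        replace ((2 * ZtoC m + 1 + c) * (2 * ZtoC m - 1 + c))
          with (- - ((2 * ZtoC m + 1 + c) * (2 * ZtoC m - 1 + c))) by ring. rewrite X. ring. }
      field. auto. }
    induction n as [|n IH].
    - simpl. ring.
    - rewrite lsum_Zrange_S, IH, !Et.
      replace (- Z.of_nat (S n) + 1)%Z with (- Z.of_nat n)%Z by lia.
      replace (Z.of_nat n + 1)%Z with (Z.of_nat (S n)) by lia. ring. }
  apply (Clim_unique _ _ _ Hv).
  pose proof (Clim_scal (/ 2) _ _ (Clim_plus _ _ _ _ (Hu Z.of_nat ltac:(lia))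
    (Clim_scal (-1) _ _ (Hu (fun n => - Z.of_nat n)%Z ltac:(lia))))) as H.
  replace (/ 2 * (0 + -1 * 0)) with (RtoC 0) in H by ring.
  refine (Clim_ext _ _ _ _ H). intros n. cbv beta. now rewrite E.
Qed.

Lemma ZtoC_plus a b : ZtoC (a + b) = ZtoC a + ZtoC b.
Proof. unfold ZtoC. now rewrite plus_IZR, RtoC_plus. Qed.

Lemma ZtoC_minus a b : ZtoC (a - b) = ZtoC a - ZtoC b.
Proof. unfold ZtoC. now rewrite minus_IZR, RtoC_minus. Qed.

Lemma ZtoC_mult a b : ZtoC (a * b) = ZtoC a * ZtoC b.
Proof. unfold ZtoC. now rewrite mult_IZR, RtoC_mult. Qed.

Lemma ZtoC_opp a : ZtoC (- a) = - ZtoC a.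
Proof. unfold ZtoC. now rewrite opp_IZR, RtoC_opp. Qed.

(** The multiplication and division by 1 are kept so that the term is convertible with the one in
    [weierstrass_zeta] for z = w = 1. *)
Definition zeta_term (tau : C) (p : Z * Z) : C :=
  if (Z.eqb (fst p) 0 && Z.eqb (snd p) 0)%bool then 0 else
  let W := 2 * ZtoC (fst p) * 1 + 2 * ZtoC (snd p) * tau in / (1 - W) + / W + 1 / W ^ 2.

(** For a, b >= 1 and s = a + b - 1 one has ab <= s^2, hence (ab)^(3/2) <= s^3. This separates the
    variables in a cubic lattice bound. *)
Lemma zweight_mult_lower m n :
  (/ (1 + IZR (Z.abs m) + IZR (Z.abs n)) ^ 3 <= zweight m * zweight n)%R.
Proof.
  pose proof (abs_IZR_pos m). pose proof (abs_IZR_pos n). unfold zweight. rewrite <- Rinv_mult.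
  set (a := (1 + IZR (Z.abs m))%R) in *. set (b := (1 + IZR (Z.abs n))%R) in *.
  set (s := (a + IZR (Z.abs n))%R).
  assert (Ha : (1 <= a)%R) by (unfold a; lra). assert (Hb : (1 <= b)%R) by (unfold b; lra).
  assert (Hs : (s = a + b - 1)%R) by (unfold s, b; lra).
  assert (Hsq : (a * b <= s * s)%R) by (rewrite Hs; nra).
  assert (Hr : (sqrt a * sqrt b <= s)%R).
  { rewrite <- sqrt_mult by lra. rewrite <- (sqrt_square s) by lra. apply sqrt_le_1; nra. }
  assert (0 < sqrt a)%R by (apply sqrt_lt_R0; lra). assert (0 < sqrt b)%R by (apply sqrt_lt_R0; lra).
  apply Rinv_le_contravar.
  - repeat apply Rmult_lt_0_compat; lra.
  - replace (a * sqrt a * (b * sqrt b))%R with (a * b * (sqrt a * sqrt b))%R by ring.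
    replace (s ^ 3)%R with (s * s * s)%R by ring. apply Rmult_le_compat; nra.
Qed.

(** The three fractions combine to 1 / (W^2 (1 - W)), which decays cubically. *)
Lemma zeta_term_bound tau : (0 < Im tau)%R -> exists K, (0 < K)%R /\
  forall p, (Cmod (zeta_term tau p) <= K * (zweight (fst p) * zweight (snd p)))%R.
Proof.
  intros Ht. destruct (lattice_lower tau Ht) as [c [Hc HL]].
  exists (2 / (c * c * c))%R. assert (Hc3 : (0 < c * c * c)%R) by (repeat apply Rmult_lt_0_compat; auto).
  split; [apply Rdiv_lt_0_compat; lra|]. intros [m n]. simpl fst. simpl snd.
  unfold zeta_term. simpl fst. simpl snd.
  pose proof (zweight_pos m) as Zm. pose proof (zweight_pos n) as Zn.
  assert (HK : (0 < 2 / (c * c * c))%R) by (apply Rdiv_lt_0_compat; lra).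
  destruct (Z.eqb m 0 && Z.eqb n 0)%bool eqn:E0; [rewrite Cmod_0; apply Rmult_le_pos; nra|].
  assert (Hmn : (1 <= IZR (Z.abs m) + IZR (Z.abs n))%R).
  { rewrite <- plus_IZR. apply IZR_le. apply Bool.andb_false_iff in E0.
    rewrite !Z.eqb_neq in E0. lia. }
  set (s := (1 + IZR (Z.abs m) + IZR (Z.abs n))%R).
  set (W := 2 * ZtoC m * 1 + 2 * ZtoC n * tau). cbv zeta. fold W.
  assert (HW : (c * s <= Cmod W)%R).
  { replace W with (2 * (ZtoC m + ZtoC n * tau)) by (unfold W; ring).
    rewrite Cmod_mult, Cmod_R, Rabs_pos_eq by lra. specialize (HL m n). unfold s. nra. }
  assert (HW1 : (c * s / 2 <= Cmod (1 - W))%R).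
  (* The coordinate 1 - 2m is odd, so 1 - W stays away from 0; since |1 - 2m| >= |m|, its size is
     again governed by |m| + |n| >= s/2. *)
  { replace (1 - W) with (ZtoC (1 - 2 * m) + ZtoC (- 2 * n) * tau)
      by (unfold W; rewrite ZtoC_minus, !ZtoC_mult; unfold ZtoC; ring).
    eapply Rle_trans; [|apply HL].
    assert (HA : (IZR (Z.abs m) <= IZR (Z.abs (1 - 2 * m)))%R) by (apply IZR_le; lia).
    assert (HB : (IZR (Z.abs n) <= IZR (Z.abs (-2 * n)))%R) by (apply IZR_le; lia).
    unfold s. nra. }
  assert (Hcs : (0 < c * s)%R) by (unfold s; apply Rmult_lt_0_compat; lra).
  assert (HW0 : W <> 0) by (apply Cmod_gt_0; lra).
  assert (HW10 : 1 - W <> 0) by (apply Cmod_gt_0; lra).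
  replace (/ (1 - W) + / W + 1 / W ^ 2) with (/ (W * W * (1 - W))) by (field; auto).
  rewrite Cmod_inv, !Cmod_mult by (repeat apply Cmult_neq_0; auto).
  apply Rle_trans with (2 / (c * c * c) * / s ^ 3)%R; [|apply Rmult_le_compat_l; [lra|apply zweight_mult_lower]].
  assert (Hs : (0 < s)%R) by (unfold s; lra).
  replace (2 / (c * c * c) * / s ^ 3)%R with (/ (c * s * (c * s) * (c * s / 2)))%R by (field; lra).
  apply Rinv_le_contravar; [repeat apply Rmult_lt_0_compat; lra|].
  apply Rmult_le_compat; try lra; [nra|]. apply Rmult_le_compat; lra.
Qed.

(* Pairing (m, n) with (-m, -n) replaces the general term by 1/(1 - W^2) + 1/W^2;
   summed over m, the first part telescopes and the second is csc2. *)
Lemma eta_row tau n v : (0 < Im tau)%R ->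
  has_sum (fun m => / 2 * (zeta_term tau (m, n) + zeta_term tau (- m, - n)%Z)) v ->
  v = if Z.eqb n 0 then / 4 * (PI ^ 2 / 3) - 1 else / 4 * csc2 (ZtoC n * tau).
Proof.
  intros Ht Hv. destruct (lattice_lower tau Ht) as [c [Hc HL]].
  set (R := if Z.eqb n 0 then / 4 * (PI ^ 2 / 3) - 1 else / 4 * csc2 (ZtoC n * tau)).
  (* The quarter comes from W = 2(m + n tau). In row 0 the zeta series omits W = 0, whereas the
     telescoping series has the term 1 / (1 - 0) = 1 there; the subtracted 1 compensates. *)
  set (r := fun m => if Z.eqb n 0 then / 4 * inv_sqr m - (if Z.eqb m 0 then 1 else 0)
    else / 4 * / (ZtoC m + ZtoC n * tau) ^ 2).
  assert (HR : has_sum r R).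
  { unfold r, R. destruct (Z.eqb_spec n 0) as [En|En].
    - apply has_sum_minus; [apply has_sum_scal, basel|].
      pose proof (has_sum_support (fun m : Z => (if Z.eqb m 0 then 1 else 0) : C) (0%Z :: nil)) as HS.
      cbn [lsum Z.eqb] in HS. replace (1 + 0) with (RtoC 1) in HS by ring.
      apply HS; [repeat constructor; easy|].
      intros m Hm. destruct (Z.eqb_spec m 0); [subst; simpl in Hm; tauto|easy].
    - apply has_sum_scal, (csc2_has_sum _ c); auto. intros m.
      eapply Rle_trans; [|apply HL]. apply Rmult_le_compat_l; [lra|].
      assert (1 <= IZR (Z.abs n))%R by (apply IZR_le; lia). lra. }
  assert (E : v - R = 0).
  { apply (telescoping_sum (2 * (ZtoC n * tau)) (c / 2)); [lra| |].
    - intros m. replace (2 * (ZtoC n * tau)) with (ZtoC (2 * n) * tau)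
        by (rewrite ZtoC_mult; unfold ZtoC; ring).
      eapply Rle_trans; [|apply HL].
      assert (H1 : (1 + IZR (Z.abs m) <= 2 * IZR (Z.abs (2 * m - 1)))%R).
      { rewrite <- mult_IZR, <- plus_IZR. apply IZR_le. lia. }
      pose proof (abs_IZR_pos (2 * n)). nra.
    - refine (has_sum_ext _ _ _ _ (has_sum_minus _ _ _ _ Hv HR)). intros m. cbv beta.
      unfold zeta_term, r. cbn [fst snd].
      replace (Z.eqb (- m) 0) with (Z.eqb m 0) by (destruct (Z.eqb_spec m 0), (Z.eqb_spec (- m) 0); auto; lia).
      replace (Z.eqb (- n) 0) with (Z.eqb n 0) by (destruct (Z.eqb_spec n 0), (Z.eqb_spec (- n) 0); auto; lia).
      assert (Hodd : forall z : Z, Z.odd z = true -> forall w, ZtoC z + ZtoC w * tau <> 0).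
      { intros z Hz w. apply Cmod_gt_0. specialize (HL z w).
        assert (1 <= IZR (Z.abs z))%R by (apply IZR_le; destruct z; simpl in *; try lia; easy).
        pose proof (abs_IZR_pos w). nra. }
      assert (A1 : 1 - (2 * ZtoC m + 2 * (ZtoC n * tau)) <> 0).
      { replace (1 - (2 * ZtoC m + 2 * (ZtoC n * tau))) with (ZtoC (1 - 2 * m) + ZtoC (-2 * n) * tau)
          by (rewrite ZtoC_minus, !ZtoC_mult; unfold ZtoC; ring).
        apply Hodd. replace (1 - 2 * m)%Z with (1 + 2 * (- m))%Z by ring. now rewrite Z.odd_add_mul_2. }
      assert (A2 : 1 + (2 * ZtoC m + 2 * (ZtoC n * tau)) <> 0).
      { replace (1 + (2 * ZtoC m + 2 * (ZtoC n * tau))) with (ZtoC (1 + 2 * m) + ZtoC (2 * n) * tau)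
          by (rewrite ZtoC_plus, !ZtoC_mult; unfold ZtoC; ring).
        apply Hodd. now rewrite Z.odd_add_mul_2. }
      rewrite !ZtoC_opp.
      replace (2 * - ZtoC m * 1 + 2 * - ZtoC n * tau) with (- (2 * (ZtoC m + ZtoC n * tau))) by ring.
      replace (2 * ZtoC m * 1 + 2 * ZtoC n * tau) with (2 * (ZtoC m + ZtoC n * tau)) by ring.
      replace (2 * ZtoC m + 2 * (ZtoC n * tau)) with (2 * (ZtoC m + ZtoC n * tau)) in * by ring.
      set (V := ZtoC m + ZtoC n * tau) in *.
      assert (A3 : 1 - (2 * V) ^ 2 <> 0).
      { replace (1 - (2 * V) ^ 2) with ((1 - 2 * V) * (1 + 2 * V)) by ring. now apply Cmult_neq_0. }
      assert (A4 : 1 - - (2 * V) <> 0) by (replace (1 - - (2 * V)) with (1 + 2 * V) by ring; auto).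
      assert (HV : V <> 0 -> / 2 * (/ (1 - 2 * V) + / (2 * V) + 1 / (2 * V) ^ 2 +
         (/ (1 - - (2 * V)) + / - (2 * V) + 1 / (- (2 * V)) ^ 2)) - / 4 * / V ^ 2 = / (1 - (2 * V) ^ 2)).
      { intros HV. field. repeat split; auto. }
      destruct (Z.eqb_spec n 0) as [En|En].
      + assert (EV : V = ZtoC m) by (unfold V; rewrite En; unfold ZtoC; ring).
        unfold inv_sqr. destruct (Z.eqb_spec m 0) as [Em|Em]; cbn [andb].
        * rewrite EV, Em. unfold ZtoC. replace (1 - (2 * 0) ^ 2) with (RtoC 1) by ring. field.
        * rewrite <- EV. rewrite <- HV; [ring|]. rewrite EV. intros X. apply RtoC_inj in X.
          now apply eq_IZR_R0 in X.
      + rewrite Bool.andb_false_r. apply HV. apply Cmod_gt_0. specialize (HL m n).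
        assert (1 <= IZR (Z.abs n))%R by (apply IZR_le; lia). pose proof (abs_IZR_pos m).
        fold V in HL. nra. }
  replace v with (v - R + R) by ring. rewrite E. ring.
Qed.

(** The leading 1/z = 1 cancels the -1 of row 0, whose Basel part is pi^2 / 12. Rows n and -n agree,
    and together they give csc2(n tau) / 2 = -2 pi^2 q^n / (1 - q^n)^2. *)
Lemma eta_lambert tau : (0 < Im tau)%R ->
  exists s, Clim (lambert tau) s /\ eta tau = PI ^ 2 / 12 - 2 * PI ^ 2 * s.
Proof.
  intros Ht. destruct (zeta_term_bound tau Ht) as [K [HK HB]].
  pose proof RtoC_PI_nz as HPI.
  assert (HW2 : sums_bounded (fun p : Z * Z => zweight (fst p) * zweight (snd p))%R (6 * 6)).
  { apply sums_bounded_prod; try (intros; left; apply zweight_pos); apply zweight_bounded. }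
  assert (Hrow : forall m k, (Cmod (zeta_term tau (m, k)) <= K * zweight m * zweight k)%R).
  { intros m k. rewrite Rmult_assoc. apply (HB (m, k)). }
  destruct (abs_summable (zeta_term tau) _ _ HB (sums_bounded_scal K _ _ (Rlt_le _ _ HK) HW2)) as [l Hl].
  assert (Heta : eta tau = 1 + l).
  { unfold eta, weierstrass_zeta. f_equal; [field|].
    set (G := fun m => Zsum (fun k => zeta_term tau (m, k))).
    assert (HG : forall m, has_sum (fun k => zeta_term tau (m, k)) (G m)).
    { intros m. apply (has_sum_Zsum _ (fun k => K * zweight m * zweight k)%R (K * zweight m * 6)).
      - apply Hrow.
      - pose proof (zweight_pos m). apply sums_bounded_scal; [nra|apply zweight_bounded]. }
    change (Zsum G = l).
    apply (Zsum_has_sum G (fun m => K * 6 * zweight m)%R (K * 6 * 6)).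
    - intros m. pose proof (zweight_pos m).
      replace (K * 6 * zweight m)%R with (K * zweight m * 6)%R by ring.
      apply (has_sum_bound _ _ _ _ (HG m) (Hrow m)).
      apply sums_bounded_scal; [nra|apply zweight_bounded].
    - apply sums_bounded_scal; [lra|apply zweight_bounded].
    - apply (has_sum_fubini _ _ _ Hl HG). }
  (* The definition sums over n inside; swapping the coordinates puts the sum over m inside, where
     [eta_row] evaluates it. *)
  set (g := fun p : Z * Z => / 2 * (zeta_term tau (snd p, fst p) + zeta_term tau (- snd p, - fst p)%Z)).
  assert (Hg : has_sum g l).
  { replace l with (/ 2 * (l + l)) by field. apply has_sum_scal, has_sum_plus.
    - apply (has_sum_bij (fun p : Z * Z => (snd p, fst p)) (fun p => (snd p, fst p))); auto;
        intros [a b]; easy.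
    - apply (has_sum_bij (fun p : Z * Z => (- snd p, - fst p)%Z) (fun p => (- snd p, - fst p)%Z)); auto;
        intros [a b]; simpl; f_equal; lia. }
  assert (Hgb : forall n m, (Cmod (g (n, m)) <= K * zweight n * zweight m)%R).
  { intros n m. unfold g. simpl fst. simpl snd. rewrite Cmod_mult.
    assert (E2 : Cmod (/ 2) = (/ 2)%R) by (rewrite <- RtoC_inv, Cmod_R, Rabs_pos_eq by lra; easy).
    rewrite E2. pose proof (Cmod_triangle (zeta_term tau (m, n)) (zeta_term tau (- m, - n)%Z)) as HT.
    pose proof (Hrow m n) as H1. pose proof (Hrow (- m)%Z (- n)%Z) as H2.
    assert (Ez : forall k, zweight (- k) = zweight k) by (intros; unfold zweight; now rewrite Z.abs_opp).
    rewrite !Ez in H2. lra. }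
  set (H := fun n => if Z.eqb n 0 then / 4 * (PI ^ 2 / 3) - 1 else / 4 * csc2 (ZtoC n * tau)).
  assert (HH : forall n, has_sum (fun m => g (n, m)) (H n)).
  { intros n. destruct (abs_summable (fun m => g (n, m)) _ (K * zweight n * 6) (Hgb n)) as [v Hv].
    { pose proof (zweight_pos n). apply sums_bounded_scal; [nra|apply zweight_bounded]. }
    pose proof (eta_row tau n v Ht Hv) as E. fold (H n) in E. now rewrite <- E. }
  pose proof (has_sum_fubini _ _ _ Hg HH) as HsumH.
  destruct (Zsum_split H (fun n => K * 6 * zweight n)%R (K * 6 * 6) l) as [a [b [Ha [Hb Eab]]]]; auto.
  { intros n. pose proof (zweight_pos n).
    replace (K * 6 * zweight n)%R with (K * zweight n * 6)%R by ring.
    apply (has_sum_bound _ _ _ _ (HH n) (Hgb n)).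
    apply sums_bounded_scal; [nra|apply zweight_bounded]. }
  { apply sums_bounded_scal; [lra|apply zweight_bounded]. }
  apply Clim_seq in Ha, Hb.
  assert (Eq : forall i, H (- Z.of_nat (S i))%Z = H (Z.of_nat (S i))).
  { intros i. unfold H. destruct (Z.eqb_spec (- Z.of_nat (S i)) 0), (Z.eqb_spec (Z.of_nat (S i)) 0); try lia.
    rewrite ZtoC_opp. replace (- ZtoC (Z.of_nat (S i)) * tau) with (- (ZtoC (Z.of_nat (S i)) * tau)) by ring.
    now rewrite csc2_opp. }
  assert (Ea : a = H 0%Z + b).
  { apply (Clim_unique _ _ _ (Clim_shift _ _ 1 Ha)).
    refine (Clim_ext _ _ _ _ (Clim_plus _ _ _ _ (Clim_const (H 0%Z)) Hb)). intros n. cbv beta.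
    rewrite Nat.add_1_r. simpl seq. simpl lsum. f_equal. rewrite <- seq_shift, lsum_map.
    apply lsum_ext. intros i. apply Eq. }
  assert (Hlam : Clim (lambert tau) (- / PI ^ 2 * b)).
  { refine (Clim_ext _ _ _ _ (Clim_scal (- / PI ^ 2) _ _ Hb)). intros n. cbv beta.
    unfold lambert. rewrite <- lsum_scal. apply lsum_ext. intros i. rewrite Eq. unfold H.
    destruct (Z.eqb_spec (Z.of_nat (S i)) 0); [lia|]. unfold csc2.
    assert (Ei : Cexp (2 * PI * Ci * (ZtoC (Z.of_nat (S i)) * tau)) = qe tau (2 * INR i + 2)).
    { unfold qe, ZtoC. f_equal. rewrite <- INR_IZR_INZ, S_INR, !RtoC_plus, RtoC_mult. ring. }
    rewrite Ei. assert (Hq : 1 - qe tau (2 * INR i + 2) <> 0).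
    { apply one_minus_neq_0, Cmod_qe_lt_1; auto. pose proof (pos_INR i). lra. }
    field. auto. }
  exists (- / PI ^ 2 * b). split; auto.
  rewrite Heta, Eab, Ea. unfold H. simpl. field. auto.
Qed.

(** * The autonomous system *)

Lemma theta1_derivative tau x : (0 < Im tau)%R -> dtheta1 x tau = thd tau 1 1 x.
Proof.
  intros Ht. apply qderiv_C_derive. apply (qderiv_ext (thd tau 1 0)).
  - intros y. symmetry. apply theta_thd.
  - now apply qderiv_thd.
Qed.

Lemma is_derive_theta tau k x : (0 < Im tau)%R ->
  is_derive (fun y => theta k y tau) x (thd tau k 1 x).
Proof.
  intros Ht. apply qderiv_is_derive, (qderiv_ext (thd tau k 0)).
  - intros y. symmetry. apply theta_thd.
  - now apply qderiv_thd.
Qed.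

(** The three Wronskians carry the constant theta_1'(0) theta_k(0) / (theta_n(0) theta_m(0)), which
    Jacobi's formula turns into pi theta_k(0)^2. *)
Lemma theta_wronskian tau k x : (0 < Im tau)%R -> (2 <= k <= 4)%Z ->
  thd tau 1 1 x * thd tau k 0 x - thd tau 1 0 x * thd tau k 1 x =
  PI * thd tau k 0 0 ^ 2 * (thd tau (index_n k) 0 x * thd tau (index_m k) 0 x).
Proof.
  intros Ht Hk. destruct (thd_constants_nz tau Ht) as [H2 [H3 H4]].
  pose proof (jacobi_derivative_formula tau Ht) as HJ.
  assert (cancel : forall a b c : C, c <> 0 -> a * c = b * c -> a = b).
  { intros a b c Hc E. replace a with (a * c / c) by (field; auto). rewrite E. field. auto. }
  assert (Hk' : k = 2%Z \/ k = 3%Z \/ k = 4%Z) by lia. destruct Hk' as [-> | [-> | ->]].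
  - change (index_n 2) with 3%Z. change (index_m 2) with 4%Z.
    apply (cancel _ _ (thd tau 3 0 0 * thd tau 4 0 0) (Cmult_neq_0 _ _ H3 H4)).
    rewrite wronskian_12, HJ by auto. ring.
  - change (index_n 3) with 4%Z. change (index_m 3) with 2%Z.
    apply (cancel _ _ (thd tau 2 0 0 * thd tau 4 0 0) (Cmult_neq_0 _ _ H2 H4)).
    rewrite wronskian_13, HJ by auto. ring.
  - change (index_n 4) with 2%Z. change (index_m 4) with 3%Z.
    apply (cancel _ _ (thd tau 2 0 0 * thd tau 3 0 0) (Cmult_neq_0 _ _ H2 H3)).
    rewrite wronskian_14, HJ by auto. ring.
Qed.

(** The braces with eta are the value of -theta_2''(0) / (4 theta_2(0)), and the theta_2^2 term
    carries theta_1'(0)^2 / theta_2(0)^2 = pi^2 theta_3(0)^2 theta_4(0)^2. *)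
Lemma theta1_second_order_ode tau x : (0 < Im tau)%R ->
  thd tau 1 2 x * thd tau 1 0 x = thd tau 1 1 x ^ 2
    - PI ^ 2 * thd tau 3 0 0 ^ 2 * thd tau 4 0 0 ^ 2 * thd tau 2 0 x ^ 2
    - 4 * (eta tau + PI ^ 2 / 12 * (thd tau 3 0 0 ^ 4 + thd tau 4 0 0 ^ 4)) * thd tau 1 0 x ^ 2.
Proof.
  intros Ht. destruct (thd_constants_nz tau Ht) as [H2 [H3 H4]].
  pose proof (jacobi_derivative_formula tau Ht) as HJ.
  destruct (eta_lambert tau Ht) as [s [Hs He]].
  (* The two Lambert expressions match: -12 (pi^2 / 12 - 2 pi^2 s) = -pi^2 + 24 pi^2 s. *)
  assert (E3 : thd tau 1 3 0 = - 12 * eta tau * thd tau 1 1 0).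
  { rewrite (theta1_third_derivative_lambert tau s Ht Hs), He. field. }
  pose proof (theta2_second_derivative_at_0 tau (eta tau) Ht H2 H3 H4 HJ E3) as E2.
  pose proof (theta1_second_derivative tau x Ht) as E. rewrite E2, HJ in E.
  set (c2 := thd tau 2 0 0) in *. set (c3 := thd tau 3 0 0) in *. set (c4 := thd tau 4 0 0) in *.
  set (S := eta tau + PI ^ 2 / 12 * (c3 ^ 4 + c4 ^ 4)) in *.
  transitivity ((thd tau 1 2 x * thd tau 1 0 x - thd tau 1 1 x ^ 2) * c2 ^ 2 / c2 ^ 2 + thd tau 1 1 x ^ 2);
    [field; auto|].
  rewrite E. field. auto.
Qed.

(* With D(x, u) = theta_1(x + u) theta_1(x - u) theta_2(0)^2, the logarithmic derivative
   of theta_1 at x - u is (D_x - D_u) / (2 D). *)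
Lemma theta1_log_derivative_sub tau x u : (0 < Im tau)%R ->
  thd tau 1 0 x <> 0 -> thd tau 1 0 u <> 0 ->
  thd tau 1 0 (x - u) <> 0 ->
  thd tau 2 0 u ^ 2 * thd tau 1 0 x ^ 2 - thd tau 1 0 u ^ 2 * thd tau 2 0 x ^ 2 <> 0 ->
  thd tau 1 1 (x - u) / thd tau 1 0 (x - u) =
    thd tau 1 1 x / thd tau 1 0 x - thd tau 1 1 u / thd tau 1 0 u +
    PI * thd tau 2 0 0 ^ 2 / thd tau 1 0 u *
      ((thd tau 1 0 u ^ 3 * (thd tau 2 0 x * thd tau 3 0 x * thd tau 4 0 x)
        + thd tau 2 0 u * thd tau 3 0 u * thd tau 4 0 u * thd tau 1 0 x ^ 3)
       / (thd tau 1 0 x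
          * (thd tau 2 0 u ^ 2 * thd tau 1 0 x ^ 2 - thd tau 1 0 u ^ 2 * thd tau 2 0 x ^ 2))).
Proof.
  intros Ht Hx Hu Hxu HD.
  pose proof (theta_addition tau x u Ht) as EA.
  pose proof (fun y => theta_addition tau y u Ht) as Ex.
  pose proof (fun y => theta_addition tau x y Ht) as Eu.
  set (c := thd tau 2 0 0 ^ 2) in *.
  assert (Hshift : forall y, qderiv (fun z => thd tau 1 0 (z + u)) y (thd tau 1 1 (y + u))).
  { intros y. apply (qderiv_ext (fun z => thd tau 1 0 (u + z))); [intros; f_equal; ring|].
    rewrite (Cplus_comm y u). now apply qderiv_thd_add. }
  assert (Hshift' : forall y, qderiv (fun z => thd tau 1 0 (z - u)) y (thd tau 1 1 (y - u))).
  { intros y. apply (qderiv_ext (fun z => thd tau 1 0 (- u + z))); [intros; f_equal; ring|].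
    replace (y - u) with (- u + y) by ring. now apply qderiv_thd_add. }
  assert (Dx : c * (thd tau 1 1 (x + u) * thd tau 1 0 (x - u) + thd tau 1 0 (x + u) * thd tau 1 1 (x - u)) =
    thd tau 2 0 u ^ 2 * (2 * (thd tau 1 0 x * thd tau 1 1 x)) -
    thd tau 1 0 u ^ 2 * (2 * (thd tau 2 0 x * thd tau 2 1 x))).
  { apply (qderiv_unique (fun y => thd tau 2 0 u ^ 2 * thd tau 1 0 y ^ 2 - thd tau 1 0 u ^ 2 * thd tau 2 0 y ^ 2) x).
    - apply (qderiv_ext (fun y => c * (thd tau 1 0 (y + u) * thd tau 1 0 (y - u)))).
      + intros y. transitivity (thd tau 1 0 (y + u) * thd tau 1 0 (y - u) * c); [ring|].
        rewrite Ex. ring.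
      + apply qderiv_scal. exact (qderiv_mult _ _ _ _ _ (Hshift x) (Hshift' x)).
    - apply qderiv_minus; apply qderiv_scal; now apply qderiv_thd_sqr. }
  assert (Du : c * (thd tau 1 1 (x + u) * thd tau 1 0 (x - u) + thd tau 1 0 (x + u) * - thd tau 1 1 (x - u)) =
    thd tau 1 0 x ^ 2 * (2 * (thd tau 2 0 u * thd tau 2 1 u)) -
    thd tau 2 0 x ^ 2 * (2 * (thd tau 1 0 u * thd tau 1 1 u))).
  { apply (qderiv_unique (fun y => thd tau 1 0 x ^ 2 * thd tau 2 0 y ^ 2 - thd tau 2 0 x ^ 2 * thd tau 1 0 y ^ 2) u).
    - apply (qderiv_ext (fun y => c * (thd tau 1 0 (x + y) * thd tau 1 0 (x - y)))).
      + intros y. rewrite <- Eu. ring.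
      + apply qderiv_scal.
        exact (qderiv_mult _ _ _ _ _ (qderiv_thd_add tau 1 0 x u Ht) (qderiv_thd_sub tau 1 0 x u Ht)).
    - apply qderiv_minus; apply qderiv_scal; now apply qderiv_thd_sqr. }
  pose proof (theta_wronskian tau 2 x Ht ltac:(lia)) as Wx.
  pose proof (theta_wronskian tau 2 u Ht ltac:(lia)) as Wu.
  change (index_n 2) with 3%Z in Wx, Wu. change (index_m 2) with 4%Z in Wx, Wu. fold c in Wx, Wu.
  set (D := thd tau 2 0 u ^ 2 * thd tau 1 0 x ^ 2 - thd tau 1 0 u ^ 2 * thd tau 2 0 x ^ 2) in *.
  assert (ED : thd tau 1 0 (x + u) * thd tau 1 0 (x - u) * c = D) by (rewrite EA; unfold D; ring).
  assert (E : 2 * (c * (thd tau 1 0 (x + u) * thd tau 1 1 (x - u))) =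
    thd tau 2 0 u ^ 2 * (2 * (thd tau 1 0 x * thd tau 1 1 x)) -
    thd tau 1 0 u ^ 2 * (2 * (thd tau 2 0 x * thd tau 2 1 x)) -
    (thd tau 1 0 x ^ 2 * (2 * (thd tau 2 0 u * thd tau 2 1 u)) -
    thd tau 2 0 x ^ 2 * (2 * (thd tau 1 0 u * thd tau 1 1 u)))).
  { rewrite <- Dx, <- Du. ring. }
  (* D is the product of theta_1(x + u), theta_1(x - u) and c, so D <> 0 rules out zeros of each. *)
  assert (Nz : thd tau 1 0 (x + u) <> 0).
  { intros X. apply HD. rewrite <- ED, X. ring. }
  assert (Nc : c <> 0).
  { intros X. apply HD. rewrite <- ED, X. ring. }
  (* The derivatives of theta_2 at x and u are eliminated by the Wronskians. This produces theta_3
     theta_4 in the numerator, and the terms with theta_1' collect into multiples of D. *)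
  assert (E2x : thd tau 2 1 x = (thd tau 1 1 x * thd tau 2 0 x - PI * c * (thd tau 3 0 x * thd tau 4 0 x)) / thd tau 1 0 x).
  { rewrite <- Wx. field. auto. }
  assert (E2u : thd tau 2 1 u = (thd tau 1 1 u * thd tau 2 0 u - PI * c * (thd tau 3 0 u * thd tau 4 0 u)) / thd tau 1 0 u).
  { rewrite <- Wu. field. auto. }
  transitivity (2 * (c * (thd tau 1 0 (x + u) * thd tau 1 1 (x - u))) / (2 * D)).
  { rewrite <- ED. field. auto. }
  rewrite E, E2x, E2u. unfold D in *. field. repeat split; auto. now rewrite !Cpow_mult_l.
Qed.

Theorem theorem7p1 : forall tau u h : C,
  (0 < Im tau)%R ->
  ~ (exists a b : Z, u = ZtoC a * tau + ZtoC b) ->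
  let th := fun (k : Z) (x : C) => theta k x tau in
  let th1' := fun x : C => dtheta1 x tau in
  let c := fun k : Z => vartheta k tau in
  let Lam := fun x : C => Lambda x u h tau in
  (forall x : C, is_derive (th 1%Z) x (th1' x))
  /\
  (forall (k : Z) (x : C), (2 <= k <= 4)%Z -> th 1%Z x <> 0 ->
     is_derive (th k) x
       (th1' x / th 1%Z x * th k x
        - PI * c k ^ 2 * (th (index_n k) x * th (index_m k) x / th 1%Z x)))
  /\
  (forall x : C, th 1%Z x <> 0 ->
     is_derive th1' x
       (th1' x ^ 2 / th 1%Z x
        - PI ^ 2 * c 3%Z ^ 2 * c 4%Z ^ 2 * (th 2%Z x ^ 2 / th 1%Z x)
        - 4 * (eta tau + PI ^ 2 / 12 * (c 3%Z ^ 4 + c 4%Z ^ 4)) * th 1%Z x))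
  /\
  (forall x : C,
     Lam x <> 0 ->
     th 1%Z x <> 0 ->
     th 2%Z u ^ 2 * th 1%Z x ^ 2 - th 1%Z u ^ 2 * th 2%Z x ^ 2 <> 0 ->
     exists dLam : C, is_derive Lam x dLam /\
       / Lam x * dLam =
         th1' x / th 1%Z x
         + PI * c 2%Z ^ 2 / th 1%Z u
           * ((th 1%Z u ^ 3 * (th 2%Z x * th 3%Z x * th 4%Z x)
               + th 2%Z u * th 3%Z u * th 4%Z u * th 1%Z x ^ 3)
              / (th 1%Z x
                 * (th 2%Z u ^ 2 * th 1%Z x ^ 2 - th 1%Z u ^ 2 * th 2%Z x ^ 2)))
         + h).
Proof.
  intros tau u h Ht Hu th th1' c Lam.
  assert (Eth : forall k x, th k x = thd tau k 0 x) by exact (fun k x => theta_thd tau k x).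
  assert (Eth1 : forall x, th1' x = thd tau 1 1 x) by exact (fun x => theta1_derivative tau x Ht).
  assert (Ec : forall k, c k = thd tau k 0 0) by exact (fun k => theta_thd tau k 0).
  clearbody th1' c.
  split; [|split; [|split]].
  - intros x. rewrite Eth1. now apply is_derive_theta.
  - intros k x Hk Hx. rewrite Eth1, Ec, !Eth. rewrite Eth in Hx.
    replace (thd tau 1 1 x / thd tau 1 0 x * thd tau k 0 x - _) with (thd tau k 1 x).
    + now apply is_derive_theta.
    + transitivity ((thd tau 1 1 x * thd tau k 0 x -
        (thd tau 1 1 x * thd tau k 0 x - thd tau 1 0 x * thd tau k 1 x)) / thd tau 1 0 x); [field; auto|].
      rewrite theta_wronskian by auto. field. auto.
  - intros x Hx. rewrite Eth1, !Ec, !Eth. rewrite Eth in Hx.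
    apply qderiv_is_derive, (qderiv_ext (thd tau 1 1)); [intros; now rewrite Eth1|].
    pose proof (theta1_second_order_ode tau x Ht) as E.
    match goal with |- qderiv _ _ ?v => replace v with (thd tau 1 2 x) end; [now apply qderiv_thd|].
    transitivity (thd tau 1 2 x * thd tau 1 0 x / thd tau 1 0 x); [field; auto|].
    rewrite E. field. auto.
  - intros x HL Hx HD. pose proof (theta1_nz tau u Ht Hu) as Hu0.
    set (b := dtheta1 u tau / theta 1 u tau).
    set (e := fun y : C => Cexp (b * y + h * y)).
    assert (EL : forall y, Lam y = thd tau 1 0 (y - u) * e y).
    { intros y. unfold Lam, Lambda. now rewrite theta_thd. }
    assert (Eb : b = thd tau 1 1 u / thd tau 1 0 u).
    { unfold b. now rewrite theta_thd, theta1_derivative. }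
    assert (He : qderiv e x ((b + h) * e x)).
    { apply (qderiv_ext (fun y => Cexp ((b + h) * y + 0))).
      - intros y. unfold e. f_equal. ring.
      - replace ((b + h) * e x) with ((b + h) * Cexp ((b + h) * x + 0)).
        + apply qderiv_affine, qderiv_Cexp.
        + unfold e. do 2 f_equal. ring. }
    assert (Ht1 : qderiv (fun y => thd tau 1 0 (y - u)) x (thd tau 1 1 (x - u))).
    { apply (qderiv_ext (fun y => thd tau 1 0 (- u + y))); [intros; f_equal; ring|].
      replace (x - u) with (- u + x) by ring. now apply qderiv_thd_add. }
    exists (thd tau 1 1 (x - u) * e x + thd tau 1 0 (x - u) * ((b + h) * e x)). split.
    + apply qderiv_is_derive. apply (qderiv_ext (fun y => thd tau 1 0 (y - u) * e y)); auto.
      exact (qderiv_mult _ _ _ _ _ Ht1 He).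
    + assert (Hxu : thd tau 1 0 (x - u) <> 0).
      { intros X. apply HL. rewrite EL, X. ring. }
      assert (He0 : e x <> 0) by apply Cexp_nz.
      rewrite EL, Eth1, !Eth, Ec. rewrite !Eth in HD. rewrite Eth in Hx.
      (* The exponent b = theta_1'(u) / theta_1(u) in Lambda cancels the u-part of the logarithmic
         derivative of theta_1(x - u). *)
      transitivity (thd tau 1 1 (x - u) / thd tau 1 0 (x - u) + b + h); [field; auto|].
      rewrite (theta1_log_derivative_sub tau x u) by auto. rewrite Eb. ring.
Qed.
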